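(* Let $A$ be a unital separable C*-algebra, $\alpha$ a *-automorphism of $A$, and $\{n_k\}_{k\ge 1}$ an increasing sequence of positive integers with $n_k\mid n_{k+1}$ for all $k$. Then the algebra $\mathcal{B}_{\alpha}(\{n_k\})$ has a unique tracial state $\tau$ if and only if $A$ has an $\alpha$-invariant tracial state $\tau_0$ such that, for every $k\ge 1$, $\tau_0$ is the unique $\alpha^{n_k}$-invariant tracial state on $A$. Moreover, in this case, $\tau$ is faithful if and only if $\tau_0$ is faithful.
   Context: For $n\ge 1$, $A\times_{\alpha^n}\mathbb{Z}$ denotes the crossed product C*-algebra, generated by $A$ and a unitary $u_n$ with $u_n a u_n^*=\alpha^n(a)$ for $a\in A$. Put $\mathcal{B}_\alpha(n)=M_n(A\times_{\alpha^n}\mathbb{Z})$, with matrix units $e_{i,j}$, $0\le i,j\le n-1$. If $n\mid m$ and $k=m/n$, let $\gamma_{n,m}:\mathcal{B}_\alpha(n)\to\mathcal{B}_\alpha(m)$ be the injective unital *-homomorphism determined by $\gamma_{n,m}(ae_{0,0})=\sum_{l=0}^{k-1}\alpha^{ln}(a)e_{ln,ln}$ for $a\in A$, $\gamma_{n,m}(u_ne_{0,0})=u_me_{(k-1)n,0}+\sum_{l=0}^{k-2}e_{ln,(l+1)n}$, and $\gamma_{n,m}(e_{i,j})=\sum_{l=0}^{k-1}e_{i+ln,j+ln}$ for $0\le i,j\le n-1$. For an increasing sequence $\{n_k\}$ of positive integers with $n_k\mid n_{k+1}$, the Bunce-Deddens algebra of $\alpha$ is the C*-algebraic direct limit $\mathcal{B}_\alpha(\{n_k\})=\varinjlim(\mathcal{B}_\alpha(n_k),\gamma_{n_k,n_{k+1}})$.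 *)

(* Defs.v *)
From HB Require Import structures.
From mathcomp Require Import all_boot all_order all_algebra.
From mathcomp Require Export complex.
From mathcomp Require Import all_classical all_reals all_analysis.

Set Implicit Arguments.
Unset Strict Implicit.
Unset Printing Implicit Defensive.

Import Order.TTheory GRing.Theory Num.Theory.
Import numFieldNormedType.Exports.

Local Open Scope classical_set_scope.
Local Open Scope ring_scope.

(* Unital complex *-algebras; the complex numbers are R[i] for R : realType.
   As everywhere in the algebraic hierarchy, algType includes 1 != 0. *)
HB.mixin Record isStarAlgebra (R : realType) A of GRing.Algebra R[i] A := {
  star : A -> A ;
  starK : involutive star ;
  starD : forall x y : A, star (x + y) = star x + star y ;
  starM : forall x y : A, star (x * y) = star y * star x ;
  starZ : forall (c : R[i]) (x : A), star (c *: x) = c^* *: star x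
}.

#[short(type="starAlgType")]
HB.structure Definition StarAlgebra (R : realType) :=
  {A of GRing.Algebra R[i] A & isStarAlgebra R A}.

HB.mixin Record isNormedStarAlgebra (R : realType) A of StarAlgebra R A := {
  cnorm : A -> R[i] ;
  cnormD : forall x y : A, cnorm (x + y) <= cnorm x + cnorm y ;
  cnormZ : forall (c : R[i]) (x : A), cnorm (c *: x) = `|c| * cnorm x ;
  cnorm0_eq0 : forall x : A, cnorm x = 0 -> x = 0 ;
  cnormM : forall x y : A, cnorm (x * y) <= cnorm x * cnorm y
}.

#[short(type="normedStarAlgType")]
HB.structure Definition NormedStarAlgebra (R : realType) :=
  {A of StarAlgebra R A & isNormedStarAlgebra R A}.

(* The normed vector space underlying A, with its norm topology.  It is an
   alias because the hierarchy has no join of rings and normed modules below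
   numDomainType, so that no type can be given both structures. *)
Definition normed_space (R : realType) (A : normedStarAlgType R) : Type := A.

HB.instance Definition _ (R : realType) (A : normedStarAlgType R) :=
  GRing.Lmodule.copy (normed_space A) A.
HB.instance Definition _ (R : realType) (A : normedStarAlgType R) :=
  Lmodule_isNormed.Build R[i] (normed_space A)
    (@cnormD R A) (@cnormZ R A) (@cnorm0_eq0 R A).

HB.mixin Record isCStarAlgebra (R : realType) A of NormedStarAlgebra R A := {
  cstar_cauchy_cvg : forall F : set_system (normed_space A),
    ProperFilter F -> cauchy F -> cvg F ;
  cnorm_star_mul : forall x : A, cnorm (star x * x) = cnorm x ^+ 2
}.

#[short(type="cstarAlgType")]
HB.structure Definition CStarAlgebra (R : realType) :=
  {A of NormedStarAlgebra R A & isCStarAlgebra R A}.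

HB.instance Definition _ (R : realType) (A : cstarAlgType R) :=
  Uniform_isComplete.Build (normed_space A) (@cstar_cauchy_cvg R A).

Definition star_hom (R : realType) (A B : starAlgType R) (f : A -> B) : Prop :=
  [/\ linear f, monoid_morphism f & {morph f : x / star x}].

Definition star_automorphism (R : realType) (A : starAlgType R) (f : A -> A)
    : Prop :=
  star_hom f /\ bijective f.

Definition unitary (R : realType) (A : starAlgType R) (u : A) : Prop :=
  star u * u = 1 /\ u * star u = 1.

Definition separable_space (T : topologicalType) : Prop :=
  exists D : set T, countable D /\ dense D.

(* For a unital algebra, a state is a positive linear functional with value 1
   at the unit; the order of R[i] makes 0 <= z mean that z is real and
   nonnegative. *)
Definition tracial_state (R : realType) (A : starAlgType R) (tau : A -> R[i])
    : Prop :=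
  [/\ scalar tau,
      forall x : A, 0 <= tau (star x * x),
      tau 1 = 1
    & forall x y : A, tau (x * y) = tau (y * x)].

Definition invariant_tracial_state (R : realType) (A : starAlgType R)
    (f : A -> A) (tau : A -> R[i]) : Prop :=
  tracial_state tau /\ forall x : A, tau (f x) = tau x.

Definition faithful (R : realType) (A : starAlgType R) (tau : A -> R[i])
    : Prop :=
  forall x : A, tau (star x * x) = 0 -> x = 0.

(* The *-algebra of n x n matrices over A, for n > 0 (as for {'GL_n[R]}, the
   format n.-1.+1 makes the ring nontrivial).  'M[A]_n already carries the
   scaling by A; the alias carries the scaling by complex numbers and the
   conjugate transpose. *)
Definition mxalg (R : realType) (A : starAlgType R) (n : nat) : Type :=
  'M[A]_n.-1.+1.

Section MatrixStarAlgebra.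
Context (R : realType) (A : starAlgType R) (n : nat).

HB.instance Definition _ := GRing.NzRing.copy (mxalg A n) 'M[A]_n.-1.+1.

Definition mxalg_scale (c : R[i]) (M : mxalg A n) : mxalg A n :=
  map_mx (fun x : A => c *: x) (M : 'M[A]_n.-1.+1).

Definition mxalg_star (M : mxalg A n) : mxalg A n :=
  (map_mx (fun x : A => star x) (M : 'M[A]_n.-1.+1))^T.

Fact mxalg_scaleA c d M :
  mxalg_scale c (mxalg_scale d M) = mxalg_scale (c * d) M.
Proof. by apply/matrixP => i j; rewrite !mxE scalerA. Qed.

Fact mxalg_scale1 : left_id 1 mxalg_scale.
Proof. by move=> M; apply/matrixP => i j; rewrite !mxE scale1r. Qed.

Fact mxalg_scaleDr : right_distributive mxalg_scale +%R.
Proof. by move=> c M N; apply/matrixP => i j; rewrite !mxE scalerDr. Qed.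

Fact mxalg_scaleDl M : {morph mxalg_scale^~ M : c d / c + d}.
Proof. by move=> c d; apply/matrixP => i j; rewrite !mxE scalerDl. Qed.

HB.instance Definition _ := GRing.Zmodule_isLmodule.Build R[i] (mxalg A n)
  mxalg_scaleA mxalg_scale1 mxalg_scaleDr mxalg_scaleDl.

Fact star_sum (I : Type) (r : seq I) (F : I -> A) :
  star (\sum_(i <- r) F i) = \sum_(i <- r) star (F i).
Proof.
have star0 : star (0 : A) = 0.
  by apply: (addrI (star (0 : A))); rewrite -starD !addr0.
exact: (big_morph _ (@starD R A) star0).
Qed.

Fact mxalg_starK : involutive mxalg_star.
Proof. by move=> M; apply/matrixP => i j; rewrite !mxE starK. Qed.

Fact mxalg_starD M N : mxalg_star (M + N) = mxalg_star M + mxalg_star N.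
Proof. by apply/matrixP => i j; rewrite !mxE starD. Qed.

Fact mxalg_starM M N : mxalg_star (M * N) = mxalg_star N * mxalg_star M.
Proof.
apply/matrixP => i j; rewrite !mxE star_sum; apply: eq_bigr => k _.
by rewrite !mxE starM.
Qed.

Fact mxalg_starZ (c : R[i]) (M : mxalg A n) :
  mxalg_star (c *: M) = c^* *: mxalg_star M.
Proof. by apply/matrixP => i j; rewrite !mxE starZ. Qed.

Fact mxalg_scalerAl (c : R[i]) (M N : mxalg A n) : c *: (M * N) = (c *: M) * N.
Proof.
apply/matrixP => i j; rewrite !mxE scaler_sumr; apply: eq_bigr => k _.
by rewrite !mxE scalerAl.
Qed.

Fact mxalg_scalerAr (c : R[i]) (M N : mxalg A n) : c *: (M * N) = M * (c *: N).
Proof.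
apply/matrixP => i j; rewrite !mxE scaler_sumr; apply: eq_bigr => k _.
by rewrite !mxE scalerAr.
Qed.

HB.instance Definition _ :=
  GRing.Lmodule_isLalgebra.Build R[i] (mxalg A n) mxalg_scalerAl.
HB.instance Definition _ :=
  GRing.Lalgebra_isAlgebra.Build R[i] (mxalg A n) mxalg_scalerAr.
HB.instance Definition _ := isStarAlgebra.Build R (mxalg A n)
  mxalg_starK mxalg_starD mxalg_starM mxalg_starZ.

(* The matrix x e_{i,j}, with indices counted from 0; it is used below only
   for i, j < n. *)
Definition single_mx (x : A) (i j : nat) : mxalg A n :=
  \matrix_(p < n.-1.+1, q < n.-1.+1) (if (p == i :> nat) && (q == j :> nat) then x else 0).

End MatrixStarAlgebra.
Arguments single_mx {R A} n x i j.

Definition star_subalgebra (R : realType) (A : starAlgType R) (S : set A)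
    : Prop :=
  [/\ S 1,
      forall (c : R[i]) (x y : A), S x -> S y -> S (c *: x + y),
      forall x y : A, S x -> S y -> S (x * y)
    & forall x : A, S x -> S (star x)].

Definition covariant (R : realType) (A B : starAlgType R) (beta : A -> A)
    (pi : A -> B) (u : B) : Prop :=
  [/\ star_hom pi, unitary u
    & forall a : A, u * pi a * star u = pi (beta a)].

(* (B, pi, u) is the crossed product of A by the action of the integers
   generated by beta: B is generated by the covariant pair (pi, u), through
   which every other covariant pair factors. *)
Definition crossed_product (R : realType) (A : cstarAlgType R) (beta : A -> A)
    (B : cstarAlgType R) (pi : A -> B) (u : B) : Prop :=
  [/\ covariant beta pi u,
      forall S : set B,
        star_subalgebra S -> closed (S : set (normed_space B)) ->
        (forall a : A, S (pi a)) -> S u -> S = setT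
    & forall (C : cstarAlgType R) (rho : A -> C) (v : C),
        covariant beta rho v ->
        exists2 f : B -> C, star_hom f &
          (forall a : A, f (pi a) = rho a) /\ f u = v].

(* The connecting map gamma_{n,m}, for n dividing m. *)
Definition bd_connecting (R : realType) (A : starAlgType R) (alpha : A -> A)
    (n m : nat) (Bn Bm : starAlgType R) (pin : A -> Bn) (un : Bn)
    (pim : A -> Bm) (um : Bm) (gamma : mxalg Bn n -> mxalg Bm m) : Prop :=
  let k := (m %/ n)%N in
  [/\ star_hom gamma, injective gamma,
      forall a : A, gamma (single_mx n (pin a) 0 0) =
        \sum_(l < k) single_mx m (pim (iter (l * n) alpha a)) (l * n) (l * n),
      gamma (single_mx n un 0 0) =
        single_mx m um (k.-1 * n) 0
        + \sum_(l < k.-1) single_mx m 1 (l * n) (l.+1 * n)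
    & forall i j : 'I_n, gamma (single_mx n 1 i j) =
        \sum_(l < k) single_mx m 1 (i + l * n) (j + l * n)].

(* C*-algebraic direct limit of a sequence of *-algebras M k that each carry a
   (necessarily unique) complete C*-norm, such as matrix algebras over
   C*-algebras: *-homomorphisms from M k into C*-algebras are automatically
   contractive, so the norm of M k does not enter the universal property. *)
Definition cstar_direct_limit (R : realType) (M : nat -> starAlgType R)
    (gamma : forall k, M k -> M k.+1)
    (L : cstarAlgType R) (iota : forall k, M k -> L) : Prop :=
  [/\ forall k, star_hom (@iota k),
      forall k (x : M k), iota k.+1 (gamma k x) = iota k x
    & forall (C : cstarAlgType R) (phi : forall k, M k -> C),
        (forall k, star_hom (@phi k)) ->
        (forall k (x : M k), phi k.+1 (gamma k x) = phi k x) ->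
        exists! f : L -> C,
          star_hom f /\ forall k (x : M k), f (iota k x) = phi k x].

(* L is the Bunce-Deddens algebra of alpha for the sequence n; the crossed
   products and the limit are given by their universal properties, hence up to
   isomorphism. *)
Definition bunce_deddens (R : realType) (A : cstarAlgType R) (alpha : A -> A)
    (n : nat -> nat) (L : cstarAlgType R) : Prop :=
  exists (B : nat -> cstarAlgType R) (pi : forall k, A -> B k)
         (u : forall k, B k)
         (gamma : forall k, mxalg (B k) (n k) -> mxalg (B k.+1) (n k.+1))
         (iota : forall k, mxalg (B k) (n k) -> L),
    [/\ forall k, crossed_product (iter (n k) alpha) (pi k) (u k),
        forall k, bd_connecting alpha (pi k) (u k) (pi k.+1) (u k.+1) (@gamma k)
      & cstar_direct_limit gamma iota].

(* Main.v *)
(* A state phi of A extends, through a regular representation of the crossed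
   product on functions Z -> A, to a positive functional Phi with
   Phi(a u^m) = phi(a) if m = 0 and 0 otherwise. When phi is an invariant trace,
   so is Phi, and the normalised matrix traces Tr(Phi)/n_k are compatible with the
   connecting maps; since phi is then invariant under all later powers of alpha, an
   alpha^(n_k)-invariant trace on A therefore extends to a trace on the limit.
   Conversely a trace on the limit restricts, through the corner e_00 at level k,
   to an alpha^(n_k)-invariant trace on A. It vanishes on every monomial a u^j e_00
   with j > 0: pushed to level k+1, the diagonal part of that monomial only contains
   the powers u^(j/K) with K = n_(k+1)/n_k > 1, so induction on j applies. Hence the
   trace is determined by its restrictions to the copies of A, which gives the
   equivalence.
   For faithfulness of the extension, averaging over Folner sets of Z shows that Phi
   is faithful when phi is; then the GNS representation of tau is injective on every
   M_(n_k)(B_k), hence isometric there, hence injective on the closure of their union.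
   Conversely, if tau_0(a* a) = 0 and tau is faithful, then a e_00 is zero in the
   limit; a state phi of A with phi(a* a) = |a|^2 extends to the limit and gives
   a = 0. *)
Require Import Defs.
From HB Require Import structures.
From mathcomp Require Import all_boot all_order all_algebra complex.
From mathcomp Require Import all_classical all_reals all_analysis.
From mathcomp Require Import finmap ring lra zify.
From Stdlib Require Ncring Ncring_tac.

Set Implicit Arguments.
Unset Strict Implicit.
Unset Printing Implicit Defensive.

Import Order.TTheory GRing.Theory Num.Theory.
Import numFieldNormedType.Exports.

Local Open Scope classical_set_scope.
Local Open Scope ring_scope.
Local Notation "r %:C" := (real_complex _ r) : ring_scope.

(** Crossed products and limits are known here only through universal properties, which produce
    homomorphisms into C*-algebras. Functionals with prescribed values are therefore obtained as
    vector functionals of representations, so a C*-algebra of operators on a Hilbert space is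
    constructed; positivity, norm-attaining states and automatic contractivity come from the
    C*-identity and an iterated square root in place of spectral theory. Elements of a crossed
    product have no coordinates, so functionals are compared on monomials and the conditional
    expectation is recovered as the element on which all extended functionals agree. Uniqueness on
    the limit yields more than uniqueness on A: every alpha^(n_k)-invariant trace extends, its
    extension must be tau, and so it is the restriction of tau at level k. Applied to that
    restriction composed with alpha, this gives alpha-invariance; and an alpha-invariant restriction
    is admissible at all levels, so all restrictions coincide. *)

Section NoncommutativeRing.
Context (A : nzRingType).
#[export] Instance nzops : @Ncring.Ring_ops A 0 1 (@GRing.add A) (@GRing.mul A)
  (fun x y => x - y) (@GRing.opp A) (@eq A) := {}.
#[export] Instance nzring : Ncring.Ring (Ro := nzops).
Proof.
split; try by (repeat intro; subst).
- by split=> // x y z ->.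
- by move=> x y -> z t ->.
- by move=> x y -> z t ->.
- by move=> x y -> z t ->.
- by move=> x y ->.
- exact: add0r.
- exact: addrC.
- exact: addrA.
- exact: mul1r.
- exact: mulr1.
- exact: mulrA.
- exact: mulrDl.
- by move=> x y z; exact: mulrDr.
- exact: subrr.
Qed.
End NoncommutativeRing.
Existing Instance nzops.
Existing Instance nzring.

(* Ring operations reach the goal through different instance paths; the ring
   normaliser recognises only one of them. *)
Ltac ncring_normalize S t :=
  lazymatch t with
  | @Algebra.add _ ?a ?b =>
      let a := ncring_normalize S a in let b := ncring_normalize S b in
      constr:(@GRing.add S a b)
  | @GRing.mul _ ?a ?b =>
      let a := ncring_normalize S a in let b := ncring_normalize S b in
      constr:(@GRing.mul S a b)
  | @Algebra.opp _ ?a =>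
      let a := ncring_normalize S a in constr:(@GRing.opp S a)
  | @Algebra.zero _ => constr:(@GRing.zero S)
  | @GRing.one _ => constr:(@GRing.one S)
  | _ => t
  end.
Ltac ncring :=
  lazymatch goal with |- @eq ?T ?a ?b =>
    let S := constr:(T : nzRingType) in
    let S := lazymatch S with ?S => S end in
    let a := ncring_normalize S a in
    let b := ncring_normalize S b in
    change (@eq (GRing.NzRing.sort S) a b); Ncring_tac.non_commutative_ring
  end.

(** * Norms and square roots *)

Section NormBasics.
Context {R : realType} {A : normedStarAlgType R}.
Implicit Types (x y z : A) (c : R[i]) (r : R).

Lemma cnormN x : cnorm (- x) = cnorm x.
Proof. by rewrite -scaleN1r cnormZ normrN1 mul1r. Qed.

Lemma cnorm_zero : cnorm (0 : A) = 0.
Proof. by rewrite -(scale0r (0 : A)) cnormZ normr0 mul0r. Qed.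

Lemma cnorm_ge0 x : 0 <= cnorm x.
Proof.
have := cnormD x (- x); rewrite subrr cnorm_zero cnormN -mulr2n.
by rewrite pmulrn_lge0.
Qed.

(** [cnorm] takes values in R[i]; being nonnegative, it is determined by its real part, and real
    inequalities become accessible to [lra] and [nra]. *)
Definition nrm x : R := complex.Re (cnorm x).

Lemma nrmE x : (nrm x)%:C = cnorm x.
Proof. by rewrite RRe_real // realE cnorm_ge0. Qed.

Lemma nrm_ge0 x : 0 <= nrm x.
Proof. by rewrite -lecR nrmE cnorm_ge0. Qed.

Lemma nrm0 : nrm (0 : A) = 0.
Proof. by rewrite /nrm cnorm_zero. Qed.

Lemma nrm0_eq0 x : nrm x = 0 -> x = 0.
Proof. by move=> x0; apply: cnorm0_eq0; rewrite -nrmE x0. Qed.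

Lemma nrmN x : nrm (- x) = nrm x.
Proof. by rewrite /nrm cnormN. Qed.

Lemma nrmD x y : nrm (x + y) <= nrm x + nrm y.
Proof. by rewrite -lecR rmorphD /= !nrmE cnormD. Qed.

Lemma nrmB x y : nrm (x - y) <= nrm x + nrm y.
Proof. by rewrite (le_trans (nrmD _ _)) // nrmN. Qed.

Lemma nrmBC x y : nrm (x - y) = nrm (y - x).
Proof. by rewrite -nrmN opprB. Qed.

Lemma nrm_tri x y z : nrm (x - z) <= nrm (x - y) + nrm (y - z).
Proof. by rewrite (le_trans _ (nrmD _ _)) // subrKA. Qed.

Lemma nrmM x y : nrm (x * y) <= nrm x * nrm y.
Proof. by rewrite -lecR rmorphM /= !nrmE cnormM. Qed.

Lemma nrmZ c x : nrm (c *: x) = complex.Re `|c| * nrm x.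
Proof.
have h : (complex.Re `|c|)%:C = `|c| by rewrite RRe_real // realE normr_ge0.
by apply: complexI; rewrite rmorphM nrmE cnormZ -nrmE -h.
Qed.

Lemma nrmZr r x : nrm (r%:C *: x) = `|r| * nrm x.
Proof. by rewrite nrmZ normc_def /= expr0n /= addr0 sqrtr_sqr. Qed.

(** Convergence, Cauchy sequences and closed sets are expressed through [nrm] on the algebra itself,
    since the topology lives only on the alias [normed_space]. *)
Definition ncvg (u : nat -> A) (l : A) :=
  forall e : R, 0 < e -> \forall n \near \oo, nrm (u n - l) < e.

Definition ncauchy (u : nat -> A) :=
  forall e : R, 0 < e -> exists N, forall m n, (N <= m)%N -> (N <= n)%N ->
    nrm (u m - u n) < e.

Definition nclosed (S : set A) :=
  forall x, (forall e : R, 0 < e -> exists2 y, S y & nrm (x - y) < e) -> S x.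

Lemma nclosed_ncvg S u l : nclosed S -> (forall n, S (u n)) -> ncvg u l -> S l.
Proof.
move=> clS Su ul; apply: clS => e e0; have [N _ uN] := ul e e0.
by exists (u N) => //; rewrite nrmBC; apply: uN => /=.
Qed.

Lemma nbhs_nrmP (x : A) (P : set A) :
  nbhs (x : normed_space A) P <->
  exists2 e : R, 0 < e & forall y, nrm (x - y) < e -> P y.
Proof.
split.
  move=> /nbhs_ballP[e /= e0 Pe]; exists (complex.Re e).
    by move: e0; rewrite ltcE => /andP[].
  move=> y xy; apply: Pe; rewrite -ball_normE /ball_ /=.
  move: (e0); rewrite ltcE => /andP[/eqP Ime _].
  have := xy; rewrite -ltcR nrmE => /lt_le_trans; apply.
  by rewrite lecE /= Ime eqxx lexx.
move=> [e e0 Pe]; apply/nbhs_ballP; exists e%:C => /=; first by rewrite ltcR.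
by move=> y; rewrite -ball_normE /ball_ /= => xy; apply: Pe; rewrite -ltcR nrmE.
Qed.

Lemma nclosedP (S : set A) : nclosed S <-> closed (S : set (normed_space A)).
Proof.
split.
  move=> clS x Sx; apply: clS => e e0.
  have /Sx[y [Sy xy]] : nbhs (x : normed_space A) [set y | nrm (x - y) < e].
    by apply/nbhs_nrmP; exists e.
  by exists y.
move=> clS x Sx; apply: clS => P /nbhs_nrmP[e e0 Pe].
by have [y Sy xy] := Sx e e0; exists y; split => //; exact: Pe.
Qed.

End NormBasics.

Section Complete.
Context {R : realType} {A : normedStarAlgType R}.

(** Centres of balls of radius 1/(n+1) belonging to the filter form a Cauchy sequence, and its limit
    is a limit of the filter. This reduces the completeness axiom of each new C*-algebra to
    sequences. *)
Lemma cauchy_filter_cvg :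
  (forall u : nat -> A, ncauchy u -> exists l, ncvg u l) ->
  forall F : set_system (normed_space A), ProperFilter F -> cauchy F -> cvg F.
Proof.
move=> compl F PF /cauchyP cF.
have pick n : {x : A | F [set y : normed_space A | nrm (x - y) < n.+1%:R^-1]}.
  apply: cid; have e0 : (0 : R[i]) < (n.+1%:R^-1 : R)%:C by rewrite ltcR invr_gt0.
  have [x Fx] := cF _ e0; exists x; apply: filterS Fx => y.
  by rewrite -ball_normE /ball_ /= => xy; rewrite -ltcR nrmE.
pose u n := sval (pick n).
have uc : forall m n, nrm (u m - u n) < m.+1%:R^-1 + n.+1%:R^-1.
  move=> m n; have FI : F ([set y : normed_space A | nrm (u m - y) < m.+1%:R^-1] `&`
               [set y : normed_space A | nrm (u n - y) < n.+1%:R^-1]).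
    by apply: filterI; exact: svalP (pick _).
  have [y [/= um un]] := filter_ex FI.
  rewrite (le_lt_trans (nrm_tri _ y _)) // ltrD //.
  by rewrite nrmBC.
have inve (e : R) : 0 < e -> exists N, forall n, (N <= n)%N -> n.+1%:R^-1 < e.
  move=> e0; exists (Num.truncn e^-1) => n Nn.
  rewrite invf_plt ?posrE // (lt_le_trans (truncnS_gt _)) // ler_nat.
  by rewrite ltnS.
have [l ul] : exists l, ncvg u l.
  apply: compl => e e0; have [|N HN] := inve (e / 2); first by rewrite divr_gt0.
  exists N => m n Nm Nn; rewrite (lt_le_trans (uc m n)) //.
  by rewrite [leRHS]splitr lerD // ltW // HN.
apply/cvg_ex; exists (l : normed_space A) => P /nbhs_nrmP[e e0 Pe].
have e20 : 0 < e / 2 by rewrite divr_gt0.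
have [N HN] := inve _ e20.
have [M _ HM] := ul _ e20.
have := svalP (pick (maxn N M)); apply: filterS => y /= uy; apply: Pe.
rewrite (le_lt_trans (nrm_tri _ (u (maxn N M)) _)) //.
have h1 := HM _ (leq_maxr N M); have h2 := lt_trans uy (HN _ (leq_maxl N M)).
by rewrite [ltRHS]splitr ltrD // nrmBC.
Qed.

End Complete.

Lemma cstar_complete {R : realType} {A : cstarAlgType R} (u : nat -> A) :
  ncauchy u -> exists l, ncvg u l.
Proof.
move=> uc; pose v : nat -> normed_space A := u.
have /cstar_cauchy_cvg : cauchy (v @ \oo).
  apply/cauchyP => e e0.
  have : 0 < complex.Re e by move: e0; rewrite ltcE => /andP[].
  move=> /uc[N HN]; exists (v N); exists N => // n /= Nn.
  rewrite -ball_normE /ball_ /=; have := HN _ _ (leqnn N) Nn.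
  move: (e0); rewrite ltcE => /andP[/eqP Ime _].
  rewrite -ltcR nrmE => /lt_le_trans; apply.
  by rewrite lecE /= Ime eqxx lexx.
move=> /cvg_ex[l ul]; exists l => e e0.
have nl : nbhs (l : normed_space A) [set y | nrm (l - y) < e].
  by apply/(@nbhs_nrmP R A l); exists e.
by have [N _ HN] := ul _ nl; exists N => // n /HN /=; rewrite nrmBC.
Qed.

Section Convergence.
Context {R : realType} {A : normedStarAlgType R}.
Implicit Types (u v : nat -> A) (x y l m : A) (b : nat -> R).

Lemma ncvgP u l : ncvg u l <-> (fun n => nrm (u n - l)) @ \oo --> (0 : R).
Proof.
split=> [ul|/cvgr0Pnorm_lt ul e e0].
  apply/cvgr0Pnorm_lt => e e0; have := ul e e0; apply: filterS => n.
  by rewrite ger0_norm // nrm_ge0.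
by have := ul e e0; apply: filterS => n; rewrite ger0_norm // nrm_ge0.
Qed.

Lemma ncvg_le u l b : (forall n, nrm (u n - l) <= b n) -> b @ \oo --> (0 : R) ->
  ncvg u l.
Proof.
move=> ub b0; apply/ncvgP; apply: (squeeze_cvgr _ (cvg_cst 0) b0).
by near=> n; rewrite nrm_ge0 ub.
Unshelve. all: by end_near. Qed.

Lemma ncvg_cst x : ncvg (fun=> x) x.
Proof.
by apply/ncvgP; rewrite (_ : (fun=> _) = fun=> 0) ?subrr ?nrm0 //; exact: cvg_cst.
Qed.

Lemma ncvgD u v l m : ncvg u l -> ncvg v m -> ncvg (fun n => u n + v n) (l + m).
Proof.
move=> /ncvgP ul /ncvgP vm.
apply: (@ncvg_le _ _ (fun n => nrm (u n - l) + nrm (v n - m))) => [n|].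
  by rewrite opprD addrACA nrmD.
by rewrite -[0]addr0; exact: cvgD.
Qed.

Lemma ncvgN u l : ncvg u l -> ncvg (fun n => - u n) (- l).
Proof. by move=> ul e /ul; apply: filterS => n; rewrite -opprD nrmN. Qed.

Lemma ncvgB u v l m : ncvg u l -> ncvg v m -> ncvg (fun n => u n - v n) (l - m).
Proof. by move=> ul /ncvgN; exact: ncvgD. Qed.

Lemma ncvgZ u l (c : R[i]) : ncvg u l -> ncvg (fun n => c *: u n) (c *: l).
Proof.
move=> /ncvgP ul.
apply: (@ncvg_le _ _ (fun n => complex.Re `|c| * nrm (u n - l))) => [n|].
  by rewrite -scalerBr nrmZ.
by rewrite -(mulr0 (complex.Re `|c|)); exact: cvgMr.
Qed.

Lemma ncvgM u v l m : ncvg u l -> ncvg v m -> ncvg (fun n => u n * v n) (l * m).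
Proof.
move=> /ncvgP ul /ncvgP vm.
apply: (@ncvg_le _ _ (fun n => nrm (u n - l) * nrm (v n - m) + nrm (u n - l) * nrm m
  + nrm l * nrm (v n - m))) => [n|].
  have -> : u n * v n - l * m = (u n - l) * (v n - m) + (u n - l) * m + l * (v n - m).
    by ncring.
  by rewrite (le_trans (nrmD _ _)) // lerD ?nrmM // (le_trans (nrmD _ _)) // lerD ?nrmM.
have -> : 0 = 0 * 0 + 0 * nrm m + nrm l * 0 :> R by rewrite !mul0r mulr0 !addr0.
by apply: cvgD; [apply: cvgD; [exact: cvgM|exact: cvgMl]|exact: cvgMr].
Qed.

Lemma ncvg_nrm_le u l (r : R) : (forall n, nrm (u n) <= r) -> ncvg u l -> nrm l <= r.
Proof.
move=> ur ul; apply/ler_addgt0Pr => e e0; have [N _ /(_ N (leqnn N))] := ul e e0.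
move=> /= h; rewrite -(subrK (u N) l) (le_trans (nrmD _ _)) // addrC lerD //.
by rewrite nrmBC ltW.
Qed.

Lemma ncvg_unique u l m : ncvg u l -> ncvg u m -> l = m.
Proof.
move=> ul um; apply/subr0_eq/nrm0_eq0/eqP; rewrite eq_le nrm_ge0 andbT.
have := ncvgB ul um; apply: ncvg_nrm_le => n.
by rewrite subrr nrm0.
Qed.

Lemma eq_ncvg u v l : u =1 v -> ncvg u l -> ncvg v l.
Proof. by move=> /funext ->. Qed.

End Convergence.

Section StarAlgebra.
Context {R : realType} {A : starAlgType R}.
Implicit Types (x y : A) (t : R).

Lemma star0 : star (0 : A) = 0.
Proof. by apply: (addrI (star (0 : A))); rewrite -starD !addr0. Qed.

Lemma starN x : star (- x) = - star x.
Proof. by apply/eqP; rewrite -addr_eq0 -starD addNr star0. Qed.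

Lemma starB x y : star (x - y) = star x - star y.
Proof. by rewrite starD starN. Qed.

Lemma star1 : star (1 : A) = 1.
Proof. by rewrite -[LHS]mul1r -{1}(starK 1) -starM mul1r starK. Qed.

Lemma starX x n : star (x ^+ n) = star x ^+ n.
Proof. by elim: n => [|n IHn]; rewrite ?star1 // exprS exprSr starM IHn. Qed.

Lemma conjc_realE t : (t%:C)^* = t%:C :> R[i].
Proof. by rewrite conj_Creal // complex_real. Qed.

Lemma starZr t x : star (t%:C *: x) = t%:C *: star x.
Proof. by rewrite starZ conjc_realE. Qed.

Definition sa x := star x = x.

Lemma sa0 : sa (0 : A). Proof. exact: star0. Qed.
Lemma sa1 : sa (1 : A). Proof. exact: star1. Qed.
Lemma saD x y : sa x -> sa y -> sa (x + y).
Proof. by rewrite /sa starD => -> ->. Qed.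
Lemma saN x : sa x -> sa (- x).
Proof. by rewrite /sa starN => ->. Qed.
Lemma saB x y : sa x -> sa y -> sa (x - y).
Proof. by move=> sx sy; apply: saD => //; exact: saN. Qed.
Lemma saZ t x : sa x -> sa (t%:C *: x).
Proof. by rewrite /sa starZr => ->. Qed.
Lemma saM x y : sa x -> sa y -> x * y = y * x -> sa (x * y).
Proof. by rewrite /sa starM => -> ->. Qed.
Lemma saMM x : sa x -> sa (x * x).
Proof. by move=> sx; exact: saM. Qed.
Lemma saJ x : sa (star x * x).
Proof. by rewrite /sa starM starK. Qed.

Definition sc t : A := t%:C *: 1.

Lemma sa_sc t : sa (sc t). Proof. exact/saZ/sa1. Qed.
Lemma scM t x : sc t * x = t%:C *: x.
Proof. by rewrite -scalerAl mul1r. Qed.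
Lemma scC t x : x * sc t = sc t * x.
Proof. by rewrite scM -scalerAr mulr1. Qed.
Lemma scD s t : sc (s + t) = sc s + sc t.
Proof. by rewrite /sc rmorphD scalerDl. Qed.
Lemma sc0 : sc 0 = 0. Proof. by rewrite /sc scale0r. Qed.

End StarAlgebra.

Section CStarBasics.
Context {R : realType} {A : cstarAlgType R}.
Implicit Types (x y : A) (t : R).

Lemma nrm_starM x : nrm (star x * x) = nrm x ^+ 2.
Proof. by apply: complexI; rewrite rmorphXn /= !nrmE cnorm_star_mul. Qed.

Lemma nrm_star x : nrm (star x) = nrm x.
Proof.
suff H y : nrm y <= nrm (star y).
  by apply/eqP; rewrite eq_le -{2}(starK x) !H.
have [->|y0] := eqVneq (nrm y) 0; first exact: nrm_ge0.
have yp : 0 < nrm y by rewrite lt_neqAle eq_sym y0 nrm_ge0.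
by rewrite -(ler_pM2r yp) -expr2 -nrm_starM nrmM.
Qed.

Lemma nrm1 : nrm (1 : A) = 1.
Proof.
have := nrm_starM (1 : A); rewrite star1 mul1r => h.
have : nrm (1 : A) != 0.
  by apply: contra_neq (oner_neq0 A) => /nrm0_eq0.
by move=> /mulfI; apply; rewrite mulr1 -expr2 -h.
Qed.

Lemma nrm_sc t : nrm (sc t : A) = `|t|.
Proof. by rewrite nrmZr nrm1 mulr1. Qed.

Lemma ncvg_star (u : nat -> A) l : ncvg u l -> ncvg (fun n => star (u n)) (star l).
Proof. by move=> ul e /ul; apply: filterS => n; rewrite -starB nrm_star. Qed.

Lemma sa_ncvg (u : nat -> A) l : (forall n, sa (u n)) -> ncvg u l -> sa l.
Proof.
move=> su ul; apply: (@ncvg_unique _ _ u) => //.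
by apply: eq_ncvg (ncvg_star ul) => n; exact: su.
Qed.

Lemma sa_sqr_eq0 x : sa x -> x * x = 0 -> x = 0.
Proof.
move=> sx xx; apply: nrm0_eq0; apply/eqP; rewrite -sqrf_eq0 -nrm_starM sx xx.
by rewrite nrm0.
Qed.

End CStarBasics.

(** * Square roots by successive approximation *)

Section SquareRoot.
Context {R : realType} {A : cstarAlgType R}.
Implicit Types (x y z a b : A) (t : R).

(* The root of 1 - x is 1 - z, where z = (x + z^2) / 2. *)
Fixpoint root_iter x n : A :=
  if n is m.+1 then (2^-1 : R)%:C *: (x + root_iter x m * root_iter x m) else 0.

(** The recursion of [root_iter] at the scalar x = 1. It majorises the norms of the iterates and,
    being increasing and at most 1, converges. *)
Fixpoint root_bound n : R :=
  if n is m.+1 then 2^-1 * (1 + root_bound m * root_bound m) else 0.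

Lemma root_bound_ge0 n : 0 <= root_bound n.
Proof.
elim: n => //= n IHn; rewrite mulr_ge0 ?invr_ge0 // addr_ge0 // mulr_ge0 //.
Qed.

Lemma root_bound_le1 n : root_bound n <= 1.
Proof. by elim: n => [|n IHn] /=; [|have := root_bound_ge0 n; nra]. Qed.

Lemma root_bound_nd : nondecreasing_seq root_bound.
Proof.
apply/nondecreasing_seqP => n /=.
by have := root_bound_ge0 n; have := root_bound_le1 n; nra.
Qed.

Lemma root_iter_le x n : nrm x <= 1 -> nrm (root_iter x n) <= root_bound n.
Proof.
move=> x1; elim: n => [|n IHn] /=; first by rewrite nrm0.
rewrite nrmZr gtr0_norm ?invr_gt0 // ler_pM2l ?invr_gt0 //.
rewrite (le_trans (nrmD _ _)) // lerD // (le_trans (nrmM _ _)) //.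
by rewrite ler_pM ?nrm_ge0.
Qed.

(** By a^2 - b^2 = a (a - b) + (a - b) b, each difference is dominated by the same difference of the
    scalar recursion. This covers the boundary case |x| = 1, where no contraction estimate is
    available. *)
Lemma root_iterB_le x m n : nrm x <= 1 -> (n <= m)%N ->
  nrm (root_iter x m - root_iter x n) <= root_bound m - root_bound n.
Proof.
move=> x1 /subnK <-; set k := (m - n)%N.
elim: n k => [|n IHn] k; first by rewrite !subr0 root_iter_le.
rewrite addnS /= -scalerBr opprD addrACA subrr add0r.
rewrite nrmZr gtr0_norm ?invr_gt0 //.
have -> : root_iter x (k + n) * root_iter x (k + n) - root_iter x n * root_iter x n =
  root_iter x (k + n) * (root_iter x (k + n) - root_iter x n) +
  (root_iter x (k + n) - root_iter x n) * root_iter x n by ncring.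
have h := IHn k; set d := _ - root_iter x n in h *.
have h1 := root_iter_le (k + n) x1; have h2 := root_iter_le n x1.
have h3 := nrmD (root_iter x (k + n) * d) (d * root_iter x n).
have h4 := nrmM (root_iter x (k + n)) d; have h5 := nrmM d (root_iter x n).
have d0 := nrm_ge0 d; have := nrm_ge0 (root_iter x n).
have := nrm_ge0 (root_iter x (k + n)); have := root_bound_ge0 n.
have := root_bound_ge0 (k + n).
nra.
Qed.

Lemma root_bound_cauchy (e : R) : 0 < e -> exists N, forall m n,
  (N <= n)%N -> (n <= m)%N -> root_bound m - root_bound n < e.
Proof.
move=> e0; have : cvgn root_bound.
  apply: nondecreasing_is_cvgn; first exact: root_bound_nd.
  by exists 1 => _ [n _ <-]; exact: root_bound_le1.
move=> cv; have le_lim n := nondecreasing_cvgn_le root_bound_nd cv n.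
have /cvgrPdist_lt/(_ e e0)[N _ HN] := cv.
exists N => m n Nn nm; have := HN n Nn.
rewrite ger0_norm ?subr_ge0 //; apply: le_lt_trans; rewrite lerD2r //.
Qed.

Lemma root_iter_cvg x : nrm x <= 1 -> exists z, ncvg (root_iter x) z.
Proof.
move=> x1; apply: cstar_complete => e e0.
have [N HN] := root_bound_cauchy e0; exists N => m n Nm Nn.
have [mn|/ltnW nm] := leqP m n.
  by rewrite nrmBC (le_lt_trans (root_iterB_le x1 mn)) // HN.
by rewrite (le_lt_trans (root_iterB_le x1 nm)) // HN.
Qed.

(** The value 0 is a default for divergent iterations; [root_limP] excludes it when |x| <= 1. *)
Definition root_lim x : A :=
  if pselect (exists z, ncvg (root_iter x) z) is left h then sval (cid h) else 0.

Lemma root_limP x : nrm x <= 1 -> ncvg (root_iter x) (root_lim x).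
Proof.
move=> x1; rewrite /root_lim; case: pselect => [h|/(_ (root_iter_cvg x1))//].
exact: svalP (cid h).
Qed.

Lemma half_double x : (2^-1 : R)%:C *: (x + x) = x.
Proof.
rewrite -mulr2n -(scaler_nat 2 x) scalerA (_ : _ * _ = 1) ?scale1r //.
by rewrite -(rmorph_nat (real_complex R)) -rmorphM /= mulVf.
Qed.

Lemma root_limE x : nrm x <= 1 -> root_lim x + root_lim x = x + root_lim x * root_lim x.
Proof.
move=> x1; have xz := root_limP x1.
have : root_lim x = (2^-1 : R)%:C *: (x + root_lim x * root_lim x).
  apply: (@ncvg_unique _ _ (fun n => root_iter x n.+1)).
    by move=> e /xz[N _ HN]; exists N => // n Nn; exact: (HN n.+1 (leqW Nn)).
  by apply: ncvgZ; apply: ncvgD; [exact: ncvg_cst|exact: ncvgM].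
set z := root_lim x => zE; have := half_double (x + z * z).
by rewrite scalerDr -zE.
Qed.

Lemma root_lim_le x : nrm x <= 1 -> nrm (root_lim x) <= 1.
Proof.
move=> x1; apply: ncvg_nrm_le (root_limP x1) => n.
exact: le_trans (root_iter_le n x1) (root_bound_le1 n).
Qed.

Lemma root_lim_sa x : nrm x <= 1 -> sa x -> sa (root_lim x).
Proof.
move=> x1 sx; apply: (sa_ncvg _ (root_limP x1)) => n.
by elim: n => [|n IHn] /=; [exact: sa0 | apply/saZ/saD => //; exact: saMM].
Qed.

(** Intertwining passes from the data to the iterates and so to the limits. The form with two
    elements, rather than plain commutation, is what relates |y y*| to |y* y| below. *)
Lemma root_lim_comm x x' y : nrm x <= 1 -> nrm x' <= 1 -> x * y = y * x' ->
  root_lim x * y = y * root_lim x'.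
Proof.
move=> x1 x'1 xy; apply: (@ncvg_unique _ _ (fun n => root_iter x n * y)).
  by apply: ncvgM (root_limP x1) (ncvg_cst y).
apply: (@eq_ncvg _ _ (fun n => y * root_iter x' n)); last first.
  exact: ncvgM (ncvg_cst y) (root_limP x'1).
elim=> [|n IHn] /=; first by rewrite mulr0 mul0r.
rewrite -scalerAl -scalerAr mulrDl mulrDr -xy; congr (_ *: (_ + _)).
by rewrite mulrA IHn -!mulrA IHn.
Qed.

(* Positivity without spectral theory: the spectrum of x lies in [0, 2t]. *)
Definition pos x := sa x /\ exists2 t : R, 0 < t & nrm (sc t - x) <= t.

Lemma pos_sa x : pos x -> sa x. Proof. by case. Qed.

(** Allows two positive elements to be tested with one common radius. *)
Lemma pos_widen x s t : nrm (sc s - x) <= s -> s <= t -> nrm (sc t - x) <= t.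
Proof.
move=> sx st; rewrite -(subrK (sc s) (sc t)) -addrA (le_trans (nrmD _ _)) //.
rewrite -[sc t - sc s](_ : sc (t - s) = _) ?nrm_sc; last first.
  by rewrite /sc rmorphB scalerBl.
by rewrite ger0_norm ?subr_ge0 //; lra.
Qed.

(** The root of x = t (1 - x') with x' = 1 - x/t. The formula depends on [t], so two roots are
    comparable only when built with the same [t]. *)
Definition csqrt t x : A := (Num.sqrt t)%:C *: (1 - root_lim (1 - (t^-1)%:C *: x)).

Lemma csqrt_subproof t x : 0 < t -> nrm (sc t - x) <= t ->
  nrm (1 - (t^-1)%:C *: x) <= 1.
Proof.
move=> t0 xt; have -> : 1 - (t^-1)%:C *: x = (t^-1)%:C *: (sc t - x).
  rewrite scalerBr /sc scalerA -rmorphM /= mulVf ?gt_eqF // scale1r //.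
by rewrite nrmZr gtr0_norm ?invr_gt0 // ler_pdivrMl // mulr1.
Qed.

Lemma csqrtK t x : 0 < t -> nrm (sc t - x) <= t -> csqrt t x * csqrt t x = x.
Proof.
move=> t0 xt; have x1 := csqrt_subproof t0 xt.
have := root_limE x1; rewrite /csqrt; set z := root_lim _ => zE.
rewrite -scalerAl -scalerAr scalerA -rmorphM /= -expr2 sqr_sqrtr ?ltW //.
have -> : (1 - z) * (1 - z) = 1 + z * z - (z + z) by ncring.
rewrite zE opprD addrACA subrr addr0 opprB addrCA subrr addr0 scalerA.
by rewrite -rmorphM /= mulfV ?gt_eqF // scale1r.
Qed.

Lemma csqrt_pos t x : 0 < t -> nrm (sc t - x) <= t -> sa x -> pos (csqrt t x).
Proof.
move=> t0 xt sx; have x1 := csqrt_subproof t0 xt.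
have s1 : sa (root_lim (1 - (t^-1)%:C *: x)).
  by apply: root_lim_sa => //; apply: saB; [exact: sa1|exact: saZ].
split; first by apply/saZ/saB => //; exact: sa1.
exists (Num.sqrt t); first by rewrite sqrtr_gt0.
rewrite /sc -scalerBr opprB addrC subrK nrmZr ger0_norm ?sqrtr_ge0 //.
by rewrite ler_piMr ?sqrtr_ge0 // root_lim_le.
Qed.

Lemma csqrt_comm t x x' y : 0 < t -> nrm (sc t - x) <= t -> nrm (sc t - x') <= t ->
  x * y = y * x' -> csqrt t x * y = y * csqrt t x'.
Proof.
move=> t0 xt x't xy; rewrite -scalerAl -scalerAr mulrBl mulrBr mulr1 mul1r.
congr (_ *: (_ - _)); apply: root_lim_comm; try exact: csqrt_subproof.
by rewrite mulrBl mulrBr mulr1 mul1r -scalerAl -scalerAr xy.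
Qed.

End SquareRoot.

(** * Positivity *)

Section Positivity.
Context {R : realType} {A : cstarAlgType R}.
Implicit Types (x y z a b h k m s : A) (t : R).

Lemma star_complex_sum x y : sa x -> sa y ->
  star (x + 'i *: y) = x - 'i *: y.
Proof. by move=> sx sy; rewrite starD starZ sx sy conjCi scaleNr. Qed.

Lemma nrm_re_im x y : sa x -> sa y ->
  nrm x <= nrm (x + 'i *: y) /\ nrm y <= nrm (x + 'i *: y).
Proof.
move=> sx sy; set v := x + _.
have svE : star v = x - 'i *: y by exact: star_complex_sum.
have E1 : v + star v = x + x by rewrite svE /v; ncring.
have E2 : v - star v = 'i *: (y + y).
  by rewrite svE /v scalerDr; ncring.
have n2 : nrm v + nrm v = 2 * nrm v by rewrite mulr_natl mulr2n.
have dbl z : nrm z = 2^-1 * nrm (z + z).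
  by rewrite -{1}(half_double z) nrmZr gtr0_norm ?invr_gt0.
have hi : complex.Re `|'i : R[i]| = 1 by rewrite normCi.
split; rewrite dbl.
  by rewrite -E1 ler_pdivrMl // -n2 -{2}(nrm_star v) nrmD.
have -> : nrm (y + y) = nrm (v - star v) by rewrite E2 nrmZ hi mul1r.
by rewrite ler_pdivrMl // -n2 -{2}(nrm_star v) nrmB.
Qed.

Lemma star_complex_mul x y : sa x -> sa y -> x * y = y * x ->
  star (x + 'i *: y) * (x + 'i *: y) = x * x + y * y.
Proof.
move=> sx sy xy; rewrite star_complex_sum // mulrBl !mulrDr -!scalerAr -!scalerAl xy.
rewrite scalerA -(expr2 ('i : R[i])) sqrCi scaleN1r.
ncring.
Qed.

(** The element v = x + i y satisfies v* v = x^2 + y^2, and its real and imaginary parts are bounded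
    in norm by v. This stands in for monotonicity of the norm on positive elements. *)
Lemma nrm_sqr_sum x y : sa x -> sa y -> x * y = y * x ->
  nrm x ^+ 2 <= nrm (x * x + y * y) /\ nrm y ^+ 2 <= nrm (x * x + y * y).
Proof.
move=> sx sy xy; rewrite -star_complex_mul // nrm_starM.
have [h1 h2] := nrm_re_im sx sy; have := nrm_ge0 x; have := nrm_ge0 y.
by split; rewrite ler_pXn2r ?nnegrE ?nrm_ge0.
Qed.

(** For r > |y| the element r^2 - y^2 has a root w by construction, since |y^2| <= r^2. As w
    commutes with y and y^2 + w^2 = r^2, one gets |r^2 - y^2| <= |w|^2 <= r^2. *)
Lemma sqr_pos y : sa y -> pos (y * y).
Proof.
move=> sy; split; first exact: saMM.
pose r := nrm y + 1; have r0 : 0 < r by rewrite /r ltr_pwDr ?nrm_ge0.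
exists (r ^+ 2); first by rewrite exprn_gt0.
pose w := csqrt (r ^+ 2) (sc (r ^+ 2) - y * y).
have r20 : 0 < r ^+ 2 by rewrite exprn_gt0.
have bnd : nrm (sc (r ^+ 2) - (sc (r ^+ 2) - y * y)) <= r ^+ 2.
  rewrite opprB addrC subrK (le_trans (nrmM _ _)) // -expr2 ler_pXn2r ?nnegrE ?nrm_ge0 ?(ltW r0) //.
  by rewrite /r lerDl.
have ww : w * w = sc (r ^+ 2) - y * y by exact: csqrtK.
have sw : sa w.
  by apply/pos_sa/csqrt_pos => //; apply: saB; [exact: sa_sc|exact: saMM].
have wy : w * y = y * w.
  by apply: csqrt_comm => //; rewrite mulrBl mulrBr scC mulrA.
rewrite -ww (le_trans (nrmM _ _)) // -expr2.
have [_ h] := nrm_sqr_sum sy sw (esym wy); apply: le_trans h _.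
by rewrite ww addrC subrK nrm_sc ger0_norm // ltW.
Qed.

Lemma pos_sqrt h : pos h -> exists y, [/\ pos y, y * y = h &
  forall z, h * z = z * h -> y * z = z * y].
Proof.
move=> [sh [t t0 ht]]; exists (csqrt t h); split.
- exact: csqrt_pos.
- exact: csqrtK.
- by move=> z hz; exact: csqrt_comm.
Qed.

Lemma pos_sc t : 0 <= t -> pos (sc t : A).
Proof.
move=> t0; split; first exact: sa_sc.
exists (t + 1); first by rewrite ltr_pwDr.
by rewrite scD addrC addKr nrm_sc normr1 lerDr.
Qed.

Lemma pos0 : pos (0 : A).
Proof. by rewrite -(sc0 (A := A)); exact: pos_sc. Qed.

Lemma posD h k : pos h -> pos k -> pos (h + k).
Proof.
move=> [sh [t t0 ht]] [sk [r r0 kr]]; split; first exact: saD.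
exists (t + r); first by rewrite addr_gt0.
by rewrite scD opprD addrACA (le_trans (nrmD _ _)) // lerD.
Qed.

Lemma posZ h t : 0 <= t -> pos h -> pos (t%:C *: h).
Proof.
rewrite le_eqVlt => /orP[/eqP<- _|t0 [sh [r r0 hr]]].
  by rewrite scale0r; exact: pos0.
split; first exact: saZ.
exists (t * r); first by rewrite mulr_gt0.
rewrite (_ : sc (t * r) = t%:C *: sc r); last by rewrite /sc scalerA -rmorphM.
by rewrite -scalerBr nrmZr gtr0_norm // ler_pM2l.
Qed.

Lemma pos_nrmB h t : sa h -> nrm h <= t -> pos (sc t - h).
Proof.
move=> sh; rewrite le_eqVlt => /orP[/eqP<-|ht].
  have [h0|h0] := eqVneq (nrm h) 0.
    by rewrite h0 (nrm0_eq0 h0) sc0 subr0; exact: pos0.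
  split; first by apply: saB => //; exact: sa_sc.
  exists (nrm h); first by rewrite lt_neqAle eq_sym h0 nrm_ge0.
  by rewrite opprB addrC subrK.
split; first by apply: saB => //; exact: sa_sc.
exists t; first exact: le_lt_trans (nrm_ge0 h) ht.
by rewrite opprB addrC subrK ltW.
Qed.

(** For commuting roots y of h and w of t - h, the sum y^2 + w^2 is the scalar t, which bounds
    |y|^2. *)
Lemma pos_nrm_le h t : 0 <= t -> pos h -> pos (sc t - h) -> nrm h <= t.
Proof.
move=> t0 /pos_sqrt[y [py yy cy]] /pos_sqrt[w [pw ww cw]].
have wy : w * y = y * w.
  by apply: cw; rewrite -yy mulrBl mulrBr scC mulrA.
have [hh _] := nrm_sqr_sum (pos_sa py) (pos_sa pw) (esym wy).
move: hh; rewrite yy ww addrC subrK nrm_sc ger0_norm //; apply: le_trans.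
by rewrite -yy expr2 nrmM.
Qed.

Lemma pos_opp_eq0 h : pos h -> pos (- h) -> h = 0.
Proof.
move=> ph pNh; apply: nrm0_eq0; apply/eqP; rewrite eq_le nrm_ge0 andbT.
apply: pos_nrm_le => //.
by rewrite sc0 add0r.
Qed.

Lemma posD_eq0 h k : pos h -> pos k -> h + k = 0 -> h = 0.
Proof.
move=> ph pk hk; apply: pos_opp_eq0 => //.
by move/eqP: hk; rewrite addr_eq0 => /eqP ->; rewrite opprK.
Qed.

Lemma posM h k : pos h -> pos k -> h * k = k * h -> pos (h * k).
Proof.
move=> /pos_sqrt[y [py yy cy]] /pos_sqrt[w [pw ww cw]] hk.
have wy : w * y = y * w by apply/cw/esym/cy.
have -> : h * k = (y * w) * (y * w).
  by rewrite -yy -ww -!mulrA [w * (y * w)]mulrA wy -!mulrA.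
by apply: sqr_pos; apply: saM => //; exact: pos_sa.
Qed.

(* Here m = |s|, and |s| - s is positive. With d = m - s, n = |d| and e = n - d one
   finds n (n + 2m) e = 0, which forces n e = 0 and then e = 0. *)
Lemma abs_pos_ge m s : pos m -> sa s -> m * s = s * m -> m * m = s * s -> pos (m - s).
Proof.
move=> pm ss ms mm; have [d dE] : exists d, d = m - s by exists (m - s).
have sd : sa d by rewrite dE; apply: saB => //; exact: pos_sa.
have md : m * d = d * m by rewrite dE mulrBr mulrBl ms.
have dd : d * d = m * d + m * d.
  have -> : d * d = m * m + s * s - m * s - s * m by rewrite dE; ncring.
  by rewrite -mm -ms dE mulrBr; ncring.
have [n [pn nn cn]] := pos_sqrt (sqr_pos sd).
have nd : n * d = d * n by apply: cn; rewrite mulrA.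
have nm : n * m = m * n by apply: cn; rewrite -mulrA -md mulrA -md mulrA.
have sn := pos_sa pn.
have [e eE] : exists e, e = n - d by exists (n - d).
have se : sa e by rewrite eE; exact: saB.
have ne : n * e = e * n by rewrite eE mulrBr mulrBl nd.
have me : m * e = e * m by rewrite eE mulrBr mulrBl md nm.
have ed : e * d = - (n * e) by rewrite eE mulrBl -nn mulrBr opprB.
have de : d * e = - (n * e) by rewrite -ed eE mulrBl mulrBr nd.
have E1 : e * (d * d) = n * (n * e).
  by rewrite mulrA ed mulNr -mulrA ed mulrN opprK.
have E2 : e * (m * d) = - (m * (n * e)).
  by rewrite mulrA -me -mulrA ed mulrN.
have E3 : n * (n * e) + (m * (n * e) + m * (n * e)) = 0.
  by rewrite -E1 dd mulrDr E2; ncring.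
have nme : (m * n) * (e * e) = (e * e) * (m * n).
  by rewrite -!mulrA (mulrA n) ne -mulrA ne (mulrA m) me -!mulrA (mulrA m e) me -!mulrA.
have pne : (n * e) * (n * e) = 0.
  apply: (@posD_eq0 _ ((m * n) * (e * e) + (m * n) * (e * e))).
  - by apply: sqr_pos; exact: saM.
  - have h : pos ((m * n) * (e * e)).
      by apply: posM => //; [exact: posM | exact: sqr_pos].
    exact: posD.
  have -> : n * e * (n * e) = n * (n * e) * e by rewrite -!mulrA (mulrA e n e) -ne -!mulrA.
  have -> : m * n * (e * e) = m * (n * e) * e by rewrite !mulrA.
  by have := congr1 (fun z => z * e) E3; rewrite /= mul0r !mulrDl.
have ne0 : n * e = 0 by apply: sa_sqr_eq0 => //; exact: saM.
have : e = 0 by apply: sa_sqr_eq0 => //; rewrite {1}eE mulrBl de ne0 oppr0 subr0.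
by rewrite eE -dE => /subr0_eq <-.
Qed.

(** Each of the two is an absolute value of the other, so [abs_pos_ge] makes both h - k and k - h
    positive. *)
Lemma pos_sqrt_unique h k : pos h -> pos k -> h * k = k * h -> h * h = k * k -> h = k.
Proof.
move=> ph pk hk hh; apply/subr0_eq/pos_opp_eq0; first exact: abs_pos_ge (pos_sa pk) _ _.
by rewrite opprB; apply: abs_pos_ge => //; exact: pos_sa.
Qed.

End Positivity.

(** * Positivity of x* x *)

Section Fukamiya.
Context {R : realType} {A : cstarAlgType R}.
Implicit Types (x y z h k m : A) (t : R).

(** Both absolute values are built with the common radius t + r, so that an intertwiner of h^2 and
    k^2 also intertwines |h| and |k|. A single absolute value is obtained by taking k = h. *)
Lemma abs_pair h k : sa h -> sa k -> exists mh mk,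
  [/\ pos mh, pos mk, mh * mh = h * h, mk * mk = k * k &
   [/\ forall z, h * h * z = z * (k * k) -> mh * z = z * mk,
       forall z, h * h * z = z * (h * h) -> mh * z = z * mh
     & forall z, k * k * z = z * (k * k) -> mk * z = z * mk]].
Proof.
move=> sh sk; have [_ [t t0 ht]] := sqr_pos sh; have [_ [r r0 kr]] := sqr_pos sk.
have hs : nrm (sc (t + r) - h * h) <= t + r.
  by apply: pos_widen ht _; rewrite lerDl ltW.
have ks : nrm (sc (t + r) - k * k) <= t + r.
  by apply: pos_widen kr _; rewrite lerDr ltW.
have tr0 : 0 < t + r by rewrite addr_gt0.
exists (csqrt (t + r) (h * h)), (csqrt (t + r) (k * k)); split.
- by apply: csqrt_pos => //; exact: saMM.
- by apply: csqrt_pos => //; exact: saMM.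
- exact: csqrtK.
- exact: csqrtK.
- by split=> z hz; exact: csqrt_comm.
Qed.

Lemma pos_half h : pos (h + h) -> pos h.
Proof. by move=> ph; rewrite -(half_double h); apply: posZ. Qed.

(** Substitute for the equality of the nonzero spectra of y* y and y y*. With q = - y* y and w = y
    y* one has w y = - y q, so y intertwines w^2 with q^2 and |w| y = y |q| = y q. Hence |w| + w
    annihilates y, then w, and its square is 0, so that - w = |w|. *)
Lemma pos_starM_swap y : pos (- (star y * y)) -> pos (- (y * star y)).
Proof.
have [q qE] : exists q : A, q = - (star y * y) by exists (- (star y * y)).
have [w wE] : exists w : A, w = y * star y by exists (y * star y).
rewrite -qE -wE => pq; have sw : sa w by rewrite /sa wE starM starK.
have wy : w * y = - (y * q) by rewrite qE mulrN opprK wE mulrA.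
have [m [n [pm pn mm nn [mn cm cn]]]] := abs_pair sw (pos_sa pq).
have nq : n = q.
  by apply: pos_sqrt_unique => //; apply: cn; rewrite mulrA.
have mw : m * w = w * m by apply: cm; rewrite mulrA.
have my : m * y = y * q.
  by rewrite -nq; apply: mn; rewrite -mulrA wy mulrN (mulrA w y) wy mulNr opprK mulrA.
have mww : (m + w) * w = 0.
  by rewrite {2}wE mulrA mulrDl my wy addrN mul0r.
suff : m + w = 0 by move/eqP; rewrite addr_eq0 => /eqP <-.
apply: sa_sqr_eq0; first by apply: saD => //; exact: pos_sa.
have -> : (m + w) * (m + w) = (m + w) * w + (m * m + w * m) by ncring.
by rewrite mww add0r mm -mw -mulrDl [w + m]addrC mww.
Qed.

(* Fukamiya: with h = x* x, k = |h| - h and y = x k, both - y* y and - y y* are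
   positive, while y* y + y y* is a sum of squares of self-adjoint elements. *)
Lemma starM_pos x : pos (star x * x).
Proof.
have [h hE] : exists h : A, h = star x * x by exists (star x * x).
have sh : sa h by rewrite hE; exact: saJ.
have [m [_ [pm _ mm _ [_ cm _]]]] := abs_pair sh sh.
have mh : m * h = h * m by apply: cm; rewrite mulrA.
have [k kE] : exists k : A, k = m - h by exists (m - h).
have pk : pos k by rewrite kE; exact: abs_pos_ge.
have sk := pos_sa pk.
have mhk : (m + h) * k = 0.
  have -> : (m + h) * k = m * m - h * h + h * m - m * h by rewrite kE; ncring.
  by rewrite mm mh subrr add0r subrr.
(* Write 2h = (m + h) - (m - h): the first summand kills k and the second is k itself. Thus y* y = k
   h k is half of - k^3. *)
have khk : k * h * k + k * h * k = - (k * k * k).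
  have -> : k * h * k + k * h * k = k * ((m + h) * k) - k * (m - h) * k by ncring.
  by rewrite mhk mulr0 sub0r -kE.
pose y := x * k.
have yy : star y * y = k * h * k by rewrite /y starM sk hE !mulrA.
have pkkk : pos (k * k * k).
  by apply: posM => //; [exact: posM|rewrite mulrA].
have pq : pos (- (star y * y)).
  by apply: pos_half; rewrite -opprD yy khk opprK.
have pw := pos_starM_swap pq.
have [q qE] : exists q : A, q = - (star y * y) by exists (- (star y * y)).
have [w wE] : exists w : A, w = - (y * star y) by exists (- (y * star y)).
have sb : sa (y + star y) by rewrite /sa starD starK addrC.
have sc : sa ('i *: (y - star y)).
  by rewrite /sa starZ conjCi starB starK scaleNr -scalerN opprB.
have E : (y + star y) * (y + star y) + 'i *: (y - star y) * ('i *: (y - star y))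
   + ((q + w) + (q + w)) = 0.
  rewrite -scalerAl -scalerAr scalerA -(expr2 ('i : R[i])) sqrCi scaleN1r qE wE.
  by ncring.
rewrite -wE -qE in pq pw.
have qw : q + w = 0.
  apply: (posD_eq0 (k := q + w)); [exact: posD|exact: posD|].
  apply: (posD_eq0 (k := (y + star y) * (y + star y) +
    'i *: (y - star y) * ('i *: (y - star y)))).
  - by apply: posD; exact: posD.
  - by apply: posD; exact: sqr_pos.
  - by rewrite addrC.
have q0 := posD_eq0 pq pw qw.
have kkk : k * k * k = 0.
  by rewrite -[LHS]opprK -khk -yy -[star y * y]opprK -qE q0 !oppr0 addr0 oppr0.
have k0 : k = 0.
  apply: sa_sqr_eq0 => //; apply: sa_sqr_eq0; first exact: saMM.
  by rewrite mulrA kkk mul0r.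
by rewrite -hE; move: k0; rewrite kE => /subr0_eq <-.
Qed.

End Fukamiya.

(** * Homomorphisms: automatic contractivity and isometry *)

Section StarHom.
Context {R : realType} {A B : starAlgType R} (f : A -> B).
Hypothesis hf : star_hom f.

Lemma star_homD : {morph f : x y / x + y}.
Proof. by case: hf => lf _ _ x y; rewrite -[x]scale1r lf !scale1r. Qed.

Lemma star_hom0 : f 0 = 0.
Proof. by apply: (addrI (f 0)); rewrite -star_homD !addr0. Qed.

Lemma star_homZ c : {morph f : x / c *: x}.
Proof. by case: hf => lf _ _ x; rewrite -[c *: x]addr0 lf star_hom0 addr0. Qed.

Lemma star_homN : {morph f : x / - x}.
Proof. by move=> x; rewrite -scaleN1r star_homZ scaleN1r. Qed.

Lemma star_homB : {morph f : x y / x - y}.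
Proof. by move=> x y; rewrite star_homD star_homN. Qed.

Lemma star_homM : {morph f : x y / x * y}.
Proof. by case: hf => _ []. Qed.

Lemma star_hom1 : f 1 = 1.
Proof. by case: hf => _ []. Qed.

Lemma star_homS : {morph f : x / star x}.
Proof. by case: hf. Qed.

Lemma star_hom_sc t : f (sc t) = sc t.
Proof. by rewrite /sc star_homZ star_hom1. Qed.

Lemma star_hom_sa x : sa x -> sa (f x).
Proof. by rewrite /sa -star_homS => ->. Qed.

Lemma star_hom_sum I (r : seq I) (P : pred I) (F : I -> A) :
  f (\sum_(i <- r | P i) F i) = \sum_(i <- r | P i) f (F i).
Proof. exact: (big_morph f star_homD star_hom0). Qed.

End StarHom.

Lemma star_hom_comp {R : realType} (A B C : starAlgType R) (f : A -> B) (g : B -> C) :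
  star_hom f -> star_hom g -> star_hom (g \o f).
Proof.
move=> hf hg; split=> [c x y|| x] /=.
- by rewrite (star_homD hf) (star_homZ hf) (star_homD hg) (star_homZ hg).
- split; first by rewrite /= (star_hom1 hf) (star_hom1 hg).
  by move=> x y /=; rewrite (star_homM hf) (star_homM hg).
- by rewrite (star_homS hf) (star_homS hg).
Qed.

Section StarHomCStar.
Context {R : realType} {A B : cstarAlgType R} (f : A -> B).
Hypothesis hf : star_hom f.

Lemma star_hom_pos x : pos x -> pos (f x).
Proof.
move=> /pos_sqrt[y [py <- _]]; rewrite (star_homM hf).
by apply: sqr_pos; apply: (star_hom_sa hf); exact: pos_sa.
Qed.

(** The positive element |x|^2 - x* x has a positive image, which [pos_nrm_le] turns into a norm
    bound. *)
Lemma star_hom_nrm x : nrm (f x) <= nrm x.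
Proof.
rewrite -(ler_pXn2r (n := 2)) ?nnegrE ?nrm_ge0 // -!nrm_starM.
apply: pos_nrm_le; [exact: nrm_ge0|exact: starM_pos|].
rewrite -(star_homS hf) -(star_homM hf) -(star_hom_sc hf) -(star_homB hf).
by apply: star_hom_pos; apply: pos_nrmB => //; exact: saJ.
Qed.

(* If |f h| = r < |h| for a positive h, then f kills the positive part of h - r. *)
Lemma star_hom_isometry x : injective f -> nrm (f x) = nrm x.
Proof.
move=> injf; apply/eqP; rewrite eq_le star_hom_nrm /=.
rewrite -(ler_pXn2r (n := 2)) ?nnegrE ?nrm_ge0 // -!nrm_starM.
rewrite -(star_homS hf) -(star_homM hf).
have := starM_pos x; move: (star x * x) => h ph.
have [r rE] : exists r, r = nrm (f h) by exists (nrm (f h)).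
rewrite -rE; have r0 : 0 <= r by rewrite rE nrm_ge0.
pose k := sc r - h; have sk : sa k.
  by apply: saB; [exact: sa_sc|exact: pos_sa].
have [m [_ [pm _ mm _ [_ cm _]]]] := abs_pair sk sk.
have pfk : pos (f k).
  rewrite (star_homB hf) (star_hom_sc hf) rE; apply: pos_nrmB => //.
  exact/(star_hom_sa hf)/pos_sa.
have : f m = f k.
  apply: pos_sqrt_unique => //; first exact: star_hom_pos.
    by rewrite -!(star_homM hf); congr f; apply: cm; rewrite mulrA.
  by rewrite -!(star_homM hf) mm.
by move/injf => mk; apply: pos_nrm_le => //; rewrite -/k -mk.
Qed.

End StarHomCStar.

(** * States *)

Section HahnBanach.
Context {R : realType} (V : lmodType R[i]) (p : V -> R).
Hypothesis pD : forall x y, p (x + y) <= p x + p y.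
Hypothesis pZ : forall (s : R) x, 0 < s -> p (s%:C *: x) = s * p x.
Implicit Types (G : set (V * R)) (x y v : V).

Let p0 : p 0 = 0.
Proof. by have := pZ 0 (ltr0Sn R 1); rewrite scaler0 => h; lra. Qed.

(** A real-linear functional on a real subspace, dominated by [p] and encoded by its graph so that
    extension is inclusion of sets. Single-valuedness is a consequence: if (0, d) is in the graph
    then d <= p 0 = 0, and likewise for - d. *)
Definition dominated_graph G :=
  [/\ forall (s : R) g h, G g -> G h -> G (s%:C *: g.1 + h.1, s * g.2 + h.2),
      forall g, G g -> g.2 <= p g.1 & G (0, 0)].

Lemma dominated_graph_fun G x a b : dominated_graph G -> G (x, a) -> G (x, b) -> a = b.
Proof.
move=> [Gl Gp G0] Ga Gb.
have H c d : G (x, c) -> G (x, d) -> c <= d.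
  move=> Gc Gd; have := Gp _ (Gl (-1) _ _ Gd Gc) => /=.
  by rewrite rmorphN1 scaleN1r addNr p0 mulN1r addrC subr_le0.
by apply/eqP; rewrite eq_le !H.
Qed.

(** The value at x is the supremum of g - p(g - x) over the graph; subadditivity of [p] keeps it
    below every p(h + x) - h, and these two bounds are domination for negative and positive
    multiples of x. *)
Lemma dominated_graph_extend G x : dominated_graph G -> ~ (exists a, G (x, a)) ->
  exists G', [/\ dominated_graph G', G `<=` G' & exists a, G' (x, a)].
Proof.
move=> [Gl Gp G0] Gx.
pose E := [set t | exists2 g : V * R, G g & t = g.2 - p (g.1 - x)].
have Eub g h : G g -> G h -> g.2 - p (g.1 - x) <= p (h.1 + x) - h.2.
  move=> Gg Gh; have := Gp _ (Gl 1 _ _ Gg Gh); rewrite /= rmorph1 scale1r mul1r.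
  have := pD (g.1 - x) (h.1 + x); rewrite addrACA addNr addr0; lra.
have E0 : E !=set0 by exists (0 - p (0 - x)); exists (0, 0).
have supE : has_sup E.
  by split => //; exists (p (0 + x) - 0) => _ [g Gg ->]; exact: (Eub g (0, 0)).
have cge g : G g -> g.2 - p (g.1 - x) <= sup E.
  by move=> Gg; apply: sup_upper_bound => //; exists g.
have cle h : G h -> sup E <= p (h.1 + x) - h.2.
  by move=> Gh; apply: ge_sup => // _ [g Gg ->]; exact: Eub.
have Gz s g : G g -> G (s%:C *: g.1, s * g.2).
  by move=> Gg; have := Gl s _ _ Gg G0; rewrite /= !addr0.
exists [set z | exists g s, G g /\ z = (g.1 + s%:C *: x, g.2 + s * sup E)]; split.
- split.
  + move=> s _ _ [g [a [Gg ->]]] [h [b [Gh ->]]] /=.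
    exists (s%:C *: g.1 + h.1, s * g.2 + h.2), (s * a + b); split; first exact: Gl.
    congr (_, _) => /=; last by ring.
    by rewrite rmorphD rmorphM /= scalerDr scalerDl scalerA addrACA.
  + move=> _ [g [s [Gg ->]]] /=.
    have [s0|s0|->] := ltgtP s 0; last by rewrite scale0r mul0r !addr0 Gp.
    * have := cge _ (Gz (- s)^-1 _ Gg) => /=.
      have -> : (- s)^-1%:C *: g.1 - x = (- s)^-1%:C *: (g.1 + s%:C *: x).
        rewrite scalerDr scalerA -rmorphM /= (_ : _ * s = -1) ?rmorphN1 ?scaleN1r //.
        by rewrite invrN mulNr mulVf // lt_eqF.
      rewrite pZ ?invr_gt0 ?oppr_gt0 // -mulrBr ler_pdivrMl ?oppr_gt0 //; lra.
    * have := cle _ (Gz s^-1 _ Gg) => /=.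
      have -> : s^-1%:C *: g.1 + x = s^-1%:C *: (g.1 + s%:C *: x).
        by rewrite scalerDr scalerA -rmorphM /= mulVf ?gt_eqF // scale1r.
      rewrite pZ ?invr_gt0 // -mulrBr ler_pdivlMl //; lra.
  + by exists (0, 0), 0; split => //=; rewrite scale0r mul0r !addr0.
- by move=> [v a] Gg; exists (v, a), 0; split => //=; rewrite scale0r mul0r !addr0.
- exists (sup E); exists (0, 0), 1; split => //=.
  by rewrite rmorph1 scale1r mul1r !add0r.
Qed.

Lemma hahn_banach v0 : exists f : V -> R,
  [/\ forall (s : R) x y, f (s%:C *: x + y) = s * f x + f y,
      forall x, f x <= p x & f v0 = p v0].
Proof.
pose G0 : set (V * R) := [set g | exists s : R, g = (s%:C *: v0, s * p v0)].
have dG0 : dominated_graph G0.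
  split.
  - move=> s _ _ [a ->] [b ->] /=; exists (s * a + b).
    by rewrite rmorphD rmorphM /= scalerDl scalerA mulrDl mulrA.
  - move=> _ [s ->] /=; have [s0|s0|->] := ltgtP s 0.
    + have Ns0 : 0 < - s by rewrite oppr_gt0.
      have := pD (s%:C *: v0) ((- s)%:C *: v0).
      by rewrite -scalerDl -rmorphD /= subrr scale0r p0 (pZ _ Ns0); lra.
    + by rewrite pZ.
    + by rewrite scale0r mul0r p0.
  - by exists 0; rewrite scale0r mul0r.
pose P := [set G : set (V * R) | G = set0 \/ dominated_graph G /\ G0 `<=` G].
have [F FP tF|G [PG maxG]] := @Zorn_bigcup _ P.
  have [[G1 FG1 G1n0]|Fe] := pselect (exists2 G, F G & G !=set0); last first.
    left; rewrite -subset0 => g [G FG Gg]; apply: Fe; exists G => //.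
    by exists g.
  have good G : F G -> G !=set0 -> dominated_graph G /\ G0 `<=` G.
    by move=> /FP[-> [x []]|].
  right; have [[_ _ G1z] G01] := good _ FG1 G1n0; split.
    split.
    - move=> s g h [G FG Gg] [H FH Hh].
      have [GH|HG] := tF _ _ FG FH.
        have [[Hl _ _] _] := good _ FH (ex_intro _ _ Hh).
        by exists H => //; apply: Hl => //; exact: GH.
      have [[Gl _ _] _] := good _ FG (ex_intro _ _ Gg).
      by exists G => //; apply: Gl => //; exact: HG.
    - move=> g [G FG Gg]; have [[_ Gp _] _] := good _ FG (ex_intro _ _ Gg).
      exact: Gp.
    - by exists G1.
  by move=> g /G01 Gg; exists G1.
have [dG G0G] : dominated_graph G /\ G0 `<=` G.
  case: PG => // Ge; exfalso; apply: (maxG G0); last by right; split.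
  rewrite Ge; split; first by move=> ? [].
  by case: dG0 => _ _ z0 /(_ _ z0).
have tot x : exists a, G (x, a).
  apply: contrapT => nx; have [G' [dG' GG' [a Ga]]] := dominated_graph_extend dG nx.
  apply: (maxG G'); last by right; split=> // g /G0G /GG'.
  by split=> // /(_ _ Ga) Gxa; apply: nx; exists a.
pose f x := sval (cid (tot x)).
have fG x : G (x, f x) := svalP (cid (tot x)).
exists f; split.
- move=> s x y; apply: (dominated_graph_fun dG (fG _)).
  by case: dG => Gl _ _; exact: (Gl s (x, f x) (y, f y)).
- by move=> x; case: dG => _ Gp _; exact: (Gp (x, f x)).
- apply: (dominated_graph_fun dG (fG _)); apply: G0G; exists 1.
  by rewrite scale1r mul1r.
Qed.

End HahnBanach.

(** * Semi-inner products and positive functionals *)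

Section SesquilinearForms.
Context {R : realType} {V : lmodType R[i]}.
Implicit Types (x y z : V) (c : R[i]).

Definition semi_inner (h : V -> V -> R[i]) :=
  [/\ forall c x y z, h (c *: x + y) z = c * h x z + h y z,
      forall c x y z, h z (c *: x + y) = c^* * h z x + h z y
    & forall x, 0 <= h x x].

Variable h : V -> V -> R[i].
Hypothesis hh : semi_inner h.

Lemma formDl x y z : h (x + y) z = h x z + h y z.
Proof. by case: hh => hl _ _; rewrite -[x]scale1r hl mul1r scale1r. Qed.
Lemma formDr x y z : h z (x + y) = h z x + h z y.
Proof. by case: hh => _ hr _; rewrite -[x]scale1r hr rmorph1 mul1r scale1r. Qed.
Lemma form0l z : h 0 z = 0.
Proof. by apply: (addrI (h 0 z)); rewrite -formDl !addr0. Qed.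
Lemma form0r z : h z 0 = 0.
Proof. by apply: (addrI (h z 0)); rewrite -formDr !addr0. Qed.
Lemma formZl c x z : h (c *: x) z = c * h x z.
Proof. by case: hh => hl _ _; rewrite -[_ *: _]addr0 hl form0l addr0. Qed.
Lemma formZr c x z : h z (c *: x) = c^* * h z x.
Proof. by case: hh => _ hr _; rewrite -[_ *: _]addr0 hr form0r addr0. Qed.
Lemma formNl x z : h (- x) z = - h x z.
Proof. by rewrite -scaleN1r formZl mulN1r. Qed.
Lemma formNr x z : h z (- x) = - h z x.
Proof. by rewrite -scaleN1r formZr rmorphN1 mulN1r. Qed.
Lemma formBl x y z : h (x - y) z = h x z - h y z.
Proof. by rewrite formDl formNl. Qed.
Lemma formBr x y z : h z (x - y) = h z x - h z y.
Proof. by rewrite formDr formNr. Qed.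
Lemma form_ge0 x : 0 <= h x x. Proof. by case: hh. Qed.

(** Hermitian symmetry is not an axiom of [semi_inner]: it follows from the values of the form at x
    + y and x + i y being real. *)
Lemma formC x y : h y x = (h x y)^*.
Proof.
have h1 := form_ge0 (x + y); have h2 := form_ge0 (x + 'i *: y).
have /ger0_Im hx := form_ge0 x; have /ger0_Im hy := form_ge0 y.
move: h1 h2 => /ger0_Im + /ger0_Im.
rewrite !formDl !formDr !formZl !formZr !conjCi -complexiE.
case: (h x y) => a b; case: (h y x) => c d; case: (h x x) hx => ? ? /= ->.
case: (h y y) hy => ? ? /= -> /= h1 h2.
by apply/eqP; rewrite eq_complex /=; apply/andP; split; apply/eqP; lra.
Qed.

Lemma cauchy_schwarz x y : `|h x y| ^+ 2 <= h x x * h y y.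
Proof.
have key u v c : 0 <= h u u - c^* * h u v - c * (h u v)^* + c * c^* * h v v.
  rewrite [X in 0 <= X](_ : _ = h (u - c *: v) (u - c *: v)) ?form_ge0 //.
  by rewrite formBl !formBr !formZl !formZr (formC u v); ring.
have pos_case u v : 0 < h v v -> `|h u v| ^+ 2 <= h u u * h v v.
  move=> v0; have := key u v (h u v / h v v).
  have vr : (h v v)^* = h v v by rewrite -formC.
  rewrite rmorphM fmorphV /= vr -(pmulr_rge0 _ v0) normCK => H.
  rewrite -subr_ge0; apply: le_trans H _; rewrite le_eqVlt; apply/orP; left; apply/eqP.
  by field; rewrite gt_eqF.
have [/pos_case //|y0] := boolP (0 < h y y).
have y00 : h y y = 0 by apply/eqP; move: y0; rewrite lt_def form_ge0 andbT negbK.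
have [x0|x0] := boolP (0 < h x x).
  by have := pos_case y x x0; rewrite formC norm_conjC mulrC.
have x00 : h x x = 0 by apply/eqP; move: x0; rewrite lt_def form_ge0 andbT negbK.
(* Both vectors are null here; the coefficient c = h x y leaves the inequality 0 <= - 2 |h x
   y|^2. *)
have := key x y (h x y); rewrite x00 y00 !mulr0 addr0 sub0r normCK [_^* * _]mulrC.
rewrite -opprD -mulr2n oppr_ge0 pmulrn_lle0 //.
Qed.

Lemma form_null_l x y : h x x = 0 -> h x y = 0.
Proof.
move=> x0; apply/eqP; rewrite -normr_eq0 -sqrf_eq0 eq_le exprn_ge0 ?normr_ge0 // andbT.
by have := cauchy_schwarz x y; rewrite x0 mul0r.
Qed.

End SesquilinearForms.

Section PositiveFunctionals.
Context {R : realType} {A : starAlgType R}.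
Implicit Types (x y z : A) (c : R[i]).

(** Continuity is left out because the matrix algebras carry no norm here; on a C*-algebra it
    follows from positivity by [pfun_bound]. *)
Definition pfun (phi : A -> R[i]) := scalar phi /\ forall x, 0 <= phi (star x * x).

Variable phi : A -> R[i].
Hypothesis hphi : pfun phi.

Lemma pfunD x y : phi (x + y) = phi x + phi y.
Proof. by case: hphi => l _; rewrite -[x]scale1r l /= mul1r scale1r. Qed.
Lemma pfun0 : phi 0 = 0.
Proof. by apply: (addrI (phi 0)); rewrite -pfunD !addr0. Qed.
Lemma pfunZ c x : phi (c *: x) = c * phi x.
Proof. by case: hphi => l _; rewrite -[c *: x]addr0 l /= pfun0 addr0. Qed.
Lemma pfunN x : phi (- x) = - phi x.
Proof. by rewrite -scaleN1r pfunZ mulN1r. Qed.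
Lemma pfunB x y : phi (x - y) = phi x - phi y.
Proof. by rewrite pfunD pfunN. Qed.
Lemma pfun_sum I (r : seq I) (P : pred I) (F : I -> A) :
  phi (\sum_(i <- r | P i) F i) = \sum_(i <- r | P i) phi (F i).
Proof. exact: (big_morph phi pfunD pfun0). Qed.
Lemma pfun_ge0 x : 0 <= phi (star x * x). Proof. by case: hphi. Qed.

Lemma pfun_semi_inner : semi_inner (fun x y => phi (star y * x)).
Proof.
split=> [c x y z|c x y z|x]; last exact: pfun_ge0.
  by rewrite mulrDr -scalerAr pfunD pfunZ.
by rewrite starD starZ mulrDl -scalerAl pfunD pfunZ.
Qed.

Lemma pfun_star x : phi (star x) = (phi x)^*.
Proof. by have := formC pfun_semi_inner x 1; rewrite star1 mul1r mulr1. Qed.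

Lemma pfun_cs x y : `|phi (star y * x)| ^+ 2 <= phi (star x * x) * phi (star y * y).
Proof. exact: (cauchy_schwarz pfun_semi_inner). Qed.

Lemma pfun_null x y : phi (star x * x) = 0 -> phi (y * x) = 0.
Proof. by move=> x0; rewrite -(starK y) (form_null_l pfun_semi_inner _ x0). Qed.

Lemma pfun1_ge0 : 0 <= phi 1.
Proof. by have := pfun_ge0 1; rewrite star1 mul1r. Qed.

End PositiveFunctionals.

Lemma pfun_comp {R : realType} {A B : starAlgType R} (f : A -> B) (phi : B -> R[i]) :
  star_hom f -> pfun phi -> pfun (phi \o f).
Proof.
move=> hf hp; split=> [c x y|x] /=.
  by rewrite (star_homD hf) (star_homZ hf) (pfunD hp) (pfunZ hp).
by rewrite (star_homM hf) (star_homS hf); exact: pfun_ge0.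
Qed.

Lemma pfun_add {R : realType} {A : starAlgType R} (phi psi : A -> R[i]) :
  pfun phi -> pfun psi -> pfun (fun x => phi x + psi x).
Proof.
move=> hp hq; split=> [c x y|x] /=; last by rewrite addr_ge0 ?pfun_ge0.
rewrite (pfunD hp) (pfunZ hp) (pfunD hq) (pfunZ hq) mulrDr addrACA //.
Qed.

Lemma pfun_zero {R : realType} {A : starAlgType R} : pfun (fun _ : A => 0 : R[i]).
Proof. by split=> [c x y|x] //=; rewrite mulr0 addr0. Qed.

Lemma pfun_scale {R : realType} {A : starAlgType R} (phi : A -> R[i]) (c : R[i]) :
  0 <= c -> pfun phi -> pfun (fun x => c * phi x).
Proof.
move=> c0 hp; split=> [d x y|x] /=; last by rewrite mulr_ge0 ?pfun_ge0.
by rewrite (pfunD hp) (pfunZ hp) mulrDr mulrCA.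
Qed.

Lemma pfun_bigsum {R : realType} {A : starAlgType R} I (r : seq I)
  (phi : I -> A -> R[i]) : (forall i, pfun (phi i)) ->
  pfun (fun x => \sum_(i <- r) phi i x).
Proof.
move=> hp; elim: r => [|i r IHr].
  by rewrite (_ : (fun _ => _) = fun=> 0) //; [exact: pfun_zero|apply/funext => x; rewrite big_nil].
rewrite (_ : (fun _ => _) = fun x => phi i x + \sum_(i <- r) phi i x).
  exact: pfun_add.
by apply/funext => x; rewrite big_cons.
Qed.

Section PositiveFunctionalsCStar.
Context {R : realType} {A : cstarAlgType R} (phi : A -> R[i]).
Hypothesis hphi : pfun phi.
Implicit Types (x y z : A).

Lemma pfun_pos h : pos h -> 0 <= phi h.
Proof.
move=> /pos_sqrt[y [py <- _]]; have := pfun_ge0 hphi y.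
by rewrite (pos_sa py).
Qed.

Lemma pfun_starM_le x : phi (star x * x) <= (nrm x ^+ 2)%:C * phi 1.
Proof.
rewrite -subr_ge0 -(pfunZ hphi) -(pfunB hphi); apply: pfun_pos.
by rewrite -nrm_starM; apply: pos_nrmB => //; exact: saJ.
Qed.

Lemma pfun_bound x : `|phi x| <= (nrm x)%:C * phi 1.
Proof.
have p1 := pfun1_ge0 hphi.
have n0 : 0 <= (nrm x)%:C * phi 1 by rewrite mulr_ge0 // ler0c nrm_ge0.
rewrite -(ler_pXn2r (n := 2)) ?nnegrE //.
have := pfun_cs hphi x 1; rewrite star1 !mul1r => /le_trans; apply.
by rewrite exprMn [phi 1 ^+ 2]expr2 mulrA ler_wpM2r // -rmorphXn /= pfun_starM_le.
Qed.

End PositiveFunctionalsCStar.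

(** * States attaining the norm *)

Section States.
Context {R : realType} {A : cstarAlgType R}.
Implicit Types (x y a : A) (t s : R).

(** The real upper bounds of the real part of x. Their infimum [p] below is the largest spectral
    value of that real part, and is the sublinear functional fed to Hahn-Banach. *)
Let T x := [set t : R | pos (sc (t + t) - (x + star x))].

Let sa_re x : sa (x + star x).
Proof. by rewrite /sa starD starK addrC. Qed.

Let pos_sc_ge0 t : pos (sc t : A) -> 0 <= t.
Proof.
move=> pt; rewrite leNgt; apply/negP => t0.
have := pos_sc (A := A) (t := - t); rewrite oppr_ge0 => /(_ (ltW t0)) pnt.
have : (sc t : A) = 0.
  apply: pos_opp_eq0 => //; rewrite (_ : - sc t = sc (- t)) //.
  by rewrite /sc rmorphN scaleNr.
by move/(congr1 nrm); rewrite nrm_sc nrm0 => /eqP; rewrite normr_eq0 lt_eqF.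
Qed.

Let T_nrm x : T x (nrm x).
Proof.
apply: pos_nrmB => //.
by rewrite (le_trans (nrmD _ _)) // nrm_star.
Qed.

Let T_lb x t : T x t -> - nrm x <= t.
Proof.
move=> Tt; have := T_nrm (- x); rewrite /T /= nrmN starN -opprD opprK => h.
have E : (sc (t + t) - (x + star x)) + (sc (nrm x + nrm x) + (x + star x)) =
    sc (t + t) + sc (nrm x + nrm x) by ncring.
have := posD Tt h; rewrite E.
by rewrite -scD => /pos_sc_ge0; lra.
Qed.

Let p x := inf (T x).

Let has_lbT x : has_lbound (T x).
Proof. by exists (- nrm x) => t; exact: T_lb. Qed.

Let p_le x t : T x t -> p x <= t.
Proof. by move=> Tt; apply: ge_inf. Qed.

Let le_p x t : (forall s, T x s -> t <= s) -> t <= p x.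
Proof. by move=> h; apply: lb_le_inf => //; exists (nrm x). Qed.

Let pD x y : p (x + y) <= p x + p y.
Proof.
rewrite -lerBlDr; apply: le_p => s Ts; rewrite lerBlDr -lerBlDl.
apply: le_p => t Tt; rewrite lerBlDl; apply: p_le.
have := posD Ts Tt; rewrite /T /= starD; congr pos.
by rewrite !scD; ncring.
Qed.

Let TZ x t s : 0 < s -> T x t -> T (s%:C *: x) (s * t).
Proof.
move=> s0 /(posZ (ltW s0)); rewrite /T /= scalerBr scalerDr starZr.
by rewrite -scM [sc s * _]scM /sc scalerA -rmorphM mulrDr.
Qed.

Let pZ s x : 0 < s -> p (s%:C *: x) = s * p x.
Proof.
have H r y : 0 < r -> r * p y <= p (r%:C *: y).
  move=> r0; apply: le_p => t Tt; rewrite -ler_pdivlMl //; apply: p_le.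
  have := TZ (x := r%:C *: y) (t := t) (s := r^-1).
  rewrite scalerA -rmorphM /= mulVf ?gt_eqF // scale1r; apply => //.
  by rewrite invr_gt0.
move=> s0; apply/eqP; rewrite eq_le H // andbT.
have := H s^-1 (s%:C *: x); rewrite invr_gt0 => /(_ s0).
by rewrite scalerA -rmorphM /= mulVf ?gt_eqF // scale1r ler_pdivrMl.
Qed.

Let p_sa h : sa h -> forall t, pos (sc t - h) -> p h <= t.
Proof.
move=> sh t ht; apply: p_le; rewrite /T /= sh scD.
by rewrite opprD addrACA; exact: posD.
Qed.

(** A real functional f dominated by [p] is positive, because p(- h) <= 0 for positive h, and has
    f(1) = 1, from the bounds at 1 and - 1. It attains p(a* a) = |a|^2. *)
Lemma state_exists a : exists phi : A -> R[i],
  [/\ pfun phi, phi 1 = 1 & phi (star a * a) = (nrm a ^+ 2)%:C].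
Proof.
have [f [fl fp fa]] := hahn_banach pD pZ (star a * a).
have fD x y : f (x + y) = f x + f y by rewrite -[x]scale1r fl mul1r scale1r.
have f0 : f 0 = 0 by apply: (addrI (f 0)); rewrite -fD !addr0.
have fZ s x : f (s%:C *: x) = s * f x by rewrite -[_ *: _]addr0 fl f0 addr0.
have fN x : f (- x) = - f x by rewrite -scaleN1r -[-1](rmorphN1 (real_complex R)) fZ mulN1r.
(* Both i h and - i h have real part 0, so domination gives f <= 0 at each. *)
have fi_sa h : sa h -> f ('i *: h) = 0.
  move=> sh; have pi0 c : c^* = - c -> p (c *: h) <= 0.
    move=> cc; apply: p_le; rewrite /T /= starZ sh cc scaleNr subrr addr0 sc0 subr0.
    exact: pos0.
  have := le_trans (fp _) (pi0 'i (conjCi _)).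
  have Ni : (- 'i)^* = - - 'i :> R[i] by rewrite rmorphN /= conjCi.
  have := le_trans (fp _) (pi0 _ Ni).
  by rewrite scaleNr fN => h1 h2; lra.
(* The complex-linear functional whose real part is f. *)
pose phi x : R[i] := Complex (f x) (- f ('i *: x)).
have phi_sa h : sa h -> phi h = (f h)%:C by move=> sh; rewrite /phi fi_sa // oppr0.
exists phi; split.
- split=> [[c d] x y|x].
    have cdE : Complex c d = c%:C + 'i * d%:C by rewrite [LHS]complexE complexiE.
    have E1 : f (Complex c d *: x) = c * f x + d * f ('i *: x).
      by rewrite cdE scalerDl fD fZ [_ * d%:C]mulrC -scalerA fZ.
    have E2 : f ('i *: (Complex c d *: x)) = c * f ('i *: x) - d * f x.
      rewrite cdE scalerDl scalerDr fD scalerA mulrC -scalerA fZ; congr (_ + _).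
      by rewrite scalerA mulrA -expr2 sqrCi mulN1r -rmorphN fZ mulNr.
    rewrite /phi scalerDr !fD E1 E2 /=; apply/eqP; rewrite eq_complex /=.
    by apply/andP; split; apply/eqP; ring.
  rewrite phi_sa ?ler0c; last exact: saJ.
  rewrite -oppr_le0 -fN (le_trans (fp _)) //; apply: p_sa; first exact/saN/saJ.
  by rewrite sc0 add0r opprK; exact: starM_pos.
- rewrite phi_sa; last exact: sa1.
  have h1 : f 1 <= 1.
    rewrite (le_trans (fp _)) //; apply: p_sa; first exact: sa1.
    by rewrite /sc rmorph1 scale1r subrr; exact: pos0.
  have h2 : f (- 1) <= - 1.
    rewrite (le_trans (fp _)) //; apply: p_sa; first exact/saN/sa1.
    by rewrite /sc rmorphN1 scaleN1r subrr; exact: pos0.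
  congr (_%:C); apply/eqP; rewrite eq_le h1 /=; move: h2; rewrite fN; lra.
- rewrite phi_sa; last exact: saJ.
  rewrite fa -nrm_starM; congr (_%:C); apply/eqP; rewrite eq_le; apply/andP; split.
    by apply: p_sa; [exact: saJ|apply: pos_nrmB => //; exact: saJ].
  apply: le_p => t; rewrite /T /= starM starK scD opprD addrACA => /pos_half pt.
  apply: pos_nrm_le => //; last exact: starM_pos.
  by apply: pos_sc_ge0; rewrite -(subrK (star a * a) (sc t)); apply: posD => //; exact: starM_pos.
Qed.

End States.

(** * Operators on Hilbert spaces *)

Section ComplexSequences.
Context {R : realType}.

Fact conjc_scale (c : R[i]) (x : R[i]^o) : ((c *: x : R[i]^o) : R[i])^* = c^* * x^*.
Proof. exact: rmorphM. Qed.

(** The scalars as a star algebra over themselves, so that [ncvg] and its lemmas also serve scalar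
    sequences. *)
HB.instance Definition _ := isStarAlgebra.Build R (R[i]^o)
  (star := fun z : R[i]^o => (z : R[i])^* : R[i]^o)
  (@conjCK R[i]) (@rmorphD _ _ Num.conj)
  (fun x y => etrans (rmorphM Num.conj x y) (mulrC _ _)) conjc_scale.

Fact regular_cnormZ (c : R[i]) (x : R[i]^o) : `|(c *: x : R[i]^o) : R[i]| = `|c| * `|x : R[i]|.
Proof. exact: normrM. Qed.

Fact regular_cnormM (x y : R[i]^o) :
  `|(x * y : R[i]^o) : R[i]| <= `|x : R[i]| * `|y : R[i]|.
Proof. by rewrite -normrM. Qed.

HB.instance Definition _ := isNormedStarAlgebra.Build R (R[i]^o)
  (cnorm := fun z : R[i]^o => `|z : R[i]|)
  (@ler_normD _ R[i]) regular_cnormZ (@normr0_eq0 _ R[i])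
  regular_cnormM.

Implicit Types (s : nat -> R[i]^o) (l : R[i]^o).

Lemma nrm_complex l : nrm l = complex.Re `|l : R[i]|.
Proof. by []. Qed.

Lemma nrm_complexE l : (nrm l)%:C = `|l : R[i]|.
Proof. exact: nrmE. Qed.

Lemma ReB (x y : R[i]) : complex.Re (x - y) = complex.Re x - complex.Re y.
Proof. by case: x; case: y. Qed.

Lemma ImB (x y : R[i]) : complex.Im (x - y) = complex.Im x - complex.Im y.
Proof. by case: x; case: y. Qed.

Lemma complex_complete s : ncauchy s -> exists l, ncvg s l.
Proof.
move=> sc.
have re_cvg (r : nat -> R) :
    (forall m n, `|r m - r n| <= nrm (s m - s n)) -> exists a : R, r @ \oo --> a.
  move=> rs; suff /cvg_ex[a ra] : cvgn r by exists a.
  apply/cauchy_cvgP/cauchyP => e e0; have [N HN] := sc e e0.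
  exists (r N); exists N => // n Nn; rewrite -ball_normE /ball_ /=.
  by rewrite (le_lt_trans (rs _ _)) // HN.
have normi : `|'i%C : R[i]| = 1.
  by rewrite normc_def /= expr0n expr1n add0r sqrtr1.
have re_le (z : R[i]^o) : `|complex.Re z| <= nrm z.
  by rewrite -lecR nrm_complexE normc_ge_Re.
have im_le (z : R[i]^o) : `|complex.Im z| <= nrm z.
  rewrite -[complex.Im z]opprK normrN -ReiNIm (le_trans (re_le _)) //.
  by rewrite nrm_complex normrM normi mulr1.
have [a ra] : exists a : R, (fun n => complex.Re (s n : R[i])) @ \oo --> a.
  by apply: re_cvg => m n; rewrite -ReB.
have [b rb] : exists b : R, (fun n => complex.Im (s n : R[i])) @ \oo --> b.
  by apply: re_cvg => m n; rewrite -ImB.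
exists (a%:C + 'i%C * b%:C : R[i]).
apply: (@ncvg_le _ _ _ _ (fun n => `|complex.Re (s n : R[i]) - a| +
    `|complex.Im (s n : R[i]) - b|)) => [n|].
  have -> : s n - (a%:C + 'i%C * b%:C) =
      (complex.Re (s n) - a)%:C + 'i%C * (complex.Im (s n) - b)%:C :> R[i]^o.
    rewrite {1}[s n]complexE !rmorphB /=; ring.
  rewrite (le_trans (nrmD _ _)) // lerD // nrm_complex ?normrM ?normi ?mul1r.
    by rewrite normc_def /= expr0n addr0 sqrtr_sqr.
  by rewrite normc_def /= expr0n addr0 sqrtr_sqr.
have h (r : nat -> R) (l : R) : r @ \oo --> l -> (fun n => `|r n - l|) @ \oo --> (0 : R).
  move=> rl; rewrite -(normr0 R); apply: cvg_norm.
  by rewrite -(subrr l); apply: cvgB => //; exact: cvg_cst.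
by rewrite -[0]addr0; apply: cvgD; exact: h.
Qed.

Lemma ncvg_ge0 s l : ncvg s l -> (forall n, 0 <= (s n : R[i])) -> 0 <= (l : R[i]).
Proof.
move=> sl s0; suff <- : `|l : R[i]| = l :> R[i] by exact: normr_ge0.
apply: (@ncvg_unique _ _ s _ _ _ sl) => e /sl; apply: filterS => n.
apply: le_lt_trans; rewrite nrm_complex -{1}(ger0_norm (s0 n)).
by rewrite -lecR nrm_complexE RRe_real ?realE ?normr_ge0 // ler_dist_dist.
Qed.

End ComplexSequences.

(** * Seminorms and completion of pre-Hilbert spaces *)

Section SemiNorm.
Context {R : realType} {V : lmodType R[i]} (h : V -> V -> R[i]).
Hypothesis hh : semi_inner h.
Implicit Types (x y z : V) (c : R[i]) (u v : nat -> V).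

Definition snorm x : R := Num.sqrt (complex.Re (h x x)).

Lemma snorm_ge0 x : 0 <= snorm x. Proof. exact: sqrtr_ge0. Qed.

Lemma snorm_sqr x : (snorm x ^+ 2)%:C = h x x.
Proof.
have := form_ge0 hh x; rewrite /snorm; case: (h x x) => a b.
by rewrite lecE /= => /andP[/eqP -> a0]; rewrite sqr_sqrtr.
Qed.

Lemma snorm_sqrE x : snorm x ^+ 2 = complex.Re (h x x).
Proof. by apply: complexI; rewrite snorm_sqr RRe_real // ger0_real // form_ge0. Qed.

Lemma snorm_cs x y : `|h x y| <= (snorm x * snorm y)%:C.
Proof.
rewrite -(ler_pXn2r (n := 2)) ?nnegrE ?normr_ge0 ?ler0c ?mulr_ge0 ?snorm_ge0 //.
have -> : (snorm x * snorm y)%:C ^+ 2 = (snorm x ^+ 2)%:C * (snorm y ^+ 2)%:C :> R[i].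
  by rewrite -rmorphXn exprMn rmorphM.
by rewrite !snorm_sqr; exact: (cauchy_schwarz hh).
Qed.

Lemma snorm_le x (r : R) : 0 <= r -> h x x <= (r ^+ 2)%:C -> snorm x <= r.
Proof.
move=> r0 hr; rewrite -(ler_pXn2r (n := 2)) ?nnegrE ?snorm_ge0 //.
by rewrite -lecR snorm_sqr.
Qed.

Lemma snormD x y : snorm (x + y) <= snorm x + snorm y.
Proof.
have re_le : complex.Re (h x y) <= snorm x * snorm y.
  by rewrite (le_trans (ler_norm _)) // -lecR (le_trans (normc_ge_Re _)) ?snorm_cs.
rewrite -(ler_pXn2r (n := 2)) ?nnegrE ?addr_ge0 ?snorm_ge0 //.
have -> : snorm (x + y) ^+ 2 = snorm x ^+ 2 + snorm y ^+ 2 + 2 * complex.Re (h x y).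
  rewrite !snorm_sqrE !(formDl hh) !(formDr hh) (formC hh x y).
  by case: (h x x) => ? ?; case: (h x y) => ? ?; case: (h y y) => ? ? /=; ring.
by have := snorm_ge0 x; have := snorm_ge0 y; nra.
Qed.

Lemma snormZ c x : snorm (c *: x) = complex.Re `|c| * snorm x.
Proof.
have c0 : 0 <= complex.Re `|c| by rewrite -lecR RRe_real ?normr_ge0 // ger0_real.
apply/eqP; rewrite -(eqrXn2 (n := 2)) ?mulr_ge0 ?snorm_ge0 //; apply/eqP.
apply: complexI; rewrite snorm_sqr (formZl hh) (formZr hh) mulrA -normCK -snorm_sqr.
have E (a b : R) : ((a * b) ^+ 2)%:C = a%:C ^+ 2 * (b ^+ 2)%:C :> R[i].
  by rewrite exprMn rmorphM rmorphXn.
by rewrite E RRe_real // ger0_real.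
Qed.

Lemma snorm0 : snorm 0 = 0.
Proof. by rewrite /snorm (form0l hh) sqrtr0. Qed.

Lemma snormN x : snorm (- x) = snorm x.
Proof. by rewrite -scaleN1r snormZ normrN1 mul1r. Qed.

Lemma snormBC x y : snorm (x - y) = snorm (y - x).
Proof. by rewrite -snormN opprB. Qed.

Lemma snorm_tri x y z : snorm (x - z) <= snorm (x - y) + snorm (y - z).
Proof. by rewrite (le_trans _ (snormD _ _)) // subrKA. Qed.

Lemma form_bound_snorm x (r : R) : 0 <= r ->
  (forall y, `|h x y| <= (r * snorm y)%:C) -> snorm x <= r.
Proof.
move=> r0 hr; have := hr x; rewrite ger0_norm ?form_ge0 // -snorm_sqr lecR expr2.
have [->//|x0] := eqVneq (snorm x) 0.
by rewrite ler_pM2r // lt_neqAle eq_sym x0 snorm_ge0.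
Qed.

Definition scauchy u := forall e : R, 0 < e -> exists N, forall m n,
  (N <= m)%N -> (N <= n)%N -> snorm (u m - u n) < e.

Definition scvg u x := forall e : R, 0 < e -> \forall n \near \oo, snorm (u n - x) < e.

Lemma scauchy_cst x : scauchy (fun=> x).
Proof. by move=> e e0; exists 0%N => m n _ _; rewrite subrr snorm0. Qed.

Lemma scauchy_lin c u v : scauchy u -> scauchy v -> scauchy (fun n => c *: u n + v n).
Proof.
move=> cu cv e e0; set r := complex.Re `|c|.
have r0 : 0 <= r by rewrite -lecR RRe_real ?normr_ge0 // ger0_real.
have [N HN] := cu (e / 2 / (r + 1)) ltac:(rewrite !divr_gt0 // ltr_pwDr //).
have [M HM] := cv (e / 2) ltac:(rewrite divr_gt0 //).
exists (maxn N M) => m n; rewrite !geq_max => /andP[Nm Mm] /andP[Nn Mn].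
rewrite opprD addrACA -scalerBr (le_lt_trans (snormD _ _)) // snormZ -/r.
rewrite [ltRHS]splitr ler_ltD ?HM //.
have := HN _ _ Nm Nn; rewrite ltr_pdivlMr; last by rewrite ltr_pwDr.
have := snorm_ge0 (u m - u n); nra.
Qed.

Lemma scauchy_bounded u : scauchy u -> exists2 K : R, 0 < K & forall n, snorm (u n) <= K.
Proof.
move=> /(_ 1 ltr01)[N HN].
exists (\sum_(i < N) snorm (u i) + snorm (u N) + 1).
  by rewrite ltr_pwDr // addr_ge0 ?snorm_ge0 // sumr_ge0 // => i _; exact: snorm_ge0.
move=> n; have [Nn|nN] := leqP N n.
  have := HN n N Nn (leqnn N); have := snormD (u n - u N) (u N); rewrite subrK.
  have : 0 <= \sum_(i < N) snorm (u i) by rewrite sumr_ge0 // => i _; exact: snorm_ge0.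
  lra.
rewrite (bigD1 (Ordinal nN)) //= -!addrA lerDl !addr_ge0 ?snorm_ge0 //.
by rewrite sumr_ge0 // => i _; exact: snorm_ge0.
Qed.

Lemma scauchy_form u v : scauchy u -> scauchy v ->
  ncauchy (fun n => h (u n) (v n) : R[i]^o).
Proof.
move=> cu cv e e0; have [K K0 uK] := scauchy_bounded cu; have [L L0 vL] := scauchy_bounded cv.
have [N HN] := cu (e / 2 / L) ltac:(rewrite !divr_gt0 //).
have [M HM] := cv (e / 2 / K) ltac:(rewrite !divr_gt0 //).
exists (maxn N M) => m n; rewrite !geq_max => /andP[Nm Mm] /andP[Nn Mn].
have -> : h (u m) (v m) - h (u n) (v n) = h (u m - u n) (v m) + h (u n) (v m - v n) :> R[i]^o.
  by rewrite (formBl hh) (formBr hh) addrA subrK.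
rewrite (le_lt_trans (nrmD _ _)) // [ltRHS]splitr.
have csR x y : nrm (h x y : R[i]^o) <= snorm x * snorm y.
  by rewrite -lecR nrm_complexE snorm_cs.
apply: ltrD; apply: le_lt_trans (csR _ _) _.
  have := HN _ _ Nm Nn; rewrite ltr_pdivlMr //; apply: le_lt_trans.
  by rewrite ler_wpM2l ?snorm_ge0.
have := HM _ _ Mm Mn; rewrite ltr_pdivlMr // mulrC; apply: le_lt_trans.
by rewrite ler_wpM2r ?snorm_ge0.
Qed.

End SemiNorm.

(* The unit vector keeps the operator algebra from being the zero ring. *)
Structure preHilbert (R : realType) := PreHilbert {
  ph_car :> lmodType R[i];
  ph_form : ph_car -> ph_car -> R[i];
  ph_unit : ph_car;
  ph_ax : semi_inner ph_form;
  ph_unitE : ph_form ph_unit ph_unit = 1 }.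

Section Completion.
Context {R : realType} (P : preHilbert R).
Local Notation h := (@ph_form R P).
Local Notation hh := (@ph_ax R P).

(** The completion is the space of Cauchy sequences with the limiting form. Null sequences are not
    divided out, so limits in it are determined only up to null vectors. *)
Definition cseq_pred : {pred nat -> P} := fun u => `[< scauchy h u >].

Fact cseq_submod_closed : submod_closed cseq_pred.
Proof.
split; first by apply/asboolP; exact: (scauchy_cst hh).
by move=> c u v /asboolP cu /asboolP cv; apply/asboolP; exact: (scauchy_lin hh).
Qed.

HB.instance Definition _ := GRing.isSubmodClosed.Build R[i] (nat -> P) cseq_pred
  cseq_submod_closed.

Record cseq := CSeq { cseq_val :> nat -> P; cseq_valP : cseq_val \in cseq_pred }.

HB.instance Definition _ := [isSub for cseq_val].
HB.instance Definition _ := [Choice of cseq by <:].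
HB.instance Definition _ := [SubChoice_isSubLmodule of cseq by <:].

Implicit Types (u v w : cseq).

Lemma cseqP u : scauchy h u.
Proof. exact: (asboolW (cseq_valP u)). Qed.

Fact cform_subproof u v : exists l : R[i], ncvg (fun n => h (u n) (v n) : R[i]^o) l.
Proof. exact/complex_complete/(scauchy_form hh)/cseqP/cseqP. Qed.

Definition cform u v : R[i] := sval (cid (cform_subproof u v)).

Lemma cformP u v : ncvg (fun n => h (u n) (v n) : R[i]^o) (cform u v).
Proof. exact: svalP (cid (cform_subproof u v)). Qed.

Lemma cform_eq u v (l : R[i]) : ncvg (fun n => h (u n) (v n) : R[i]^o) l -> cform u v = l.
Proof. exact: ncvg_unique (cformP u v). Qed.

Fact cform_semi_inner : semi_inner cform.
Proof.
split=> [c u v w|c u v w|u].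
- apply: cform_eq; apply: eq_ncvg (ncvgD (ncvgZ c (cformP u w)) (cformP v w)) => n.
  by rewrite [RHS](_ : _ = h (c *: u n + v n) (w n)) // (formDl hh) (formZl hh).
- apply: cform_eq; apply: eq_ncvg (ncvgD (ncvgZ c^* (cformP w u)) (cformP w v)) => n.
  by rewrite [RHS](_ : _ = h (w n) (c *: u n + v n)) // (formDr hh) (formZr hh).
- by apply: ncvg_ge0 (cformP u u) _ => n; exact: (form_ge0 hh).
Qed.

Definition cembed (x : P) : cseq := CSeq (asboolT (scauchy_cst hh x)).

Lemma cform_embed x y : cform (cembed x) (cembed y) = h x y.
Proof. by apply: cform_eq; exact: ncvg_cst. Qed.

Fact cform_unitE : cform (cembed (ph_unit P)) (cembed (ph_unit P)) = 1.
Proof. by rewrite cform_embed ph_unitE. Qed.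

Definition completion_pre := PreHilbert cform_semi_inner cform_unitE.

Lemma snorm_embed x : snorm cform (cembed x) = snorm h x.
Proof. by rewrite /snorm cform_embed. Qed.

Lemma cform_snorm_le u (r : R) : (\forall n \near \oo, snorm h (u n) <= r) ->
  snorm cform u <= r.
Proof.
move=> [N _ HN]; have r0 : 0 <= r by rewrite (le_trans (snorm_ge0 h (u N))) ?HN //=.
apply: (snorm_le _ r0); first exact: cform_semi_inner.
rewrite -[X in X <= _]ger0_norm; last exact: (form_ge0 cform_semi_inner).
rewrite -nrm_complexE lecR.
apply: (@ncvg_nrm_le _ _ (fun n => h (u (n + N)%N) (u (n + N)%N) : R[i]^o)).
  move=> n; rewrite -lecR nrm_complexE ger0_norm ?(form_ge0 hh) // -(snorm_sqr hh) lecR.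
  by rewrite ler_pXn2r ?nnegrE ?snorm_ge0 // HN //= leq_addl.
move=> e /(cformP u u)[M _ HM]; exists M => // n /= Mn; apply: HM => /=.
exact: leq_trans Mn (leq_addr _ _).
Qed.

Lemma scvg_embed u : scvg cform (fun n => cembed (u n)) u.
Proof.
move=> e e0; have [N HN] := cseqP u (e := e / 2) ltac:(rewrite divr_gt0 //).
exists N => // n /= Nn; apply: (@le_lt_trans _ _ (e / 2)); last by rewrite ltr_pdivrMr //; lra.
by apply: cform_snorm_le; exists N => // m /= Nm; rewrite ltW // HN.
Qed.

(** Each U_k lies within 1/(k+1) of an embedded vector x_k; the sequence of the x_k is Cauchy in
    [P], hence itself a point of the completion, and is the limit. *)
Lemma completion_complete (U : nat -> cseq) : scauchy cform U ->
  exists l, scvg cform U l.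
Proof.
move=> cU; have ch := cform_semi_inner.
have app k : exists x, snorm cform (cembed x - U k) < k.+1%:R^-1.
  have [N _ /(_ N (leqnn N)) h1] := scvg_embed (U k) (e := k.+1%:R^-1) ltac:(rewrite invr_gt0 //).
  by exists (U k N).
pose x k := sval (cid (app k)).
have xP k : snorm cform (cembed (x k) - U k) < k.+1%:R^-1 := svalP (cid (app k)).
have inve (e : R) : 0 < e -> exists N, forall n, (N <= n)%N -> n.+1%:R^-1 < e.
  move=> e0; exists (Num.truncn e^-1) => n Nn.
  rewrite invf_plt ?posrE // (lt_le_trans (truncnS_gt _)) // ler_nat.
  by rewrite ltnS.
have cx : scauchy h x.
  move=> e e0; have e30 : 0 < e / 3 by rewrite divr_gt0.
  have [N HN] := inve _ e30; have [M HM] := cU _ e30.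
  exists (maxn N M) => m n; rewrite !geq_max => /andP[Nm Mm] /andP[Nn Mn].
  have -> : snorm h (x m - x n) = snorm cform (cembed (x m) - cembed (x n)).
    rewrite -snorm_embed; congr snorm; exact/val_inj.
  have -> : e = e / 3 + (e / 3 + e / 3) by lra.
  apply: le_lt_trans (snorm_tri ch _ (U m) _) _; apply: ltrD.
    exact: lt_trans (xP m) (HN _ Nm).
  apply: le_lt_trans (snorm_tri ch _ (U n) _) _; apply: ltrD; first exact: HM.
  by rewrite (snormBC ch); exact: lt_trans (xP n) (HN _ Nn).
exists (CSeq (asboolT cx)) => e e0; have e20 : 0 < e / 2 by rewrite divr_gt0.
have [N HN] := inve _ e20; have [M _ HM] := scvg_embed (CSeq (asboolT cx)) e20.
exists (maxn N M) => // n /=; rewrite geq_max => /andP[Nn Mn].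
rewrite [ltRHS]splitr; apply: le_lt_trans (snorm_tri ch _ (cembed (x n)) _) _.
apply: ltrD; last exact: HM.
by rewrite (snormBC ch); exact: lt_trans (xP n) (HN _ Nn).
Qed.

End Completion.

Structure semiHilbert (R : realType) := SemiHilbert {
  sh_pre :> preHilbert R;
  sh_complete : forall u, scauchy (@ph_form R sh_pre) u ->
    exists x, scvg (@ph_form R sh_pre) u x }.

(** * The C*-algebra of bounded operators *)

Section BoundedOperators.
Context {R : realType} (S : semiHilbert R).
Local Notation h := (@ph_form R S).
Local Notation hh := (@ph_ax R S).
Local Notation sn := (snorm h).
Implicit Types (v w : S).

(* An operator is identified with its form (v, w) |-> <T v, w>, which sees
   vectors only up to null vectors. *)
Definition bounded_form (t : S -> S -> R[i]^o) :=
  exists T T' : S -> S, exists2 K : R, forall v, sn (T v) <= K * sn v &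
    forall v w, t v w = h (T v) w /\ t v w = h v (T' w).

Definition bop_pred : {pred S -> S -> R[i]^o} := fun t => `[< bounded_form t >].

Fact bop_submod_closed : submod_closed bop_pred.
Proof.
split.
  apply/asboolP; exists (fun=> 0), (fun=> 0), 0 => [v|v w].
    by rewrite mul0r (snorm0 hh).
  by rewrite (form0l hh) (form0r hh).
move=> c s t /asboolP[T [T' [K TK sT]]] /asboolP[U [U' [L UL tU]]]; apply/asboolP.
exists (fun v => c *: T v + U v), (fun w => c^* *: T' w + U' w), (complex.Re `|c| * K + L).
  move=> v; rewrite (le_trans (snormD hh _ _)) // (snormZ hh) mulrDl lerD //.
  by rewrite -mulrA ler_wpM2l // -lecR RRe_real ?normr_ge0 // ger0_real.
move=> v w; rewrite [(_ + _) v w](_ : _ = c * s v w + t v w) //.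
have [s1 s2] := sT v w; have [t1 t2] := tU v w; split.
  by rewrite (formDl hh) (formZl hh) s1 t1.
by rewrite (formDr hh) (formZr hh) conjCK s2 t2.
Qed.

HB.instance Definition _ := GRing.isSubmodClosed.Build R[i] (S -> S -> R[i]^o) bop_pred
  bop_submod_closed.

Record bop := Bop { bop_val :> S -> S -> R[i]^o; bop_valP : bop_val \in bop_pred }.

HB.instance Definition _ := [isSub for bop_val].
HB.instance Definition _ := [Choice of bop by <:].
HB.instance Definition _ := [SubChoice_isSubLmodule of bop by <:].

Implicit Types (s t : bop).

Lemma bopP s t : (forall v w, s v w = t v w) -> s = t.
Proof. by move=> st; apply/val_inj/funext => v; apply/funext => w; exact: st. Qed.

Lemma bopDE s t v w : (s + t) v w = s v w + t v w. Proof. by []. Qed.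
Lemma bopZE c t v w : (c *: t) v w = c * t v w. Proof. by []. Qed.
Lemma bopBE s t v w : (s - t) v w = s v w - t v w. Proof. by []. Qed.
Lemma bop0E v w : (0 : bop) v w = 0. Proof. by []. Qed.

Fact bop_subproof t : {T : (S -> S) * (S -> S) | (exists K : R, forall v, sn (T.1 v) <= K * sn v)
  /\ forall v w, t v w = h (T.1 v) w /\ t v w = h v (T.2 w)}.
Proof.
apply: cid; have /asboolP[T [T' [K TK tT]]] := bop_valP t.
by exists (T, T'); split => //; exists K.
Qed.

(** Chosen values of the operator, and below of its adjoint. They are fixed only up to null vectors,
    so [bapp t] need not be linear and identities about it hold inside the form. *)
Definition bapp t : S -> S := (sval (bop_subproof t)).1.
Definition badj t : S -> S := (sval (bop_subproof t)).2.

Lemma bappE t v w : t v w = h (bapp t v) w.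
Proof. by have [_ /(_ v w)[]] := svalP (bop_subproof t). Qed.
Lemma badjE t v w : t v w = h v (badj t w).
Proof. by have [_ /(_ v w)[]] := svalP (bop_subproof t). Qed.
Lemma bapp_bounded t : exists2 K : R, 0 <= K & forall v, sn (bapp t v) <= K * sn v.
Proof.
have [[K HK] _] := svalP (bop_subproof t); exists (Num.max 0 K); first by rewrite le_max lexx.
move=> v; apply: le_trans (HK v) _; rewrite ler_wpM2r ?snorm_ge0 //.
by rewrite le_max lexx orbT.
Qed.

Definition mkbop (T T' : S -> S) (K : R) (TK : forall v, sn (T v) <= K * sn v)
  (TT' : forall v w, h (T v) w = h v (T' w)) : bop :=
  @Bop (fun v w => h (T v) w) (asboolT (ex_intro _ T (ex_intro _ T'
    (ex_intro2 _ _ K TK (fun v w => conj erefl (TT' v w)))))).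

Definition bop1 : bop := @mkbop id id 1 (fun v => eq_ind_r (fun r => _ <= r) (lexx _) (mul1r _))
  (fun _ _ => erefl).

Fact bop_mul_bound s t : exists K, forall v, sn (bapp s (bapp t v)) <= K * sn v.
Proof.
have [K K0 sK] := bapp_bounded s; have [L L0 tL] := bapp_bounded t.
exists (K * L) => v; apply: le_trans (sK _) _.
by rewrite -mulrA ler_wpM2l.
Qed.

Definition bop_mul s t : bop :=
  @mkbop (fun v => bapp s (bapp t v)) (fun w => badj t (badj s w))
   _ (svalP (cid (bop_mul_bound s t)))
   (fun v w => etrans (esym (bappE s _ _)) (etrans (badjE s _ _)
     (etrans (esym (bappE t _ _)) (badjE t _ _)))).

Lemma bop_mulE s t v w : bop_mul s t v w = s (bapp t v) w.
Proof. by rewrite [RHS]bappE. Qed.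
Lemma bop_mulE' s t v w : bop_mul s t v w = t v (badj s w).
Proof. by rewrite bop_mulE badjE bappE. Qed.

Lemma bop_congl t v v' w : (forall y, h v y = h v' y) -> t v w = t v' w.
Proof. by move=> vv'; rewrite !badjE vv'. Qed.

Fact bop_mulA : associative bop_mul.
Proof.
move=> r s t; apply: bopP => v w; rewrite !bop_mulE; apply: bop_congl => y.
by rewrite -!bappE bop_mulE.
Qed.
Fact bop_mul1 : left_id bop1 bop_mul.
Proof. by move=> t; apply: bopP => v w; rewrite bop_mulE [RHS]bappE. Qed.
Fact bop_mulr1 : right_id bop1 bop_mul.
Proof. by move=> t; apply: bopP => v w; rewrite bop_mulE; apply: bop_congl => y; rewrite -bappE. Qed.
Fact bop_mulDl : left_distributive bop_mul +%R.
Proof. by move=> r s t; apply: bopP => v w; rewrite bopDE !bop_mulE. Qed.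
Fact bop_mulDr : right_distributive bop_mul +%R.
Proof. by move=> r s t; apply: bopP => v w; rewrite bopDE !bop_mulE' bopDE. Qed.
Fact bop1_neq0 : bop1 != 0.
Proof.
apply/eqP => e; have : bop1 (ph_unit S) (ph_unit S) = 0 by rewrite e.
by apply/eqP; rewrite -[_ (ph_unit S) _]/(h _ _) ph_unitE oner_neq0.
Qed.

HB.instance Definition _ := GRing.Zmodule_isNzRing.Build bop
  bop_mulA bop_mul1 bop_mulr1 bop_mulDl bop_mulDr bop1_neq0.

Fact bop_scaleAl (c : R[i]) s t : c *: (s * t) = (c *: s) * t.
Proof. by apply: bopP => v w; rewrite bopZE !bop_mulE. Qed.
Fact bop_scaleAr (c : R[i]) s t : c *: (s * t) = s * (c *: t).
Proof. by apply: bopP => v w; rewrite bopZE !bop_mulE'. Qed.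

HB.instance Definition _ := GRing.Lmodule_isLalgebra.Build R[i] bop bop_scaleAl.
HB.instance Definition _ := GRing.Lalgebra_isAlgebra.Build R[i] bop bop_scaleAr.

Fact badj_bound t : exists K : R, forall v, sn (badj t v) <= K * sn v.
Proof.
have [K K0 tK] := bapp_bounded t; exists K => v.
apply: (form_bound_snorm hh); first by rewrite mulr_ge0 ?snorm_ge0.
move=> y; rewrite (formC hh) norm_conjC -badjE bappE (le_trans (snorm_cs hh _ _)) // lecR.
by rewrite mulrAC ler_wpM2r ?snorm_ge0.
Qed.

Definition bop_star t : bop := @mkbop (badj t) (bapp t) _ (svalP (cid (badj_bound t)))
  (fun v w => etrans (formC hh w (badj t v)) (etrans (congr1 Num.conj
    (etrans (esym (badjE t w v)) (bappE t w v))) (esym (formC hh (bapp t w) v)))).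

Lemma bop_starE t v w : bop_star t v w = (t w v)^*.
Proof. by rewrite [RHS](congr1 Num.conj (badjE t w v)) -(formC hh). Qed.

Fact bop_starK : involutive bop_star.
Proof. by move=> t; apply: bopP => v w; rewrite !bop_starE conjCK. Qed.
Fact bop_starD s t : bop_star (s + t) = bop_star s + bop_star t.
Proof. by apply: bopP => v w; rewrite bopDE !bop_starE bopDE rmorphD. Qed.
Fact bop_starM s t : bop_star (s * t) = bop_star t * bop_star s.
Proof.
apply: bopP => v w; rewrite bop_starE [X in X^*]bop_mulE [RHS]bop_mulE bop_starE.
by rewrite (bappE t) (formC hh) -bappE bop_starE conjCK.
Qed.
Fact bop_starZ (c : R[i]) t : bop_star (c *: t) = c^* *: bop_star t.
Proof. by apply: bopP => v w; rewrite bopZE !bop_starE bopZE rmorphM. Qed.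

HB.instance Definition _ := isStarAlgebra.Build R bop bop_starK bop_starD bop_starM bop_starZ.

End BoundedOperators.

Section OperatorNorm.
Context {R : realType} (S : semiHilbert R).
Local Notation h := (@ph_form R S).
Local Notation hh := (@ph_ax R S).
Local Notation sn := (snorm h).
Implicit Types (v w : S) (s t : bop S).

Lemma real_complexM (a b : R) : (a * b)%:C = a%:C * b%:C :> R[i].
Proof. exact: rmorphM. Qed.

Definition bop_bound t := [set K : R | 0 <= K /\ forall v w, `|t v w : R[i]| <= (K * sn v * sn w)%:C].

Definition bop_norm t : R := inf (bop_bound t).

Lemma bop_bound_ex t : bop_bound t !=set0.
Proof.
have [K K0 tK] := bapp_bounded t; exists K; split=> // v w.
rewrite bappE (le_trans (snorm_cs hh _ _)) // lecR ler_wpM2r ?snorm_ge0 //.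
Qed.

Lemma bop_norm_le t K : 0 <= K -> (forall v w, `|t v w : R[i]| <= (K * sn v * sn w)%:C) ->
  bop_norm t <= K.
Proof. by move=> K0 tK; apply: ge_inf; [exists 0 => ? [] | split]. Qed.

Lemma bop_norm_ge0 t : 0 <= bop_norm t.
Proof. by apply: lb_le_inf; [exact: bop_bound_ex | move=> ? []]. Qed.

Lemma bop_normP t v w : `|t v w : R[i]| <= (bop_norm t * sn v * sn w)%:C.
Proof.
have tE : `|t v w : R[i]| = (complex.Re `|t v w : R[i]|)%:C.
  by rewrite RRe_real // ger0_real.
rewrite tE lecR.
have key K : bop_bound t K -> complex.Re `|t v w : R[i]| <= K * (sn v * sn w).
  by move=> [_ /(_ v w)]; rewrite tE lecR mulrA.
have [vw0|vw0] := eqVneq (sn v * sn w) 0.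
  by have [K /key] := bop_bound_ex t; rewrite -mulrA vw0 !mulr0.
have vwp : 0 < sn v * sn w by rewrite lt_neqAle eq_sym vw0 mulr_ge0 ?snorm_ge0.
rewrite -mulrA -ler_pdivrMr //; apply: lb_le_inf; first exact: bop_bound_ex.
by move=> K /key; rewrite ler_pdivrMr.
Qed.

Lemma snorm_bapp_le t v : sn (bapp t v) <= bop_norm t * sn v.
Proof.
apply: (form_bound_snorm hh); first by rewrite mulr_ge0 ?bop_norm_ge0 ?snorm_ge0.
by move=> y; rewrite -bappE bop_normP.
Qed.

Lemma bop_norm_le_app t K : 0 <= K -> (forall v, sn (bapp t v) <= K * sn v) ->
  bop_norm t <= K.
Proof.
move=> K0 tK; apply: bop_norm_le => // v w.
by rewrite bappE (le_trans (snorm_cs hh _ _)) // lecR ler_wpM2r ?snorm_ge0.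
Qed.

Lemma bop_normD s t : bop_norm (s + t) <= bop_norm s + bop_norm t.
Proof.
apply: bop_norm_le => [|v w]; first by rewrite addr_ge0 ?bop_norm_ge0.
rewrite bopDE (le_trans (ler_normD _ _)) // !mulrDl rmorphD /= lerD //; exact: bop_normP.
Qed.

Lemma bop_normZ_le (c : R[i]) t : bop_norm (c *: t) <= complex.Re `|c| * bop_norm t.
Proof.
have c0 : 0 <= complex.Re `|c| by rewrite -lecR RRe_real ?normr_ge0 // ger0_real.
apply: bop_norm_le => [|v w]; first by rewrite mulr_ge0 ?bop_norm_ge0.
rewrite bopZE normrM -!mulrA real_complexM RRe_real ?ger0_real //.
by rewrite ler_wpM2l // mulrA bop_normP.
Qed.

Lemma bop_normZ (c : R[i]) t : bop_norm (c *: t) = complex.Re `|c| * bop_norm t.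
Proof.
apply/eqP; rewrite eq_le bop_normZ_le andTb.
have [->|c0] := eqVneq c 0.
  by rewrite normr0 mul0r bop_norm_ge0.
have c1 : complex.Re `|c| * complex.Re `|c^-1| = 1.
  apply: complexI; rewrite real_complexM !RRe_real ?ger0_real // -normrM mulfV //.
  by rewrite normr1.
have c0' : 0 <= complex.Re `|c| by rewrite -lecR RRe_real ?normr_ge0 // ger0_real.
have := bop_normZ_le c^-1 (c *: t); rewrite scalerA mulVf // scale1r.
by move=> /(ler_wpM2l c0'); rewrite mulrA c1 mul1r.
Qed.

Lemma bop_norm_eq0 t : bop_norm t = 0 -> t = 0.
Proof.
move=> t0; apply: bopP => v w; apply/eqP; rewrite bop0E -normr_le0.
by have := bop_normP t v w; rewrite t0 !mul0r.
Qed.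

Lemma bop_normM s t : bop_norm (s * t) <= bop_norm s * bop_norm t.
Proof.
apply: bop_norm_le => [|v w]; first by rewrite mulr_ge0 ?bop_norm_ge0.
rewrite bop_mulE (le_trans (bop_normP _ _ _)) // lecR ler_wpM2r ?snorm_ge0 //.
by rewrite -mulrA ler_wpM2l ?bop_norm_ge0 ?snorm_bapp_le.
Qed.

Lemma bop_norm_star t : bop_norm (star t) <= bop_norm t.
Proof.
apply: bop_norm_le => [|v w]; first exact: bop_norm_ge0.
by rewrite bop_starE norm_conjC mulrAC bop_normP.
Qed.

Lemma bop_norm_starM t : bop_norm (star t * t) = bop_norm t ^+ 2.
Proof.
apply/eqP; rewrite eq_le; apply/andP; split.
  by rewrite (le_trans (bop_normM _ _)) // expr2 ler_wpM2r ?bop_norm_ge0 ?bop_norm_star.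
have r0 := bop_norm_ge0 (star t * t).
rewrite -[X in _ <= X]sqr_sqrtr // ler_pXn2r ?nnegrE ?sqrtr_ge0 ?bop_norm_ge0 //.
apply: bop_norm_le_app => [|v]; first exact: sqrtr_ge0.
rewrite -(ler_pXn2r (n := 2)) ?nnegrE ?mulr_ge0 ?sqrtr_ge0 ?snorm_ge0 //.
rewrite exprMn (sqr_sqrtr r0) -lecR (snorm_sqr hh).
have := bop_normP (star t * t) v v; rewrite bop_mulE bop_starE [t v _]bappE norm_conjC.
by rewrite ger0_norm ?(form_ge0 hh) // -mulrA -expr2.
Qed.

Definition bop_cnorm t : R[i] := (bop_norm t)%:C.

Fact bop_cnormD s t : bop_cnorm (s + t) <= bop_cnorm s + bop_cnorm t.
Proof. by rewrite -rmorphD lecR bop_normD. Qed.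
Fact bop_cnormZ (c : R[i]) t : bop_cnorm (c *: t) = `|c| * bop_cnorm t.
Proof. by rewrite /bop_cnorm bop_normZ real_complexM RRe_real // ger0_real. Qed.
Fact bop_cnorm0_eq0 t : bop_cnorm t = 0 -> t = 0.
Proof. by move=> /complexI; exact: bop_norm_eq0. Qed.
Fact bop_cnormM s t : bop_cnorm (s * t) <= bop_cnorm s * bop_cnorm t.
Proof. by rewrite -rmorphM lecR bop_normM. Qed.

HB.instance Definition _ := isNormedStarAlgebra.Build R (bop S)
  bop_cnormD bop_cnormZ bop_cnorm0_eq0 bop_cnormM.

Lemma snorm_bappB_le s t v : sn (bapp s v - bapp t v) <= nrm (s - t) * sn v.
Proof.
apply: (form_bound_snorm hh); first by rewrite mulr_ge0 ?bop_norm_ge0 ?snorm_ge0.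
by move=> y; rewrite (formBl hh) -!bappE -bopBE bop_normP.
Qed.

Lemma snorm_badjB_le s t v : sn (badj s v - badj t v) <= nrm (s - t) * sn v.
Proof.
apply: (form_bound_snorm hh); first by rewrite mulr_ge0 ?bop_norm_ge0 ?snorm_ge0.
move=> y; rewrite (formC hh) norm_conjC (formBr hh) -!badjE -bopBE mulrAC.
exact: bop_normP.
Qed.

(** [F] stands for [bapp] and for [badj]; the estimate is assumed on differences because neither is
    additive in the operator. *)
Lemma bop_pointwise_cauchy (u : nat -> bop S) (F : bop S -> S -> S) :
  (forall s t v, sn (F s v - F t v) <= nrm (s - t) * sn v) -> ncauchy u ->
  forall v, scauchy h (fun n => F (u n) v).
Proof.
move=> FB cu v e e0; have v1 : 0 < sn v + 1 by rewrite ltr_pwDr ?snorm_ge0.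
have [N HN] := cu (e / (sn v + 1)) ltac:(rewrite divr_gt0 //).
exists N => m n Nm Nn; rewrite (le_lt_trans (FB _ _ _)) //.
have := HN _ _ Nm Nn; rewrite ltr_pdivlMr //; apply: le_lt_trans.
by rewrite ler_wpM2l ?nrm_ge0 // lerDl.
Qed.

Lemma scvg_form_unique (x y : nat -> S) v w v' w' :
  (forall n, h (x n) w = h v (y n)) -> scvg h x v' -> scvg h y w' -> h v' w = h v w'.
Proof.
move=> xy xv yw.
have H (z : R[i]) : (forall e : R, 0 < e -> `|z| <= (e * (sn w + sn v))%:C) -> z = 0.
  move=> hz; apply/eqP; rewrite -normr_eq0 -[ `|z|](RRe_real (ger0_real (normr_ge0 z))).
  apply/eqP; congr (_%:C); apply/eqP.
  rewrite eq_le -(lecR 0) RRe_real ?normr_ge0 ?ger0_real // andbT.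
  apply/ler_addgt0Pr => e e0; rewrite add0r.
  have p0 : 0 < sn w + sn v + 1 by rewrite ltr_pwDr ?addr_ge0 ?snorm_ge0.
  have := hz (e / (sn w + sn v + 1)) ltac:(rewrite divr_gt0 //).
  rewrite -(RRe_real (ger0_real (normr_ge0 z))) lecR => /le_trans; apply.
  by rewrite mulrAC ler_pdivrMr // ler_wpM2l ?(ltW e0) // lerDl.
apply/subr0_eq/H => e e0; have [N _ HN] := filterI (xv e e0) (yw e e0).
have [/= h1 h2] := HN N (leqnn N).
have -> : h v' w - h v w' = h v (y N - w') - h (x N - v') w.
  by rewrite (formBl hh) (formBr hh) xy; ring.
rewrite (le_trans (ler_normB _ _)) // addrC mulrDr rmorphD /= lerD //.
  by rewrite (le_trans (snorm_cs hh _ _)) // lecR ler_wpM2r ?snorm_ge0 // ltW.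
by rewrite (le_trans (snorm_cs hh _ _)) // lecR mulrC ler_wpM2r ?snorm_ge0 // ltW.
Qed.

Lemma bop_ncauchy_cvg (u : nat -> bop S) : ncauchy u -> exists l, ncvg u l.
Proof.
move=> cu.
have appc v := sh_complete (bop_pointwise_cauchy snorm_bappB_le cu v).
have adjc v := sh_complete (bop_pointwise_cauchy snorm_badjB_le cu v).
pose T v := sval (cid (appc v)); pose T' v := sval (cid (adjc v)).
have TP v : scvg h (fun n => bapp (u n) v) (T v) := svalP (cid (appc v)).
have T'P v : scvg h (fun n => badj (u n) v) (T' v) := svalP (cid (adjc v)).
have TT' v w : h (T v) w = h v (T' w).
  by apply: scvg_form_unique (TP v) (T'P w) => n; rewrite -bappE badjE.
(* The Cauchy estimate survives the pointwise limit with a constant independent of v, which upgrades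
   pointwise convergence to norm convergence. *)
have close (e : R) N : (forall m n, (N <= m)%N -> (N <= n)%N -> nrm (u m - u n) < e) ->
    forall n, (N <= n)%N -> forall v, sn (bapp (u n) v - T v) <= e * sn v.
  move=> HN n Nn v; apply/ler_addgt0Pr => d d0.
  have [M _ HM] := TP v d d0.
  rewrite (le_trans (snorm_tri hh _ (bapp (u (maxn N M)) v) _)) // lerD //.
    rewrite (le_trans (snorm_bappB_le _ _ _)) // ler_wpM2r ?snorm_ge0 // ltW //.
    by rewrite HN // leq_maxl.
  by rewrite ltW // HM //= leq_maxr.
have [N1 HN1] := cu 1 ltr01.
have Tb v : sn (T v) <= (bop_norm (u N1) + 1) * sn v.
  rewrite -(subrK (bapp (u N1) v) (T v)) addrC (le_trans (snormD hh _ _)) // mulrDl lerD //.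
    exact: snorm_bapp_le.
  by rewrite (snormBC hh) (close _ N1).
exists (mkbop Tb TT') => e e0.
have e20 : 0 < e / 2 by rewrite divr_gt0.
have [N HN] := cu _ e20; exists N => // n /= Nn.
apply: (@le_lt_trans _ _ (e / 2)); last by rewrite ltr_pdivrMr //; lra.
apply: bop_norm_le => [|v w]; first exact: ltW.
rewrite bopBE bappE -[mkbop _ _ _ _]/(h (T v) w) -(formBl hh).
rewrite (le_trans (snorm_cs hh _ _)) // lecR ler_wpM2r ?snorm_ge0 //.
exact: close HN _ Nn _.
Qed.

Fact bop_cnorm_star t : cnorm (star t * t) = cnorm t ^+ 2.
Proof. by rewrite -rmorphXn -bop_norm_starM. Qed.

HB.instance Definition _ := isCStarAlgebra.Build R (bop S)
  (@cauchy_filter_cvg R (bop S) bop_ncauchy_cvg) bop_cnorm_star.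

End OperatorNorm.

Section BoundedElements.
Context {R : realType} {M : starAlgType R}.
Implicit Types (a b x : M) (phi : M -> R[i]).

(** A bound on a* a that is uniform over positive functionals. It replaces the norm for elements of
    a star algebra and makes their action bounded in every representation. *)
Definition bounded_elt a := exists2 K : R, 0 <= K &
  forall phi, pfun phi -> phi (star a * a) <= K%:C * phi 1.

(** The parallelogram identity, with the nonnegative term of a - b dropped; it accounts for the
    factor 2. *)
Lemma bounded_elt_add a b : bounded_elt a -> bounded_elt b -> bounded_elt (a + b).
Proof.
move=> [K K0 aK] [L L0 bL]; exists (2 * (K + L)) => [|phi pp].
  by rewrite mulr_ge0 ?addr_ge0.
have E : star (a + b) * (a + b) + star (a - b) * (a - b) =
    (star a * a + star a * a) + (star b * b + star b * b).
  by rewrite starD starB; ncring.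
have := pfun_ge0 pp (a - b); rewrite -(lerDl (phi (star (a + b) * (a + b)))) -(pfunD pp) E.
move=> /le_trans; apply; rewrite !(pfunD pp).
have -> : (2 * (K + L))%:C * phi 1 = (K%:C * phi 1 + K%:C * phi 1) + (L%:C * phi 1 + L%:C * phi 1).
  by rewrite real_complexM !rmorphD /= rmorph1; ring.
by rewrite !lerD ?aK ?bL.
Qed.

Lemma bounded_elt0 : bounded_elt 0.
Proof. by exists 0 => // phi pp; rewrite mulr0 (pfun0 pp) mul0r. Qed.

Lemma bounded_elt_sum I (r : seq I) (F : I -> M) : (forall i, bounded_elt (F i)) ->
  bounded_elt (\sum_(i <- r) F i).
Proof.
by move=> bF; elim/big_ind: _ => //; [exact: bounded_elt0|exact: bounded_elt_add].
Qed.

End BoundedElements.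

Lemma bounded_elt_cstar {R : realType} {A : cstarAlgType R} (a : A) : bounded_elt a.
Proof.
exists (nrm a ^+ 2) => [|phi pp]; first by rewrite exprn_ge0 ?nrm_ge0.
exact: pfun_starM_le.
Qed.

(** * Representations on completions *)

Section Representation.
Context {R : realType} (P : preHilbert R).
Local Notation h := (@ph_form R P).
Local Notation hh := (@ph_ax R P).

Definition hilbert_completion : semiHilbert R := @SemiHilbert R (completion_pre P) (@completion_complete R P).
Local Notation H := hilbert_completion.
Local Notation ch := (@ph_ax R H).
Implicit Types (s t : bop H) (T U : P -> P) (x y : P).

Lemma embed_dense (v v' : H) :
  (forall y, ph_form v (cembed y : H) = ph_form v' (cembed y : H)) ->
  forall w : H, ph_form v w = ph_form v' w.
Proof.
move=> vv' w; apply/subr0_eq; rewrite -(formBl ch); set d := v - v'.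
have dy y : ph_form d (cembed y : H) = 0 by rewrite (formBl ch) vv' subrr.
apply: (@ncvg_unique _ _ (fun n => ph_form d w : R[i]^o)); first exact: ncvg_cst.
move=> e e0; have d1 : 0 < snorm (@ph_form R H) d + 1 by rewrite ltr_pwDr ?snorm_ge0.
have [N _ HN] := @scvg_embed R P w (e / (snorm (@ph_form R H) d + 1))
  ltac:(rewrite divr_gt0 //).
have /= wN := HN N (leqnn N).
suff hb : `|ph_form d w| < e%:C.
  by exists 0%N => // n _ /=; rewrite subr0 -ltcR nrm_complexE.
rewrite (_ : ph_form d w = ph_form d (w - (cembed (w N) : H))); last first.
  by rewrite (formBr ch) dy subr0.
apply: le_lt_trans (snorm_cs ch _ _) _; rewrite ltcR (snormBC ch).
move: wN; rewrite ltr_pdivlMr // mulrC; apply: le_lt_trans.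
by rewrite ler_wpM2r ?snorm_ge0 // lerDl.
Qed.

(** The operator t of the completion acts on embedded vectors as T, up to null vectors. By density
    this determines t. *)
Definition represents t T := forall x y,
  t (cembed x : H) (cembed y : H) = h (T x) y.

Lemma represents_inj s t T U : represents s T -> represents t U ->
  (forall x y, h (T x) y = h (U x) y) -> s = t.
Proof.
move=> sT tU TU; apply: bopP => v w.
have st x z : s (cembed x : H) z = t (cembed x : H) z.
  rewrite !bappE; apply: embed_dense => y; rewrite -!bappE sT tU; exact: TU.
have ts z x : ph_form (badj s z) (cembed x : H) = ph_form (badj t z) (cembed x : H).
  by rewrite (formC ch) -badjE st badjE -(formC ch).
rewrite !badjE (formC ch) (embed_dense (ts w)) -(formC ch) //.
Qed.

Lemma represents_mul s t T U : represents s T -> represents t U ->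
  represents (s * t) (fun x => T (U x)).
Proof.
move=> sT tU x y; rewrite bop_mulE -sT; apply: bop_congl; apply: embed_dense => z.
by rewrite -bappE tU [RHS]cform_embed.
Qed.

Lemma represents_star t T U : represents t T -> (forall x y, h (T x) y = h x (U y)) ->
  represents (star t) U.
Proof.
by move=> tT TU x y; rewrite bop_starE tT TU -(formC hh).
Qed.

Lemma represents1 : represents 1 id.
Proof. by move=> x y; rewrite -[LHS]/(cform _ _) cform_embed. Qed.

Lemma represents_lin (c : R[i]) s t T U : represents s T -> represents t U ->
  represents (c *: s + t) (fun x => c *: T x + U x).
Proof. by move=> sT tU x y; rewrite bopDE bopZE sT tU (formDl hh) (formZl hh). Qed.

Lemma snorm_adj_le T T' (K : R) : 0 <= K -> (forall x, snorm h (T x) <= K * snorm h x) ->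
  (forall x y, h (T x) y = h x (T' y)) -> forall y, snorm h (T' y) <= K * snorm h y.
Proof.
move=> K0 TK TT' y; apply: (form_bound_snorm hh); first by rewrite mulr_ge0 ?snorm_ge0.
move=> x; rewrite (formC hh) norm_conjC -TT' (le_trans (snorm_cs hh _ _)) // lecR.
by rewrite mulrAC ler_wpM2r ?snorm_ge0.
Qed.

Lemma scauchy_map T (K : R) (u : cseq P) : (forall x y, T (x - y) = T x - T y) ->
  (forall x, snorm h (T x) <= K * snorm h x) -> scauchy h (fun n => T (u n)).
Proof.
move=> TB TK e e0; have K1 : 0 < `|K| + 1 by rewrite ltr_pwDr.
have [N HN] := cseqP u (e := e / (`|K| + 1)) ltac:(rewrite divr_gt0 //).
exists N => m n Nm Nn; rewrite -TB (le_lt_trans (TK _)) //.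
have := HN _ _ Nm Nn; rewrite ltr_pdivlMr // mulrC; apply: le_lt_trans.
by rewrite ler_wpM2r ?snorm_ge0 // (le_trans (ler_norm _)) // lerDl.
Qed.

(** A bounded map that respects differences sends Cauchy sequences to Cauchy sequences, so it
    extends termwise; the formal adjoint T' inherits its bound from T and extends in the same
    way. *)
Lemma represents_exists T T' (K : R) :
  (forall x y, T (x - y) = T x - T y) -> (forall x y, T' (x - y) = T' x - T' y) ->
  (forall x, snorm h (T x) <= K * snorm h x) ->
  (forall x y, h (T x) y = h x (T' y)) -> exists t, represents t T.
Proof.
move=> TB TB' TK TT'; have TK1 x : snorm h (T x) <= `|K| * snorm h x.
  by rewrite (le_trans (TK x)) // ler_wpM2r ?snorm_ge0 // ler_norm.
have TK' := snorm_adj_le (normr_ge0 K) TK1 TT'.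
pose F (u : H) : H := CSeq (asboolT (scauchy_map u TB TK1)).
pose F' (u : H) : H := CSeq (asboolT (scauchy_map u TB' TK')).
have FF' (u v : H) : ph_form (F u) v = ph_form u (F' v).
  apply: cform_eq; apply: eq_ncvg (cformP u (F' v)) => n /=.
  by rewrite TT'.
have FK (u : H) : snorm (@ph_form R H) (F u) <= `|K| * snorm (@ph_form R H) u.
  apply/ler_addgt0Pr => e e0; have K1 : 0 < `|K| + 1 by rewrite ltr_pwDr.
  have [N _ HN] := @scvg_embed R P u (e / (`|K| + 1)) ltac:(rewrite divr_gt0 //).
  apply: cform_snorm_le; exists N => // n /= Nn; rewrite (le_trans (TK1 _)) //.
  have /= := HN n Nn; rewrite ltr_pdivlMr // => h1.
  have h2 : snorm h (u n) <= snorm (@ph_form R H) (cembed (u n) - u) + snorm (@ph_form R H) u.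
    by rewrite -(snorm_embed (u n)) -[X in snorm _ X <= _](subrK u) (snormD ch).
  apply: le_trans (ler_wpM2l (normr_ge0 K) h2) _; rewrite mulrDr addrC lerD2l.
  apply: le_trans (ltW h1); rewrite mulrC ler_wpM2l ?lerDl //.
  exact: snorm_ge0.
exists (mkbop FK FF') => x y; rewrite -[LHS]/(cform _ _).
apply: cform_eq; exact: ncvg_cst.
Qed.

End Representation.

Section StarRepresentation.
Context {R : realType} (M : starAlgType R) (P : preHilbert R) (act : M -> P -> P).
Local Notation h := (@ph_form R P).
Hypothesis actB : forall a x y, act a (x - y) = act a x - act a y.
Hypothesis act_lin : forall (c : R[i]) a b x y,
  h (act (c *: a + b) x) y = c * h (act a x) y + h (act b x) y.
Hypothesis actM : forall a b x y, h (act (a * b) x) y = h (act a (act b x)) y.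
Hypothesis act1 : forall x y, h (act 1 x) y = h x y.
Hypothesis act_star : forall a x y, h (act a x) y = h x (act (star a) y).

Lemma act_pfun x : pfun (fun a => h (act a x) x).
Proof.
split=> [c a b|a] /=; first exact: act_lin.
by rewrite actM act_star starK (form_ge0 (ph_ax P)).
Qed.

(** The functional a |-> h (act a x) x is positive, so [bounded_elt] bounds the norm of act a x by
    that of x. The algebraic laws of [act] are needed only inside the form, which suits actions
    defined up to null vectors. *)
Lemma star_representation (bM : forall a : M, bounded_elt a) :
  exists2 F : M -> bop (hilbert_completion P), star_hom F & forall a, represents (F a) (act a).
Proof.
have ex a : exists t : bop (hilbert_completion P), represents t (act a).
  have [K K0 aK] := bM a.
  apply: (@represents_exists _ _ _ (act (star a)) (Num.sqrt K)) => // x.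
  rewrite -(ler_pXn2r (n := 2)) ?nnegrE ?mulr_ge0 ?sqrtr_ge0 ?snorm_ge0 //.
  rewrite exprMn (sqr_sqrtr K0) -lecR [(K * _)%:C]real_complexM !(snorm_sqr (ph_ax P)).
  by have := aK _ (act_pfun x); rewrite act1 actM act_star starK.
pose F a := sval (cid (ex a)).
have FP a : represents (F a) (act a) := svalP (cid (ex a)).
exists F => //; split.
- move=> c a b; apply: represents_inj (FP _) (represents_lin c (FP a) (FP b)) _ => x y.
  by rewrite act_lin (formDl (ph_ax P)) (formZl (ph_ax P)).
- split.
    by apply: (represents_inj (FP 1) (@represents1 R P)) => x y; rewrite act1.
  move=> a b; apply: represents_inj (FP _) (represents_mul (FP a) (FP b)) _ => x y.
  exact: actM.
- move=> a; apply: represents_inj (FP _) (represents_star (FP a) (act_star a)) _ => x y.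
  by [].
Qed.

End StarRepresentation.

Lemma bop_pfun {R : realType} (S : semiHilbert R) (v : S) :
  pfun (fun t : bop S => t v v : R[i]).
Proof.
split=> [c s t|t]; first by [].
by rewrite bop_mulE bop_starE [t v _]bappE conj_ge0 (form_ge0 (ph_ax S)).
Qed.

(** * Crossed products *)

Section CrossedProductDensity.
Context {R : realType} (A : cstarAlgType R) (beta : A -> A).
Context (B : cstarAlgType R) (pi : A -> B) (u : B).
Hypothesis hbeta : star_automorphism beta.
Hypothesis hB : crossed_product beta pi u.

Lemma cp_star_hom : star_hom pi. Proof. by case: hB => -[]. Qed.
Lemma cp_uu : star u * u = 1. Proof. by case: hB => -[_ []]. Qed.
Lemma cp_uu' : u * star u = 1. Proof. by case: hB => -[_ []]. Qed.
Lemma cp_upi a : u * pi a = pi (beta a) * u.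
Proof.
have -> : pi (beta a) = u * pi a * star u by case: hB => -[_ _ ->].
by rewrite -[RHS]mulrA cp_uu mulr1.
Qed.
Lemma cp_pius a : pi a * star u = star u * pi (beta a).
Proof.
have -> : pi (beta a) = u * pi a * star u by case: hB => -[_ _ ->].
by rewrite !mulrA cp_uu mul1r.
Qed.
Lemma cp_uXpi m a : u ^+ m * pi a = pi (iter m beta a) * u ^+ m.
Proof.
elim: m a => [|m IHm] a; first by rewrite mulr1 mul1r.
by rewrite exprS -mulrA IHm mulrA cp_upi iterS mulrA.
Qed.

Definition cp_subspace (W : set B) :=
  [/\ forall (c : R[i]) x y, W x -> W y -> W (c *: x + y), nclosed W,
      forall a m, W (pi a * u ^+ m) & forall a m, W (pi a * star u ^+ m)].

Lemma cp_subspace_stable W x : cp_subspace W ->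
  (forall a m, W (x * (pi a * u ^+ m))) ->
  (forall a m, W (x * (pi a * star u ^+ m))) -> cp_subspace (fun y => W (x * y)).
Proof.
move=> [Wl Wc _ _] h1 h2; split => //.
  by move=> c y z Wy Wz; rewrite mulrDr -scalerAr; exact: Wl.
move=> y Wy; apply: Wc => e e0.
have x1 : 0 < nrm x + 1 by rewrite ltr_pwDr ?nrm_ge0.
have [z Wz yz] := Wy (e / (nrm x + 1)) ltac:(rewrite divr_gt0 //).
exists (x * z) => //; rewrite -mulrBr (le_lt_trans (nrmM _ _)) //.
move: yz; rewrite ltr_pdivlMr // mulrC; apply: le_lt_trans.
by rewrite ler_wpM2r ?nrm_ge0 // lerDl.
Qed.

(* The intersection of all such W is stable under left multiplication by the
   generators, so the elements which together with their adjoints multiply it into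
   itself form a closed star subalgebra containing the generators. *)
Lemma cp_dense W : cp_subspace W -> forall x, W x.
Proof.
pose Wm x := forall W, cp_subspace W -> W x.
have Wm1 : Wm 1.
  move=> {}W [_ _ W1 _]; have := W1 1 0%N.
  by rewrite (star_hom1 cp_star_hom) mulr1.
have Wpi a x : Wm x -> Wm (pi a * x).
  move=> Wx {}W hW; apply: Wx (cp_subspace_stable hW _ _) => b m.
    by rewrite mulrA -(star_homM cp_star_hom); case: hW.
  by rewrite mulrA -(star_homM cp_star_hom); case: hW.
have Wu x : Wm x -> Wm (u * x).
  move=> Wx {}W hW; apply: Wx (cp_subspace_stable hW _ _) => b m.
    by rewrite mulrA cp_upi -mulrA -exprS; case: hW.
  rewrite mulrA cp_upi -mulrA; case: m => [|m].
    by rewrite mulr1 -[u]expr1; case: hW.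
  by rewrite exprS (mulrA u) cp_uu' mul1r; case: hW.
have Wus x : Wm x -> Wm (star u * x).
  move=> Wx {}W hW; apply: Wx (cp_subspace_stable hW _ _) => b m;
    have [_ [g _ gK]] := hbeta; rewrite -(gK b) mulrA -cp_pius -mulrA.
    case: m => [|m]; first by rewrite mulr1 -[star u]expr1; case: hW.
    by rewrite exprS (mulrA (star u)) cp_uu mul1r; case: hW.
  by rewrite -exprS; case: hW.
pose S : set B := [set x | forall y, Wm y -> Wm (x * y) /\ Wm (star x * y)].
have Wml (c : R[i]) x y : Wm x -> Wm y -> Wm (c *: x + y).
  by move=> Wx Wy {}W hW; case: (hW) => Wl _ _ _; apply: Wl; [exact: Wx|exact: Wy].
have Wmc : nclosed Wm.
  move=> x Wx {}W hW; case: (hW) => _ Wc _ _; apply: Wc => e e0.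
  by have [y Wy xy] := Wx e e0; exists y => //; exact: Wy.
have ST : S = setT.
  case: hB => _ gen _; apply: gen.
  - split.
    + by move=> y Wy; rewrite star1 !mul1r.
    + move=> c x y Sx Sy z Wz; have [? ?] := Sx z Wz; have [? ?] := Sy z Wz.
      by rewrite starD starZ !mulrDl -!scalerAl; split; exact: Wml.
    + move=> x y Sx Sy z Wz; rewrite starM -!mulrA.
      have [h1 _] := Sy z Wz; have [_ h2] := Sx z Wz.
      by split; [case: (Sx _ h1)|case: (Sy _ h2)].
    + by move=> x Sx y Wy; rewrite starK; have [? ?] := Sx y Wy.
  - apply/nclosedP => x Sx y Wy.
    have y1 : 0 < nrm y + 1 by rewrite ltr_pwDr ?nrm_ge0.
    have H e z : 0 < e -> nrm (x - z) < e / (nrm y + 1) -> nrm ((x - z) * y) < e.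
      move=> e0; rewrite ltr_pdivlMr // => h1; apply: le_lt_trans (nrmM _ _) _.
      by apply: le_lt_trans h1; rewrite ler_wpM2l ?nrm_ge0 // lerDl.
    have H' e z : 0 < e -> nrm (x - z) < e / (nrm y + 1) -> nrm (star (x - z) * y) < e.
      move=> e0; rewrite -nrm_star ltr_pdivlMr // => h1; apply: le_lt_trans (nrmM _ _) _.
      by apply: le_lt_trans h1; rewrite ler_wpM2l ?nrm_ge0 // lerDl.
    split; apply: Wmc => e e0; have [|z Sz xz] := Sx (e / (nrm y + 1)).
    + by rewrite divr_gt0.
    + by exists (z * y); [case: (Sz y Wy)|rewrite -mulrBl; exact: H].
    + by rewrite divr_gt0.
    + by exists (star z * y); [case: (Sz y Wy)|rewrite -mulrBl -starB; exact: H'].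
  - move=> a y Wy; rewrite -(star_homS cp_star_hom); split; exact: Wpi.
  - by move=> y Wy; split; [exact: Wu|exact: Wus].
move=> hW x; have : S x by rewrite ST.
by move=> /(_ 1 Wm1)[]; rewrite mulr1 => Wx _; exact: Wx.
Qed.

(** Monomials with a negative power of u are adjoints of monomials with a positive power, after
    moving the coefficient across u^m. *)
Lemma cp_dense_star (W : set B) :
  (forall (c : R[i]) x y, W x -> W y -> W (c *: x + y)) -> nclosed W ->
  (forall x, W x -> W (star x)) -> (forall a m, W (pi a * u ^+ m)) -> forall x, W x.
Proof.
move=> Wl Wc Ws Wm; apply: cp_dense; split => // a m.
have -> : pi a * star u ^+ m = star (pi (iter m beta (star a)) * u ^+ m).
  by rewrite -cp_uXpi starM starX -(star_homS cp_star_hom) starK.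
exact/Ws/Wm.
Qed.

Lemma pfun_cp_eq (phi psi : B -> R[i]) : pfun phi -> pfun psi ->
  (forall a m, phi (pi a * u ^+ m) = psi (pi a * u ^+ m)) -> phi =1 psi.
Proof.
move=> hp hq pq; apply: cp_dense_star => //.
- by move=> c x y ex ey; rewrite (pfunD hp) (pfunZ hp) (pfunD hq) (pfunZ hq) ex ey.
- move=> x hx; apply/subr0_eq/eqP; rewrite -normr_le0.
  have pb := pfun_bound hp; have qb := pfun_bound hq.
  set K := phi 1 + psi 1; have K0 : 0 <= K by rewrite addr_ge0 // pfun1_ge0.
  have KE : K = (complex.Re K)%:C by rewrite RRe_real // ger0_real.
  have hd : `|phi x - psi x| = (complex.Re `|phi x - psi x|)%:C.
    by rewrite RRe_real // ger0_real.
  have K0' : 0 <= complex.Re K by rewrite -lecR -KE.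
  rewrite hd lecR; apply/ler_addgt0Pr => e e0; rewrite add0r -lecR -hd.
  have K1 : 0 < complex.Re K + 1 by rewrite ltr_pwDr.
  have [y yE xy] := hx (e / (complex.Re K + 1)) ltac:(rewrite divr_gt0 //).
  have -> : phi x - psi x = phi (x - y) - psi (x - y).
    rewrite (pfunB hp) (pfunB hq) yE; ring.
  apply: le_trans (ler_normB _ _) _.
  apply: le_trans (lerD (pb _) (qb _)) _; rewrite -mulrDr -/K KE -real_complexM lecR.
  move: xy; rewrite ltr_pdivlMr // => xy; apply: le_trans (ltW xy).
  by rewrite ler_wpM2l ?nrm_ge0 // lerDl.
- by move=> x e; rewrite (pfun_star hp) (pfun_star hq) e.
Qed.

End CrossedProductDensity.

(** * Regular representations of crossed products *)

Section FiniteSupport.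
Context {R : realType} (D : starAlgType R).

Definition fsupp_pred : {pred int -> D} :=
  fun f => `[< exists E : {fset int}, forall j, j \notin E -> f j = 0 >].

Fact fsupp_submod_closed : submod_closed fsupp_pred.
Proof.
split; first by apply/asboolP; exists fset0.
move=> c f g /asboolP[E fE] /asboolP[F gF]; apply/asboolP; exists (E `|` F)%fset => j.
rewrite inE negb_or => /andP[jE jF].
by rewrite -[LHS]/(c *: f j + g j) fE // gF // scaler0 addr0.
Qed.

HB.instance Definition _ := GRing.isSubmodClosed.Build R[i] (int -> D) fsupp_pred
  fsupp_submod_closed.

Record fsupp := FSupp { fsupp_val :> int -> D; fsupp_valP : fsupp_val \in fsupp_pred }.

HB.instance Definition _ := [isSub for fsupp_val].
HB.instance Definition _ := [Choice of fsupp by <:].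
HB.instance Definition _ := [SubChoice_isSubLmodule of fsupp by <:].

Implicit Types (f g : fsupp).

Lemma fsuppP f : exists E : {fset int}, forall j, j \notin E -> f j = 0.
Proof. exact: (asboolW (fsupp_valP f)). Qed.

Lemma fsuppDE (c : R[i]) f g j : (c *: f + g) j = c *: f j + g j. Proof. by []. Qed.
Fact fsupp_map_subproof (F : int -> D -> D) f : (forall j, F j 0 = 0) ->
  exists E : {fset int}, forall j, j \notin E -> F j (f j) = 0.
Proof. by move=> F0; have [E fE] := fsuppP f; exists E => j /fE ->. Qed.

Definition fsupp_map (F : int -> D -> D) (F0 : forall j, F j 0 = 0) f : fsupp :=
  FSupp (asboolT (fsupp_map_subproof f F0)).

Fact fsupp_shift_subproof (k : int) f :
  exists E : {fset int}, forall j, j \notin E -> f (j + k) = 0.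
Proof.
have [E fE] := fsuppP f; exists [fset (j - k)%R | j in E]%fset => j jE.
apply: fE; apply: contra jE => jE; apply/imfsetP; exists (j + k) => //=.
by rewrite addrK.
Qed.

Definition fsupp_shift (k : int) f : fsupp := FSupp (asboolT (fsupp_shift_subproof k f)).

Fact fsupp_delta_subproof (i : int) (d : D) :
  exists E : {fset int}, forall j, j \notin E -> (if j == i then d else 0) = 0.
Proof. by exists [fset i]%fset => j; rewrite inE => /negbTE ->. Qed.

Definition fsupp_delta i d : fsupp := FSupp (asboolT (fsupp_delta_subproof i d)).

End FiniteSupport.

Section RegularRepresentation.
Context {R : realType} (A : cstarAlgType R) (beta : A -> A).
Context (B : cstarAlgType R) (pi : A -> B) (u : B).
Hypothesis hB : crossed_product beta pi u.
Context (D : cstarAlgType R) (psi : D -> R[i]) (sigma : int -> A -> D) (U : D).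
Hypothesis hpsi : pfun psi.
Hypothesis psi1 : psi 1 = 1.
Hypothesis hsigma : forall j, star_hom (sigma j).
Hypothesis UU : star U * U = 1.
Hypothesis UU' : U * star U = 1.
Hypothesis Usigma : forall j a, U * sigma j a = sigma (j + 1) (beta a) * U.

Local Notation V := (fsupp D).
Implicit Types (f g : V).

Definition fsupp_form f g : R[i] := \sum_(j \in [set: int]) psi (star (g j) * f j).

Lemma fsupp_formE f g (E : {fset int}) : (forall j, j \notin E -> psi (star (g j) * f j) = 0) ->
  fsupp_form f g = \sum_(j <- E) psi (star (g j) * f j).
Proof. by move=> fE; exact: fsbigTE. Qed.

Lemma fsupp_formEl f g (E : {fset int}) : (forall j, j \notin E -> f j = 0) ->
  fsupp_form f g = \sum_(j <- E) psi (star (g j) * f j).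
Proof. by move=> fE; apply: fsupp_formE => j /fE ->; rewrite mulr0 (pfun0 hpsi). Qed.

Lemma fsupp_formEr f g (E : {fset int}) : (forall j, j \notin E -> g j = 0) ->
  fsupp_form f g = \sum_(j <- E) psi (star (g j) * f j).
Proof. by move=> gE; apply: fsupp_formE => j /gE ->; rewrite star0 mul0r (pfun0 hpsi). Qed.

Fact fsupp_form_semi_inner : semi_inner fsupp_form.
Proof.
have common f g : exists E : {fset int}, [/\ forall j, j \notin E -> f j = 0,
    forall j, j \notin E -> g j = 0 & forall (c : R[i]) j, j \notin E -> (c *: f + g) j = 0].
  have [E fE] := fsuppP f; have [F gF] := fsuppP g; exists (E `|` F)%fset.
  have fEF j : j \notin (E `|` F)%fset -> f j = 0 by rewrite inE negb_or => /andP[/fE].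
  have gEF j : j \notin (E `|` F)%fset -> g j = 0 by rewrite inE negb_or => /andP[_ /gF].
  by split=> // c j jEF; rewrite fsuppDE fEF // gEF // scaler0 addr0.
split.
- move=> c f g k; have [E [fE gE cE]] := common f g.
  rewrite (fsupp_formEl _ (cE c)) (fsupp_formEl _ fE) (fsupp_formEl _ gE).
  rewrite mulr_sumr -big_split /=; apply: eq_bigr => j _.
  rewrite [X in psi (_ * X)](_ : _ = c *: f j + g j) //.
  by rewrite mulrDr -scalerAr (pfunD hpsi) (pfunZ hpsi).
- move=> c f g k; have [E [fE gE cE]] := common f g.
  rewrite (fsupp_formEr _ (cE c)) (fsupp_formEr _ fE) (fsupp_formEr _ gE).
  rewrite mulr_sumr -big_split /=; apply: eq_bigr => j _.
  rewrite [X in psi (star X * _)](_ : _ = c *: f j + g j) //.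
  by rewrite starD starZ mulrDl -scalerAl (pfunD hpsi) (pfunZ hpsi).
- move=> f; have [E fE] := fsuppP f; rewrite (@fsupp_formE _ _ E).
    by apply: sumr_ge0 => j _; exact: pfun_ge0.
  by move=> j /fE ->; rewrite mulr0 (pfun0 hpsi).
Qed.

Lemma fsupp_form_delta f i d : fsupp_form f (fsupp_delta i d) = psi (star d * f i).
Proof.
rewrite (@fsupp_formE _ _ [fset i]%fset).
  by rewrite big_seq_fset1 /= eqxx.
by move=> j; rewrite inE /= => /negbTE ->; rewrite star0 mul0r (pfun0 hpsi).
Qed.

Fact fsupp_unitE : fsupp_form (fsupp_delta 0 1) (fsupp_delta 0 1) = 1.
Proof. by rewrite fsupp_form_delta /= star1 mul1r psi1. Qed.

Definition regular_space := PreHilbert fsupp_form_semi_inner fsupp_unitE.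
Local Notation P := regular_space.
Local Notation H := (hilbert_completion P).

Definition regular_act a : V -> V :=
  fsupp_map (F := fun j x => sigma j a * x) (fun j => mulr0 _).
Definition regular_shift f : V :=
  fsupp_map (F := fun j x => U * x) (fun j => mulr0 _) (fsupp_shift (-1) f).
Definition regular_unshift f : V :=
  fsupp_map (F := fun j x => star U * x) (fun j => mulr0 _) (fsupp_shift 1 f).

Lemma fsuppPext f g : (forall j, f j = g j) -> f = g.
Proof. by move=> fg; apply/val_inj/funext. Qed.

Lemma regular_shift_adj f g : fsupp_form (regular_shift f) g = fsupp_form f (regular_unshift g).
Proof.
have hb : bijective (fun j : int => j + 1) by exists (fun j => j - 1) => j; rewrite ?addrK ?subrK.
rewrite /fsupp_form (reindex_fsbigT _ _ hb); apply: eq_fsbigr => j _ /=.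
by rewrite addrK starM starK mulrA.
Qed.

(** On finitely supported functions Z -> D, a acts at place j by sigma_j(a), and u as the shift
    followed by U. Two cases are used: D = A, sigma_j = beta^(-j), U = 1, which extends functionals
    of A; and D = B, sigma_j = [pi], U = u, a given representation of B combined with the shift. *)
Lemma regular_representation : exists F : B -> bop H,
  [/\ star_hom F, forall a, represents (P := P) (F (pi a)) (regular_act a) &
      represents (P := P) (F u) regular_shift].
Proof.
have hh := fsupp_form_semi_inner.
have [||||||rho hrho rhoE] := @star_representation R A P regular_act.
- by move=> a f g; apply: fsuppPext => j /=; rewrite mulrBr.
- move=> c a b f g.
  rewrite -[c * _](formZl hh) -(formDl hh); congr fsupp_form; apply: fsuppPext => j.
  rewrite [RHS](_ : _ = c *: (sigma j a * f j) + sigma j b * f j) //=.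
  by rewrite (star_homD (hsigma j)) (star_homZ (hsigma j)) mulrDl scalerAl.
- move=> a b f g; congr fsupp_form; apply: fsuppPext => j /=.
  by rewrite (star_homM (hsigma j)) mulrA.
- move=> f g; congr fsupp_form; apply: fsuppPext => j /=.
  by rewrite (star_hom1 (hsigma j)) mul1r.
- move=> a f g; apply: eq_fsbigr => j _ /=.
  by rewrite starM -(star_homS (hsigma j)) starK mulrA.
- exact: bounded_elt_cstar.
have [v vE] : exists v : bop H, represents (P := P) v regular_shift.
  apply: (@represents_exists _ P _ regular_unshift 1).
  - by move=> f g; apply: fsuppPext => j /=; rewrite mulrBr.
  - by move=> f g; apply: fsuppPext => j /=; rewrite mulrBr.
  - move=> f; rewrite mul1r /snorm -[ph_form _ _]/(fsupp_form _ _) regular_shift_adj.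
    rewrite (_ : regular_unshift (regular_shift f) = f) //.
    by apply: fsuppPext => j /=; rewrite mulrA UU mul1r addrK.
  - exact: regular_shift_adj.
have vsE : represents (P := P) (star v) regular_unshift.
  by apply: represents_star vE _ => f g; exact: regular_shift_adj.
have cov : covariant beta rho v.
  split => //; first split.
  - apply: (represents_inj (represents_mul vsE vE) (@represents1 R P)) => f g.
    congr fsupp_form; apply: fsuppPext => j /=.
    by rewrite mulrA UU mul1r addrK.
  - apply: (represents_inj (represents_mul vE vsE) (@represents1 R P)) => f g.
    congr fsupp_form; apply: fsuppPext => j /=.
    by rewrite mulrA UU' mul1r subrK.
  - move=> a; apply: (represents_inj (represents_mul (represents_mul vE (rhoE a)) vsE) (rhoE _)) => f g.
    congr fsupp_form; apply: fsuppPext => j /=.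
    by rewrite !mulrA Usigma -[_ * U * _]mulrA UU' mulr1 !subrK.
have [_ _ univ] := hB; have [F hF [Fpi Fu]] := univ _ _ _ cov.
exists F; split => // [a|]; first by rewrite Fpi.
by rewrite Fu.
Qed.

(* G i k x is the matrix coefficient <x e_i, e_k> of the regular representation on
   finitely supported functions Z -> D. *)
Lemma regular_functionals : exists G : nat -> nat -> B -> R[i],
  [/\ forall N, pfun (fun x => \sum_(i < N) \sum_(k < N) G i k x),
      forall i, pfun (G i i),
      forall i k m a, G i k (pi a * u ^+ m) =
        if k == (i + m)%N then psi (sigma k a * U ^+ m) else 0 &
      forall i k x, G i i (star x * x) = 0 -> G i k (star x * x) = 0].
Proof.
have [F [hF Fpi Fu]] := regular_representation.
pose e (i : nat) : H := cembed (fsupp_delta (i : int) 1 : P).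
exists (fun i k x => F x (e i) (e k)).
have FJ x v w : F (star x * x) v w = ph_form (bapp (F x) v) (bapp (F x) w).
  by rewrite (star_homM hF) (star_homS hF) bop_mulE bop_starE bappE -(formC (ph_ax H)).
have lin (c : R[i]) x y v w : F (c *: x + y) v w = c * F x v w + F y v w.
  by rewrite (star_homD hF) (star_homZ hF) bopDE bopZE.
split.
- move=> N; split=> [c x y|x].
    rewrite /= mulr_sumr -big_split; apply: eq_bigr => i _.
    rewrite mulr_sumr -big_split; apply: eq_bigr => k _; exact: lin.
  rewrite (_ : \sum_(i < N) _ = ph_form (\sum_(i < N) bapp (F x) (e i)) (\sum_(i < N) bapp (F x) (e i))).
    exact: (form_ge0 (ph_ax H)).
  have sl (v : nat -> H) w : ph_form (\sum_(i < N) v i) w = \sum_(i < N) ph_form (v i) w.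
    by apply: (big_morph (fun z => ph_form z w)); [move=> ? ?; exact: (formDl (ph_ax H))|
      exact: (form0l (ph_ax H))].
  have sr (v : nat -> H) w : ph_form w (\sum_(i < N) v i) = \sum_(i < N) ph_form w (v i).
    by apply: (big_morph (fun z => ph_form w z)); [move=> ? ?; exact: (formDr (ph_ax H))|
      exact: (form0r (ph_ax H))].
  rewrite (sl (fun i => bapp (F x) (e i))); apply: eq_bigr => i _.
  by rewrite (sr (fun i => bapp (F x) (e i))); apply: eq_bigr => k _; rewrite FJ.
- move=> i; split=> [c x y|x] /=; first exact: lin.
  by rewrite FJ (form_ge0 (ph_ax H)).
- move=> i k m a.
  have rep : represents (P := P) (F (pi a * u ^+ m)) (fun f => regular_act a (iter m regular_shift f)).
    rewrite (star_homM hF); apply: represents_mul (Fpi a) _.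
    elim: m => [|m IHm]; first by rewrite (star_hom1 hF); exact: represents1.
    by rewrite exprS (star_homM hF); exact: represents_mul Fu IHm.
  rewrite rep -[LHS]/(fsupp_form _ _) fsupp_form_delta star1 mul1r /=.
  have sh f j : iter m regular_shift f j = U ^+ m * f (j - m%:Z).
    elim: m j {rep} => [|m IHm] j; first by rewrite mul1r subr0.
    rewrite iterS /= IHm exprS mulrA; congr (_ * f _).
    by rewrite -addn1 PoszD opprD addrA addrAC.
  rewrite sh /= (_ : (k%:Z - m%:Z == i%:Z) = (k == i + m)%N); last first.
    by rewrite subr_eq -PoszD.
  by case: eqP => _; rewrite ?mulr1 // !mulr0 (pfun0 hpsi).
- by move=> i k x; rewrite !FJ => /(form_null_l (ph_ax H)).
Qed.

End RegularRepresentation.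

Section ClosedSets.
Context {R : realType} {A : normedStarAlgType R}.

Lemma nclosed_seq (S : set A) :
  (forall u l, (forall n, S (u n)) -> ncvg u l -> S l) -> nclosed S.
Proof.
move=> H x Sx.
have ex n : exists y, S y /\ nrm (x - y) < n.+1%:R^-1.
  by have [|y Sy xy] := Sx n.+1%:R^-1; [rewrite invr_gt0|exists y].
pose u n := sval (cid (ex n)).
have uP n : S (u n) /\ nrm (x - u n) < n.+1%:R^-1 := svalP (cid (ex n)).
apply: (H u) => [n|e e0]; first by have [] := uP n.
exists (Num.truncn e^-1) => // n /= Nn; rewrite nrmBC.
have [_ /lt_trans] := uP n; apply.
by rewrite invf_plt ?posrE // (lt_le_trans (truncnS_gt _)) // ler_nat ltnS.
Qed.

End ClosedSets.

Lemma pfun_ncvg {R : realType} {A : cstarAlgType R} (phi : A -> R[i]) u l : pfun phi ->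
  ncvg u l -> ncvg (fun n => phi (u n) : R[i]^o) (phi l).
Proof.
move=> hp /ncvgP ul; have p1 := pfun1_ge0 hp.
apply: (@ncvg_le _ _ _ _ (fun n => nrm (u n - l) * complex.Re (phi 1))) => [n|].
  rewrite -lecR nrm_complexE real_complexM [(complex.Re (phi 1))%:C]RRe_real ?ger0_real //.
  rewrite (_ : _ - _ = phi (u n - l)) ?pfun_bound // (pfunB hp) //.
by rewrite -(mul0r (complex.Re (phi 1))); exact: cvgMl.
Qed.

Section Automorphisms.
Context {R : realType} {A : starAlgType R}.
Implicit Types (f g : A -> A).

Lemma star_hom_id : star_hom (@id A).
Proof. by split. Qed.

Lemma star_hom_iter f n : star_hom f -> star_hom (iter n f).
Proof.
move=> hf; elim: n => [|n IHn]; first exact: star_hom_id.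
exact: (star_hom_comp IHn hf).
Qed.

Lemma star_automorphism_iter f n : star_automorphism f -> star_automorphism (iter n f).
Proof.
move=> [hf bf]; split; first exact: star_hom_iter.
by elim: n => [|n IHn]; [exists id | exact: bij_comp bf IHn].
Qed.

Lemma star_hom_inverse f g : star_hom f -> cancel f g -> cancel g f -> star_hom g.
Proof.
move=> hf fK gK; split.
- by move=> c x y; rewrite -{1}(gK x) -{1}(gK y) -(star_homZ hf) -(star_homD hf) fK.
- split; first by rewrite /= -{1}(star_hom1 hf) fK.
  by move=> x y; rewrite -{1}(gK x) -{1}(gK y) -(star_homM hf) fK.
- by move=> x; rewrite -{1}(gK x) -(star_homS hf) fK.
Qed.

Definition autpow f g (j : int) : A -> A :=
  match j with Posz n => iter n g | Negz n => iter n.+1 f end.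

Lemma autpow_succ f g j a : cancel f g -> autpow f g (j + 1) (f a) = autpow f g j a.
Proof.
move=> fK; case: j => n.
  by rewrite (_ : Posz n + 1 = Posz n.+1) /= -?iterS ?iterSr ?fK // -addn1 PoszD.
case: n => [|n] //; have -> : Negz n.+1 + 1 = Negz n by rewrite !NegzE; lia.
by rewrite /autpow [RHS]iterSr.
Qed.

End Automorphisms.

(** * Extension of functionals and conditional expectation *)

Section CrossedProductFunctionals.
Context {R : realType} (A : cstarAlgType R) (beta : A -> A).
Context (B : cstarAlgType R) (pi : A -> B) (u : B).
Hypothesis hbeta : star_automorphism beta.
Hypothesis hB : crossed_product beta pi u.
Let hpi := cp_star_hom hB.
Let uu := cp_uu hB.
Let uu' := cp_uu' hB.

Definition cp_extends (phi : A -> R[i]) (Phi : B -> R[i]) :=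
  forall a m, Phi (pi a * u ^+ m) = if m == 0%N then phi a else 0.

Lemma cp_extension phi : pfun phi -> phi 1 = 1 -> exists2 Phi, pfun Phi & cp_extends phi Phi.
Proof.
move=> hp p1; have [hb [g bK gK]] := hbeta; have hg := star_hom_inverse hb bK gK.
have hs j : star_hom (autpow beta g j).
  by case: j => n; apply: star_hom_iter.
have [||a|G [_ G1 GE _]] := regular_functionals hB hp p1 hs (U := 1).
- by rewrite star1 mulr1.
- by rewrite star1 mulr1.
- by move=> x; rewrite mul1r mulr1 autpow_succ.
exists (G 0 0)%N => // a m; rewrite GE add0n eq_sym; case: eqP => // ->.
by rewrite mulr1.
Qed.

Section Extension.
Variables (phi : A -> R[i]) (Phi : B -> R[i]).
Hypotheses (hphi : pfun phi) (hPhi : pfun Phi) (ext : cp_extends phi Phi).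

Lemma ext_pi a : Phi (pi a) = phi a.
Proof. by have := ext a 0; rewrite mulr1. Qed.

Lemma ext_star a m : Phi (pi a * star u ^+ m) = if m == 0%N then phi a else 0.
Proof.
have -> : pi a * star u ^+ m = star (pi (iter m beta (star a)) * u ^+ m).
  by rewrite -(cp_uXpi hB) starM starX -(star_homS hpi) starK.
rewrite (pfun_star hPhi) ext; case: eqP => [->|_]; last by rewrite rmorph0.
by rewrite /= (pfun_star hphi) conjCK.
Qed.

Lemma uX_starX m n : u ^+ m * star u ^+ n = star u ^+ n * u ^+ m.
Proof.
have c : GRing.comm u (star u) by rewrite /GRing.comm uu uu'.
exact: commrX (commr_sym (commrX m (commr_sym c))).
Qed.

Lemma uX_starX_sub m n : u ^+ m * star u ^+ n =
  if (n <= m)%N then u ^+ (m - n) else star u ^+ (n - m).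
Proof.
have c : GRing.comm u (star u) by rewrite /GRing.comm uu uu'.
have unit k : u ^+ k * star u ^+ k = 1 by rewrite -exprMn_comm // uu' expr1n.
case: leqP => [nm|/ltnW mn].
  by rewrite -{1}(subnK nm) exprD -mulrA unit mulr1.
by rewrite -{1}(subnKC mn) exprD mulrA unit mul1r.
Qed.

Lemma ext_mixed a m n : Phi (pi a * (u ^+ m * star u ^+ n)) = if m == n then phi a else 0.
Proof.
rewrite uX_starX_sub; case: leqP => [nm|mn]; rewrite ?ext ?ext_star subn_eq0.
  by rewrite eqn_leq nm andbT.
by rewrite leqNgt mn /= ltn_eqF.
Qed.

(** Density is applied to each factor in turn. On monomials only opposite exponents survive: for a
    u^m and b u^(-m) the two orders give phi(a beta^m(b)) and phi(b beta^(-m)(a)), equal by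
    invariance and the trace property. *)
Lemma ext_trace : tracial_state phi -> (forall a, phi (beta a) = phi a) -> tracial_state Phi.
Proof.
move=> [_ _ p1 ptr] pinv.
have pinvX m a : phi (iter m beta a) = phi a by elim: m => //= m IHm; rewrite pinv.
split; [by case: hPhi|by case: hPhi|by rewrite -(star_hom1 hpi) ext_pi|].
pose W : set B := fun x => forall y, Phi (x * y) = Phi (y * x).
suff : forall x, W x by [].
have [hb [g bK gK]] := star_automorphism_iter 1 hbeta.
apply: (cp_dense_star hbeta hB).
- move=> c x y Wx Wy z; rewrite mulrDl mulrDr -scalerAl -scalerAr.
  by rewrite !(pfunD hPhi) !(pfunZ hPhi) Wx Wy.
- apply: nclosed_seq => v l Wv vl y.
  apply: (@ncvg_unique _ _ (fun n => Phi (v n * y) : R[i]^o)).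
    by apply: pfun_ncvg => //; apply: ncvgM => //; exact: ncvg_cst.
  apply: (@eq_ncvg _ _ (fun n => Phi (y * v n) : R[i]^o)) => [n|]; first by rewrite Wv.
  by apply: pfun_ncvg => //; apply: ncvgM => //; exact: ncvg_cst.
- move=> x Wx y; rewrite -[y]starK -!starM !(pfun_star hPhi) Wx //.
- move=> a m; apply: (cp_dense hbeta hB); split.
  + move=> c x y Wx Wy; rewrite mulrDl mulrDr -scalerAl -scalerAr.
    by rewrite !(pfunD hPhi) !(pfunZ hPhi) Wx Wy.
  + apply: nclosed_seq => v l Wv vl; set x := pi a * _ in Wv *.
    apply: (@ncvg_unique _ _ (fun n => Phi (x * v n) : R[i]^o)).
      by apply: pfun_ncvg => //; apply: ncvgM => //; exact: ncvg_cst.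
    apply: (@eq_ncvg _ _ (fun n => Phi (v n * x) : R[i]^o)) => [n|]; first by rewrite Wv.
    by apply: pfun_ncvg => //; apply: ncvgM => //; exact: ncvg_cst.
  + move=> b n.
    have H c d i j : Phi (pi c * u ^+ i * (pi d * u ^+ j)) = if (i + j == 0)%N then phi (c * d) else 0.
      rewrite -mulrA (mulrA (u ^+ i)) (cp_uXpi hB) !mulrA -(star_homM hpi) -mulrA -exprD ext.
      by rewrite addn_eq0; case: i.
    by rewrite !H addnC ptr.
  + move=> b n.
    have [_ [gn _ gnK]] := star_automorphism_iter n hbeta.
    have h2 : star u ^+ n * pi a = pi (gn a) * star u ^+ n.
      have -> : pi a = pi (iter n beta (gn a)) by rewrite gnK.
      have c : GRing.comm u (star u) by rewrite /GRing.comm uu uu'.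
      have un : star u ^+ n * u ^+ n = 1.
        by rewrite -exprMn_comm ?uu ?expr1n //; exact: commr_sym.
      rewrite -[LHS]mulr1 -[X in _ * X = _](_ : u ^+ n * star u ^+ n = 1); last first.
        by rewrite uX_starX.
      by rewrite mulrA -(mulrA _ (pi _)) -(cp_uXpi hB) !mulrA un mul1r.
    rewrite -mulrA (mulrA (u ^+ m)) (cp_uXpi hB) !mulrA -(star_homM hpi) -mulrA ext_mixed.
    rewrite -[pi b * _ * _]mulrA h2 mulrA -(star_homM hpi) -mulrA -uX_starX ext_mixed.
    case: eqP => // mn; rewrite -[a in LHS]gnK -mn.
    by rewrite -(star_homM (star_hom_iter m hbeta.1)) pinvX ptr.
Qed.

End Extension.

(* c is the conditional expectation of x onto A, characterised by testing against
   all extended functionals. *)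
Definition cp_coef (x : B) (c : A) :=
  forall theta Theta, pfun theta -> pfun Theta -> cp_extends theta Theta ->
  forall b, Theta (pi b * x) = theta (b * c).

Lemma cp_coef_lin (k : R[i]) x y c d : cp_coef x c -> cp_coef y d -> cp_coef (k *: x + y) (k *: c + d).
Proof.
move=> xc yd t T ht hT tT b; rewrite !mulrDr -!scalerAr (pfunD ht) (pfunZ ht).
by rewrite (pfunD hT) (pfunZ hT) (xc _ _ ht hT tT) (yd _ _ ht hT tT).
Qed.

(** Extend a state phi with phi(c* c) = |c|^2; testing against b = c* gives |c|^2 = Phi(pi(b) x) <=
    |c| |x|. *)
Lemma cp_coef_nrm x c : cp_coef x c -> nrm c <= nrm x.
Proof.
move=> xc; have [->|c0] := eqVneq (nrm c) 0; first exact: nrm_ge0.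
have cp : 0 < nrm c by rewrite lt_neqAle eq_sym c0 nrm_ge0.
have [phi [hp p1 pE]] := state_exists c.
have [Phi hP Pext] := cp_extension hp p1.
rewrite -(ler_pM2l cp) -expr2 -lecR -pE -(xc _ _ hp hP Pext).
rewrite (le_trans (real_ler_norm _)) //.
  by rewrite (xc _ _ hp hP Pext) pE complex_real.
rewrite (le_trans (pfun_bound hP _)) // -(star_hom1 hpi) (ext_pi Pext) p1 mulr1 lecR.
rewrite (le_trans (nrmM _ _)) // ler_wpM2r ?nrm_ge0 //.
by rewrite (le_trans (star_hom_nrm hpi _)) // nrm_star.
Qed.

(** The coefficient of a monomial is visible, and [cp_coef_nrm] makes coefficients of a convergent
    sequence Cauchy, so the elements having one form a closed subspace. *)
Lemma cp_coef_exists x : exists c, cp_coef x c.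
Proof.
move: x; apply: (cp_dense hbeta hB); split.
- by move=> k x y [c xc] [d yd]; exists (k *: c + d); exact: cp_coef_lin.
- apply: nclosed_seq => v l vW vl.
  pose c n := sval (cid (vW n)).
  have cP n : cp_coef (v n) (c n) := svalP (cid (vW n)).
  have [|d cd] := cstar_complete (u := c).
    move=> e e0; have [N _ HN] := vl (e / 2) ltac:(rewrite divr_gt0 //).
    exists N => m n Nm Nn; apply: (@le_lt_trans _ _ (nrm (v m - v n))).
      apply: cp_coef_nrm; have := cp_coef_lin (- 1) (cP n) (cP m).
      by rewrite !scaleN1r ![- _ + _]addrC.
    apply: le_lt_trans (nrm_tri _ l _) _; rewrite [ltRHS]splitr ltrD //; first exact: HN.
    by rewrite nrmBC; exact: HN.
  exists d => t T ht hT tT b.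
  apply: (@ncvg_unique _ _ (fun n => T (pi b * v n) : R[i]^o)).
    by apply: pfun_ncvg => //; apply: ncvgM => //; exact: ncvg_cst.
  apply: (@eq_ncvg _ _ (fun n => t (b * c n) : R[i]^o)).
    by move=> n; rewrite (cP n _ _ ht hT tT).
  by apply: pfun_ncvg => //; apply: ncvgM => //; exact: ncvg_cst.
- move=> a m; exists (if m == 0%N then a else 0) => t T ht hT tT b.
  rewrite mulrA -(star_homM hpi) tT; case: eqP => // _.
  by rewrite mulr0 (pfun0 ht).
- move=> a m; exists (if m == 0%N then a else 0) => t T ht hT tT b.
  rewrite mulrA -(star_homM hpi) (ext_star ht hT tT); case: eqP => // _.
  by rewrite mulr0 (pfun0 ht).
Qed.

End CrossedProductFunctionals.

(** * Faithfulness of the extended functional *)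

Section FaithfulExtension.
Context {R : realType} (A : cstarAlgType R) (beta : A -> A).
Context (B : cstarAlgType R) (pi : A -> B) (u : B).
Hypothesis hbeta : star_automorphism beta.
Hypothesis hB : crossed_product beta pi u.
Let hpi := cp_star_hom hB.

(** Counts the pairs (i, i + m) inside an N by N square; the truncated N - m is correct also when m
    exceeds N. *)
Lemma sum_shift_count (N m : nat) (z : R[i]) :
  \sum_(i < N) \sum_(k < N) (if k == (i + m)%N :> nat then z else 0) = z *+ (N - m).
Proof.
have inner (i : nat) : \sum_(k < N) (if k == (i + m)%N :> nat then z else 0) =
    if (i + m < N)%N then z else 0.
  case: ltnP => [im|im].
    rewrite (bigD1 (Ordinal im)) //= eqxx big1 ?addr0 // => k.
    by rewrite -val_eqE /= => /negbTE ->.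
  rewrite big1 // => k _; case: eqP => // kim.
  by have := ltn_ord k; rewrite kim ltnNge im.
under eq_bigr do rewrite inner.
rewrite -big_mkcond /= (eq_bigl (fun i : 'I_N => i < N - m)%N); last first.
  by move=> i; rewrite ltn_subRL addnC.
by rewrite -(big_ord_widen _ (fun=> z) (leq_subr m N)) sumr_const card_ord.
Qed.

Lemma cvg_count_ratio (m : nat) (z : R[i]) :
  ncvg (fun N => (N.+1%:R^-1 : R)%:C * (z *+ (N.+1 - m)) : R[i]^o) z.
Proof.
have inve : (fun N => N.+1%:R^-1 : R) @ \oo --> (0 : R) by exact: cvg_harmonic.
apply: (@ncvg_le _ _ _ _ (fun N => N.+1%:R^-1 * (m%:R * complex.Re `|z|))) => [N|]; last first.
  by rewrite -(mul0r (m%:R * complex.Re `|z|)); exact: cvgMl.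
have -> : (N.+1%:R^-1 : R)%:C * (z *+ (N.+1 - m)) - z =
   (- N.+1%:R^-1 * (N.+1%:R - (N.+1 - m)%:R) : R)%:C *: (z : R[i]^o).
  have h : (N.+1%:R^-1 : R)%:C * N.+1%:R = 1 :> R[i].
    by rewrite -(rmorph_nat (real_complex R)) -real_complexM mulVf ?pnatr_eq0.
  rewrite -[RHS]/(_ * z) -(mulr_natr z) real_complexM rmorphN rmorphB /= !rmorph_nat.
  rewrite mulNr [_ * (_ - _)]mulrBr h; ring.
rewrite nrmZr normrM normrN (ger0_norm (x := _^-1)) ?invr_ge0 // -mulrA ler_wpM2l ?invr_ge0 //.
rewrite ler_wpM2r ?nrm_ge0 // -natrB ?leq_subr // ger0_norm ?ler0n // ler_nat.
by lia.
Qed.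

(* The Folner functionals psi_N approximate a given state psi of B pointwise
   and vanish on x* x as soon as every coefficient of x* x does. *)
Lemma cp_faithful phi Phi : pfun phi -> pfun Phi -> cp_extends pi u phi Phi ->
  faithful phi -> faithful Phi.
Proof.
move=> hp hP ext fphi x x0.
have [c xc] := cp_coef_exists hbeta hB (star x * x).
(* Testing against b = c* turns phi(c* c) into Phi(pi(b) x* x), which vanishes by Cauchy-Schwarz. *)
have c0 : c = 0.
  apply: fphi; rewrite -(xc _ _ hp hP ext) mulrA.
  exact: pfun_null.
have [psi [hpsi psi1 psiE]] := state_exists x.
have [||a|G [GN Gp GE G0]] :=
  @regular_functionals _ _ _ _ _ _ hB _ psi (fun=> pi) u hpsi psi1 (fun=> hpi).
- exact: cp_uu hB.
- exact: cp_uu' hB.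
- exact: (cp_upi hB).
(* The diagonal G i i extends the state psi restricted to A, so it takes the value psi(pi c) = 0 at
   x* x; the off-diagonal coefficients then vanish by Cauchy-Schwarz. *)
have Gx i k : G i k (star x * x) = 0.
  apply: (G0); have := xc _ _ (pfun_comp hpi hpsi) (Gp i) _ 1.
  rewrite (star_hom1 hpi) !mul1r => -> //.
    by rewrite c0 /= (star_hom0 hpi) (pfun0 hpsi).
  move=> a m; rewrite GE -[X in X == _]addn0 eqn_add2l eq_sym.
  by case: eqP => // ->; rewrite mulr1.
(* The vector functional of the normalised indicator of {0, ..., N}. It multiplies psi on a u^m by
   (N + 1 - m)/(N + 1), truncated at 0, which tends to 1. *)
pose p N y : R[i] := (N.+1%:R^-1 : R)%:C * \sum_(i < N.+1) \sum_(k < N.+1) G i k y.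
have pp N : pfun (p N) by apply: pfun_scale (GN _); rewrite ler0c invr_ge0.
have pm N a m : p N (pi a * u ^+ m) =
    (N.+1%:R^-1 : R)%:C * (psi (pi a * u ^+ m) *+ (N.+1 - m)).
  rewrite /p -sum_shift_count; congr (_ * _).
  by apply: eq_bigr => i _; apply: eq_bigr => k _; rewrite GE.
have p1 N : p N 1 = 1.
  have -> : 1 = pi 1 * u ^+ 0 by rewrite (star_hom1 hpi) mulr1.
  rewrite pm subn0 (star_hom1 hpi) mulr1 psi1 -(rmorph_nat (real_complex R)) -real_complexM.
  by rewrite mulVf ?pnatr_eq0.
have : ncvg (fun N => p N (star x * x) : R[i]^o) (psi (star x * x)).
  move: (star x * x); apply: (cp_dense_star hbeta hB).
  - move=> k y z hy hz; rewrite (pfunD hpsi) (pfunZ hpsi).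
    apply: (eq_ncvg _ (ncvgD (ncvgZ k hy) hz)) => N.
    by rewrite (pfunD (pp N)) (pfunZ (pp N)).
  - move=> y hy e e0; have e30 : 0 < e / 3 by rewrite divr_gt0.
    have [z zc yz] := hy _ e30; have [N _ HN] := zc _ e30; exists N => // n /HN /= hn.
    have bound (q : B -> R[i]) : pfun q -> q 1 = 1 -> nrm (q (y - z) : R[i]^o) < e / 3.
      move=> hq q1; apply: le_lt_trans yz; rewrite -lecR nrm_complexE.
      by have := pfun_bound hq (y - z); rewrite q1 mulr1.
    have -> : p n y - psi y = p n (y - z) + (p n z - psi z) - psi (y - z) :> R[i]^o.
      by rewrite (pfunB (pp n)) (pfunB hpsi); ring.
    have -> : e = e / 3 + e / 3 + e / 3 by lra.
    apply: le_lt_trans (nrmB _ _) _; apply: ltrD; last exact: bound.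
    by apply: le_lt_trans (nrmD _ _) _; apply: ltrD => //; exact: bound.
  - move=> y hy e /hy; apply: filterS => N; rewrite (pfun_star (pp N)) (pfun_star hpsi).
    by rewrite -rmorphB !nrm_complex norm_conjC.
  - by move=> a m; apply: (eq_ncvg _ (cvg_count_ratio m _)) => N; rewrite pm.
move=> h; have : psi (star x * x) = 0.
  apply: (ncvg_unique h); apply: (eq_ncvg _ (ncvg_cst 0)) => N.
  by rewrite /p big1 ?mulr0 // => i _; rewrite big1 // => k _; exact: Gx.
rewrite psiE => /complexI /eqP; rewrite sqrf_eq0 => /eqP; exact: nrm0_eq0.
Qed.

End FaithfulExtension.

(** * Direct limits *)

Structure closed_subalgebra (R : realType) (L : cstarAlgType R) := ClosedSubalgebra {
  csa_set :> set L;
  csa_star : star_subalgebra csa_set;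
  csa_closed : nclosed csa_set }.

Section ClosedSubalgebra.
Context {R : realType} {L : cstarAlgType R} (S : closed_subalgebra L).

Definition csa_pred : {pred L} := fun x => `[< csa_set S x >].

Lemma csa_predP x : reflect (csa_set S x) (x \in csa_pred).
Proof. exact: asboolP. Qed.

Fact csa_subalg_closed : subalg_closed csa_pred.
Proof.
have [S1 Sl SM _] := csa_star S; split; first exact/csa_predP.
  by move=> c x y /csa_predP Sx /csa_predP Sy; apply/csa_predP; exact: Sl.
by move=> x y /csa_predP Sx /csa_predP Sy; apply/csa_predP; exact: SM.
Qed.

HB.instance Definition _ := GRing.isSubalgClosed.Build R[i] L csa_pred csa_subalg_closed.

Record csa := Csa { csa_val :> L; csa_valP : csa_val \in csa_pred }.

HB.instance Definition _ := [isSub for csa_val].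
HB.instance Definition _ := [Choice of csa by <:].
HB.instance Definition _ := [SubChoice_isSubAlgebra of csa by <:].

Implicit Types (x y : csa).

Fact csa_star_subproof x : star (x : L) \in csa_pred.
Proof.
by have [_ _ _ Ss] := csa_star S; apply/csa_predP/Ss/csa_predP/csa_valP.
Qed.

Definition csa_star_op x : csa := Csa (csa_star_subproof x).

Fact csa_starK : involutive csa_star_op.
Proof. by move=> x; apply/val_inj; rewrite /= starK. Qed.
Fact csa_starD x y : csa_star_op (x + y) = csa_star_op x + csa_star_op y.
Proof. by apply/val_inj; rewrite /= starD. Qed.
Fact csa_starM x y : csa_star_op (x * y) = csa_star_op y * csa_star_op x.
Proof. by apply/val_inj; rewrite /= starM. Qed.
Fact csa_starZ (c : R[i]) x : csa_star_op (c *: x) = c^* *: csa_star_op x.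
Proof. by apply/val_inj; rewrite /= starZ. Qed.

HB.instance Definition _ := isStarAlgebra.Build R csa csa_starK csa_starD csa_starM csa_starZ.

Definition csa_norm x : R[i] := cnorm (x : L).

Fact csa_normD x y : csa_norm (x + y) <= csa_norm x + csa_norm y.
Proof. exact: cnormD. Qed.
Fact csa_normZ (c : R[i]) x : csa_norm (c *: x) = `|c| * csa_norm x.
Proof. exact: cnormZ. Qed.
Fact csa_norm0_eq0 x : csa_norm x = 0 -> x = 0.
Proof. by move=> /cnorm0_eq0 x0; apply/val_inj. Qed.
Fact csa_normM x y : csa_norm (x * y) <= csa_norm x * csa_norm y.
Proof. exact: cnormM. Qed.

HB.instance Definition _ := isNormedStarAlgebra.Build R csa
  csa_normD csa_normZ csa_norm0_eq0 csa_normM.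

Lemma csa_ncauchy_cvg (u : nat -> csa) : ncauchy u -> exists l, ncvg u l.
Proof.
move=> cu; have [l ul] := @cstar_complete _ _ (fun n => u n : L) cu.
have Sl : l \in csa_pred.
  by apply/csa_predP/(nclosed_ncvg (@csa_closed _ _ S) _ ul) => n; apply/csa_predP/csa_valP.
by exists (Csa Sl).
Qed.

Fact csa_norm_star x : cnorm (star x * x) = cnorm x ^+ 2.
Proof. exact: (cnorm_star_mul (x : L)). Qed.

HB.instance Definition _ := isCStarAlgebra.Build R csa
  (@cauchy_filter_cvg R csa csa_ncauchy_cvg) csa_norm_star.

Lemma csa_val_star_hom : star_hom csa_val.
Proof. by split=> //; split. Qed.

End ClosedSubalgebra.

(** * Density in the direct limit *)

Section DirectLimit.
Context {R : realType} (M : nat -> starAlgType R) (gamma : forall k, M k -> M k.+1).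
Context (L : cstarAlgType R) (iota : forall k, M k -> L).
Hypothesis hL : cstar_direct_limit gamma iota.

Lemma limit_hom k : star_hom (@iota k). Proof. by case: hL. Qed.
Lemma limit_compat k x : @iota k.+1 (gamma x) = iota x. Proof. by case: hL. Qed.

(** The closed subalgebra S is a C*-algebra receiving the system, so there is a map L -> S; composed
    with the inclusion it is the identity by uniqueness, hence S is everything. *)
Lemma limit_dense (S : set L) : star_subalgebra S -> nclosed S ->
  (forall k (x : M k), S (iota x)) -> forall z, S z.
Proof.
move=> hS cS iS; pose T := ClosedSubalgebra hS cS.
have iT k (x : M k) : iota x \in csa_pred T by apply/csa_predP; exact: iS.
pose phi k (x : M k) : csa T := Csa (iT k x).
have [_ _ univ] := hL.
have hphi k : star_hom (@phi k).
  have h := limit_hom k; split.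
  - by move=> c x y; apply/val_inj; rewrite /= (star_homD h) (star_homZ h).
  - split; first by apply/val_inj; rewrite /= (star_hom1 h).
    by move=> x y; apply/val_inj; rewrite /= (star_homM h).
  - by move=> x; apply/val_inj; rewrite /= (star_homS h).
have [|f [[hf fE] _]] := univ (csa T) phi hphi.
  by move=> k x; apply/val_inj; rewrite /= limit_compat.
have [g [_ gU]] := univ L iota limit_hom limit_compat.
have gid : g = id by apply: gU; split=> //; exact: star_hom_id.
have gf : g = (fun z => csa_val (f z)).
  apply: gU; split; first exact: (star_hom_comp hf (csa_val_star_hom T)).
  by move=> k x; rewrite fE.
move=> z; have -> : z = csa_val (f z) by rewrite -[LHS]/(id z) -gid gf.
by apply/(csa_predP T)/csa_valP.
Qed.

End DirectLimit.

Section LimitDensity.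
Context {R : realType} (M : nat -> starAlgType R) (gamma : forall k, M k -> M k.+1).
Context (L : cstarAlgType R) (iota : forall k, M k -> L).
Hypothesis hL : cstar_direct_limit gamma iota.
Let hi k := limit_hom hL k.

Let D : set L := [set z | exists k (x : M k), z = iota x].

Let D_lift k (x : M k) m : (k <= m)%N -> exists y : M m, iota y = iota x.
Proof.
move=> /subnK <-; elim: (m - k)%N => [|d [y IH]]; first by exists x.
by exists (gamma y); rewrite (limit_compat hL).
Qed.

Let D_two z w : D z -> D w -> exists k (x y : M k), z = iota x /\ w = iota y.
Proof.
move=> [k [x ->]] [m [y ->]].
have [x' xE] := D_lift x (leq_maxl k m); have [y' yE] := D_lift y (leq_maxr k m).
by exists (maxn k m), x', y'; rewrite xE yE.
Qed.

(** The closure of the union of the images is a star subalgebra, because any two of its approximants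
    can be lifted to a common level; [limit_dense] then applies. *)
Lemma limit_closed (W : set L) : nclosed W -> (forall k (x : M k), W (iota x)) ->
  forall z, W z.
Proof.
move=> cW iW; pose S : set L := [set z | forall e : R, 0 < e -> exists2 y, D y & nrm (z - y) < e].
suff SW : forall z, S z.
  move=> z; apply: cW => e /(SW z)[_ [k [x ->]] h].
  by exists (iota x).
have DS z : D z -> S z by move=> Dz e e0; exists z; rewrite ?subrr ?nrm0.
have cS : nclosed S.
  move=> z Sz e e0; have e20 : 0 < e / 2 by rewrite divr_gt0.
  have [y Sy zy] := Sz _ e20; have [w Dw yw] := Sy _ e20; exists w => //.
  by apply: le_lt_trans (nrm_tri _ y _) _; rewrite [ltRHS]splitr ltrD.
have Sseq z : S z -> exists2 u : nat -> L, (forall n, D (u n)) & ncvg u z.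
  move=> Sz; have ex n : exists y, D y /\ nrm (z - y) < n.+1%:R^-1.
    by have [|y Dy zy] := Sz n.+1%:R^-1; [rewrite invr_gt0|exists y].
  pose u n := sval (cid (ex n)); have uP n := svalP (cid (ex n)).
  exists u => [n|e e0]; first by have [] := uP n.
  exists (Num.truncn e^-1) => // n /= Nn; rewrite nrmBC.
  have [_ /lt_trans] := uP n; apply.
  by rewrite invf_plt ?posrE // (lt_le_trans (truncnS_gt _)) // ler_nat ltnS.
have Scvg u z : (forall n, D (u n)) -> ncvg u z -> S z.
  by move=> Du; apply: nclosed_ncvg => // n; exact: DS.
apply: (limit_dense hL) => //; last by move=> k x; apply: DS; exists k, x.
split.
- by apply: DS; exists 0%N, 1; rewrite (star_hom1 (hi 0)).
- move=> c x y /Sseq[u Du ux] /Sseq[v Dv vy].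
  apply: Scvg (ncvgD (ncvgZ c ux) vy) => n; have [k [a [b [-> ->]]]] := D_two (Du n) (Dv n).
  by exists k, (c *: a + b); rewrite (star_homD (hi k)) (star_homZ (hi k)).
- move=> x y /Sseq[u Du ux] /Sseq[v Dv vy].
  apply: Scvg (ncvgM ux vy) => n; have [k [a [b [-> ->]]]] := D_two (Du n) (Dv n).
  by exists k, (a * b); rewrite (star_homM (hi k)).
- move=> x /Sseq[u Du ux]; apply: Scvg (ncvg_star ux) => n.
  by have [k [a ->]] := Du n; exists k, (star a); rewrite (star_homS (hi k)).
Qed.

Lemma limit_pfun_eq phi psi : pfun phi -> pfun psi ->
  (forall k (x : M k), phi (iota x) = psi (iota x)) -> phi = psi.
Proof.
move=> hp hq pq; apply/funext; apply: limit_closed pq.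
apply: nclosed_seq => u l uE ul; apply: (ncvg_unique (pfun_ncvg hp ul)).
by apply: eq_ncvg (pfun_ncvg hq ul) => n; rewrite /= uE.
Qed.

(** The trace identity is asked only from level [N0] on, because an alpha^(n_k)-invariant trace is
    compatible with the system only from level k on. *)
Lemma limit_trace phi N0 : pfun phi ->
  (forall k (x y : M k), (N0 <= k)%N -> phi (iota x * iota y) = phi (iota y * iota x)) ->
  forall z w, phi (z * w) = phi (w * z).
Proof.
move=> hp ptr; have two (F G : L -> L) :
    (forall u l, ncvg u l -> ncvg (fun n => F (u n)) (F l)) ->
    (forall u l, ncvg u l -> ncvg (fun n => G (u n)) (G l)) ->
    nclosed [set z | phi (F z) = phi (G z)].
  move=> Fc Gc; apply: nclosed_seq => u l uE ul.
  apply: (ncvg_unique (pfun_ncvg hp (Fc _ _ ul))).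
  by apply: eq_ncvg (pfun_ncvg hp (Gc _ _ ul)) => n; rewrite /= uE.
have h1 z w : D z -> phi (z * w) = phi (w * z).
  move=> Dz; move: w; apply: (limit_closed (W := [set w | phi (z * w) = phi (w * z)])).
    by apply: two => u l ul; apply: ncvgM => //; exact: ncvg_cst.
  move=> k x /=; have [m [a [b [-> ->]]]] := D_two Dz (ex_intro _ k (ex_intro _ x erefl)).
  have [a' <-] := D_lift a (leq_maxl m N0); have [b' <-] := D_lift b (leq_maxl m N0).
  by apply: ptr; exact: leq_maxr.
move=> z w; move: z; apply: (limit_closed (W := [set z | phi (z * w) = phi (w * z)])).
  by apply: two => u l ul; apply: ncvgM => //; exact: ncvg_cst.
by move=> k x; apply: h1; exists k, x.
Qed.

Lemma limit_isometry (C : cstarAlgType R) (f : L -> C) : star_hom f ->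
  (forall k (x : M k), nrm (iota x) <= nrm (f (iota x))) -> injective f.
Proof.
move=> hf iso.
suff H z : nrm z <= nrm (f z).
  move=> x y fxy; apply/subr0_eq/nrm0_eq0/eqP; rewrite eq_le nrm_ge0 andbT.
  by rewrite (le_trans (H _)) // (star_homB hf) fxy subrr nrm0.
move: z; apply: limit_closed iso; apply: nclosed_seq => u l uE ul.
apply/ler_addgt0Pr => e e0; have e20 : 0 < e / 2 by rewrite divr_gt0.
have [N _ /(_ N (leqnn N)) /= h1] := ul _ e20.
have h2 := nrmD (l - u N) (u N); rewrite subrK (nrmBC l) in h2.
have h3 := nrmD (f (u N - l)) (f l); rewrite -(star_homD hf) subrK in h3.
have h4 := star_hom_nrm hf (u N - l); have h5 := uE N; lra.
Qed.

End LimitDensity.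

(** Below level m the sequence takes the default values z. The induction shifts the family M by one,
    so no transport between the types M k arises. *)
Lemma lift_sequence (M : nat -> Type) (z : forall k, M k) (gamma : forall k, M k -> M k.+1)
  m (x : M m) : exists2 y : forall k, M k, y m = x &
    forall k, (m <= k)%N -> y k.+1 = gamma k (y k).
Proof.
elim: m M z gamma x => [|m IHm] M z gamma x.
  exists (fun k => nat_rect M x gamma k) => //.
have [y ym yE] := IHm (fun k => M k.+1) (fun k => z k.+1) (fun k => gamma k.+1) x.
exists (fun k => if k is j.+1 then y j else z 0%N) => // -[|k] // mk.
exact: yE.
Qed.

(** * Compatible functionals and their extension to the limit *)

Section EventuallyCompatible.
Context {R : realType} (M : nat -> starAlgType R) (gamma : forall k, M k -> M k.+1).
Hypothesis hg : forall k, star_hom (@gamma k).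

(* Sequences following the connecting maps from some level on stand in for the
   algebraic direct limit, avoiding the quotient by eventual equality. *)
Record eseq := ESeq { eseq_val :> forall k, M k;
  eseqP : exists N, forall k, (N <= k)%N -> eseq_val k.+1 = gamma (eseq_val k) }.

HB.instance Definition _ := gen_eqMixin eseq.
HB.instance Definition _ := gen_choiceMixin eseq.

Implicit Types (x y w : eseq).

Lemma eseq_ext x y : (forall k, x k = y k) -> x = y.
Proof.
case: x y => x xP [y yP] /= xy.
have E : x = y by apply: functional_extensionality_dep.
by subst y; rewrite (Prop_irrelevance xP yP).
Qed.

Fact eseq_map2_subproof (F : forall k, M k -> M k -> M k) x y :
  (forall k a b, F k.+1 (gamma a) (gamma b) = gamma (F k a b)) ->
  exists N, forall k, (N <= k)%N -> F k.+1 (x k.+1) (y k.+1) = gamma (F k (x k) (y k)).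
Proof.
move=> FE; have [N xN] := eseqP x; have [K yK] := eseqP y; exists (maxn N K) => k.
by rewrite geq_max => /andP[Nk Kk]; rewrite xN // yK // FE.
Qed.

Definition eseq_map2 F FE x y : eseq := ESeq (@eseq_map2_subproof F x y FE).

Fact eseq_const_subproof (z : forall k, M k) : (forall k, z k.+1 = gamma (z k)) ->
  exists N, forall k, (N <= k)%N -> z k.+1 = gamma (z k).
Proof. by exists 0%N. Qed.

Definition eseq0 : eseq :=
  ESeq (@eseq_const_subproof (fun=> 0) (fun k => esym (star_hom0 (hg k)))).
Definition eseq1 : eseq :=
  ESeq (@eseq_const_subproof (fun=> 1) (fun k => esym (star_hom1 (hg k)))).
Definition eseq_add : eseq -> eseq -> eseq :=
  @eseq_map2 (fun k => +%R) (fun k a b => esym (star_homD (hg k) a b)).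
Definition eseq_opp x : eseq :=
  @eseq_map2 (fun k a _ => - a) (fun k a b => esym (star_homN (hg k) a)) x x.
Definition eseq_scale (c : R[i]) x : eseq :=
  @eseq_map2 (fun k a _ => c *: a) (fun k a b => esym (star_homZ (hg k) c a)) x x.

Fact eseq_addA : associative eseq_add.
Proof. by move=> x y w; apply: eseq_ext => k; exact: addrA. Qed.
Fact eseq_addC : commutative eseq_add.
Proof. by move=> x y; apply: eseq_ext => k; exact: addrC. Qed.
Fact eseq_add0 : left_id eseq0 eseq_add.
Proof. by move=> x; apply: eseq_ext => k; exact: add0r. Qed.
Fact eseq_addN : left_inverse eseq0 eseq_opp eseq_add.
Proof. by move=> x; apply: eseq_ext => k; exact: addNr. Qed.

HB.instance Definition _ := GRing.isZmodule.Build eseq eseq_addA eseq_addC eseq_add0 eseq_addN.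

Fact eseq_scaleA c d x : eseq_scale c (eseq_scale d x) = eseq_scale (c * d) x.
Proof. by apply: eseq_ext => k; exact: scalerA. Qed.
Fact eseq_scale1 : left_id 1 eseq_scale.
Proof. by move=> x; apply: eseq_ext => k; exact: scale1r. Qed.
Fact eseq_scaleDr : right_distributive eseq_scale +%R.
Proof. by move=> c x y; apply: eseq_ext => k; exact: scalerDr. Qed.
Fact eseq_scaleDl x : {morph eseq_scale^~ x : c d / c + d}.
Proof. by move=> c d; apply: eseq_ext => k; exact: scalerDl. Qed.

HB.instance Definition _ := GRing.Zmodule_isLmodule.Build R[i] eseq
  eseq_scaleA eseq_scale1 eseq_scaleDr eseq_scaleDl.

Variable psi : forall k, M k -> R[i].
Hypothesis hpsi : forall k, pfun (@psi k).
Hypothesis psi1 : forall k, psi (1 : M k) = 1.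
Variable N0 : nat.
Hypothesis psi_compat : forall k (x : M k), (N0 <= k)%N -> psi (gamma x) = psi x.

Fact eseq_form_subproof x y : exists l : R[i], exists N, forall k, (N <= k)%N ->
  psi (star (y k) * x k) = l.
Proof.
have [N xN] := eseqP x; have [K yK] := eseqP y.
pose m := maxn N0 (maxn N K); exists (psi (star (y m) * x m)), m => k /subnK <-.
elim: (k - m)%N => [//|d <-]; rewrite addSn.
have : (m <= d + m)%N by rewrite leq_addl.
rewrite {1}/m !geq_max => /andP[h0 /andP[hN hK]].
by rewrite xN // yK // -(star_homS (hg _)) -(star_homM (hg _)) psi_compat.
Qed.

Definition eseq_form x y : R[i] := sval (cid (eseq_form_subproof x y)).

Lemma eseq_formP x y : exists N, forall k, (N <= k)%N ->
  psi (star (y k) * x k) = eseq_form x y.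
Proof. exact: svalP (cid (eseq_form_subproof x y)). Qed.

Lemma eseq_formE x y (l : R[i]) N : (forall k, (N <= k)%N -> psi (star (y k) * x k) = l) ->
  eseq_form x y = l.
Proof.
move=> h; have [K hK] := eseq_formP x y.
by rewrite -(hK (maxn N K)) ?leq_maxr // h // leq_maxl.
Qed.

Fact eseq_semi_inner : semi_inner eseq_form.
Proof.
split.
- move=> c x y w; have [N xN] := eseq_formP x w; have [K yK] := eseq_formP y w.
  apply: (@eseq_formE _ _ _ (maxn N K)) => k; rewrite geq_max => /andP[/xN <- /yK <-].
  rewrite [X in psi (star _ * X)](_ : _ = c *: x k + y k) // mulrDr -scalerAr.
  by rewrite (pfunD (hpsi k)) (pfunZ (hpsi k)).
- move=> c x y w; have [N xN] := eseq_formP w x; have [K yK] := eseq_formP w y.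
  apply: (@eseq_formE _ _ _ (maxn N K)) => k; rewrite geq_max => /andP[/xN <- /yK <-].
  rewrite [X in psi (star X * _)](_ : _ = c *: x k + y k) // starD starZ mulrDl -scalerAl.
  by rewrite (pfunD (hpsi k)) (pfunZ (hpsi k)).
- move=> x; have [N xN] := eseq_formP x x; rewrite -(xN N) //; exact: pfun_ge0.
Qed.

Fact eseq_unitE : eseq_form eseq1 eseq1 = 1.
Proof. by apply: (@eseq_formE _ _ _ 0) => k _; rewrite /= star1 mulr1 psi1. Qed.

Definition eseq_space := PreHilbert eseq_semi_inner eseq_unitE.

Lemma eseq_form_congl x x' y N : (forall k, (N <= k)%N -> x k = x' k) ->
  eseq_form x y = eseq_form x' y.
Proof.
move=> xx'; have [K yK] := eseq_formP x' y.
apply: (@eseq_formE _ _ _ (maxn N K)) => k; rewrite geq_max => /andP[/xx' -> /yK].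
by [].
Qed.

Definition eseq_lift m (a : M m) : forall k, M k :=
  sval (cid2 (lift_sequence (fun k => 0 : M k) gamma a)).

Lemma eseq_lift_self m (a : M m) : eseq_lift a m = a.
Proof. exact: s2valP (cid2 (lift_sequence (fun k => 0 : M k) gamma a)). Qed.

Lemma eseq_liftS m (a : M m) k : (m <= k)%N -> eseq_lift a k.+1 = gamma (eseq_lift a k).
Proof. exact: (s2valP' (cid2 (lift_sequence (fun k => 0 : M k) gamma a))). Qed.

Lemma eseq_lift_unique m (a : M m) (y : forall k, M k) : y m = a ->
  (forall k, (m <= k)%N -> y k.+1 = gamma (y k)) ->
  forall k, (m <= k)%N -> eseq_lift a k = y k.
Proof.
move=> ya yS k mk; rewrite -(subnK mk); elim: (k - m)%N => [|d IH].
  by rewrite add0n eseq_lift_self ya.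
by rewrite addSn eseq_liftS ?leq_addl // IH yS ?leq_addl.
Qed.

Fact eseq_act_subproof m (a : M m) x :
  exists N, forall k, (N <= k)%N -> eseq_lift a k.+1 * x k.+1 = gamma (eseq_lift a k * x k).
Proof.
have [N xN] := eseqP x; exists (maxn m N) => k; rewrite geq_max => /andP[mk Nk].
by rewrite xN // eseq_liftS // (star_homM (hg k)).
Qed.

Definition eseq_act m (a : M m) x : eseq := ESeq (eseq_act_subproof a x).

(** An element of M m multiplies a sequence through its images at later levels. Below level m the
    lift is arbitrary, so the laws hold only eventually, which is all that [eseq_form] sees. *)
Lemma eseq_representation m : (forall a : M m, bounded_elt a) ->
  exists2 F : M m -> bop (hilbert_completion eseq_space), star_hom F &
    forall a, represents (P := eseq_space) (F a) (eseq_act a).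
Proof.
move=> bM; have hh := eseq_semi_inner.
apply: (@star_representation R (M m) eseq_space (@eseq_act m)) => //.
- by move=> a x y; apply: eseq_ext => k; exact: mulrBr.
- move=> c a b x y; rewrite -[c * _](formZl hh) -(formDl hh).
  apply: (@eseq_form_congl _ _ _ m) => k mk.
  rewrite -[RHS]/(c *: (eseq_lift a k * x k) + eseq_lift b k * x k) /=.
  rewrite scalerAl -mulrDl; congr (_ * _).
  apply: (@eseq_lift_unique _ _ (fun k => c *: eseq_lift a k + eseq_lift b k)) => //.
    by rewrite !eseq_lift_self.
  by move=> j mj; rewrite !eseq_liftS // (star_homD (hg j)) (star_homZ (hg j)).
- move=> a b x y; apply: (@eseq_form_congl _ _ _ m) => k mk /=; rewrite mulrA; congr (_ * _).
  apply: (@eseq_lift_unique _ _ (fun k => eseq_lift a k * eseq_lift b k)) => //.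
    by rewrite !eseq_lift_self.
  by move=> j mj; rewrite !eseq_liftS // (star_homM (hg j)).
- move=> x y; apply: (@eseq_form_congl _ _ _ m) => k mk /=.
  rewrite (@eseq_lift_unique _ _ (fun=> 1)) ?mul1r // => j _.
  by rewrite (star_hom1 (hg j)).
- move=> a x y; have [N yN] := eseq_formP x (eseq_act (star a) y).
  apply: (@eseq_formE _ _ _ (maxn m N)) => k; rewrite geq_max => /andP[mk Nk].
  rewrite -[RHS]/(eseq_form x (eseq_act (star a) y)) -(yN k Nk) /=; congr psi; rewrite starM mulrA; congr (_ * _ * _).
  rewrite (@eseq_lift_unique _ (star a) (fun k => star (eseq_lift a k))) ?starK //.
    by rewrite eseq_lift_self.
  by move=> j mj; rewrite eseq_liftS // (star_homS (hg j)).
Qed.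

Context (L : cstarAlgType R) (iota : forall k, M k -> L).
Hypothesis hL : cstar_direct_limit gamma iota.

(** The representations of the M m agree along the connecting maps and therefore factor through L;
    the vector functional at the constant sequence 1 is the required extension. *)
Lemma limit_functional : (forall k (a : M k), bounded_elt a) ->
  exists2 Psi : L -> R[i], pfun Psi &
    forall k (x : M k), (N0 <= k)%N -> Psi (iota x) = psi x.
Proof.
move=> bM.
pose F m := sval (cid2 (eseq_representation (bM m))).
have hF m : star_hom (F m) := s2valP (cid2 (eseq_representation (bM m))).
have FE m (a : M m) : represents (P := eseq_space) (F m a) (eseq_act a) :=
  s2valP' (cid2 (eseq_representation (bM m))) a.
have [_ _ univ] := hL.
have [|f [[hf fE] _]] := univ _ F hF.
  move=> k a; apply: (represents_inj (FE _ _) (FE _ _)) => x y.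
  apply: (@eseq_form_congl _ _ _ k.+1) => j kj /=; congr (_ * _).
  apply: eseq_lift_unique => [|i ki|//]; first by rewrite eseq_liftS // eseq_lift_self.
  by rewrite eseq_liftS // ltnW.
pose v : hilbert_completion eseq_space := cembed (eseq1 : eseq_space).
exists (fun z => f z v v).
  exact: (pfun_comp hf (bop_pfun v)).
move=> k x N0k; rewrite fE FE; apply: (@eseq_formE _ _ _ k) => j kj /=.
rewrite star1 mul1r mulr1 -(subnK kj); elim: (j - k)%N => [|d <-].
  by rewrite eseq_lift_self.
by rewrite addSn eseq_liftS ?leq_addl // psi_compat // (leq_trans N0k) ?leq_addl.
Qed.

End EventuallyCompatible.

(** * Traces on the Bunce-Deddens algebra *)

Section MatrixUnits.
Context {R : realType} (B : starAlgType R) (n : nat).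
Hypothesis n0 : (0 < n)%N.
Implicit Types (x y : B) (i j k l : nat) (X Y : mxalg B n).
Local Notation sm := (@single_mx R B n).

Lemma single_mxE x i j (p q : 'I_n.-1.+1) :
  sm x i j p q = if (p == i :> nat) && (q == j :> nat) then x else 0.
Proof. by rewrite mxE. Qed.

Lemma mxalg_sumE I (r : seq I) (P : pred I) (F : I -> mxalg B n) p q :
  (\sum_(a <- r | P a) F a) p q = \sum_(a <- r | P a) F a p q.
Proof. by apply: (big_morph (fun X : mxalg B n => X p q)) => [X Y|]; rewrite mxE. Qed.

Lemma single_mx0 i j : sm 0 i j = 0.
Proof. by apply/matrixP => p q; rewrite single_mxE mxE if_same. Qed.

Lemma single_mx_lin (c : R[i]) x y i j : sm (c *: x + y) i j = c *: sm x i j + sm y i j.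
Proof. by apply/matrixP => p q; rewrite !mxE; case: ifP => // _; rewrite scaler0 addr0. Qed.

Lemma single_mx_star x i j : star (sm x i j) = sm (star x) j i.
Proof.
by apply/matrixP => p q; rewrite !mxE andbC; case: ifP => // _; rewrite star0.
Qed.

Lemma single_mxM x y i j k l : (j < n)%N ->
  sm x i j * sm y k l = if j == k then sm (x * y) i l else 0.
Proof.
move=> jn; have jn' : (j < n.-1.+1)%N by rewrite prednK.
apply/matrixP => p q; rewrite mxE (bigD1 (Ordinal jn')) //= !single_mxE /= eqxx andbT.
rewrite big1 ?addr0; last first.
  by move=> r; rewrite -val_eqE /= => /negbTE rj; rewrite !single_mxE rj andbF mul0r.
have [_|jk] := eqVneq j k; last by rewrite /= mulr0 mxE.
rewrite single_mxE; case: (p == i :> nat); case: (q == l :> nat) => //=;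
  by rewrite ?mulr0 ?mul0r.
Qed.

Lemma single_mx_decomp X : X = \sum_(p < n.-1.+1) \sum_(q < n.-1.+1) sm (X p q) p q.
Proof.
apply/matrixP => p q; rewrite mxalg_sumE (bigD1 p) //= [X in _ + X]big1 ?addr0; last first.
  move=> r rp; rewrite mxalg_sumE big1 // => s _.
  by rewrite single_mxE val_eqE eq_sym (negbTE rp).
rewrite mxalg_sumE (bigD1 q) //= [X in _ + X]big1 ?addr0 ?single_mxE ?eqxx //.
by move=> s sq; rewrite single_mxE !val_eqE [q == s]eq_sym (negbTE sq) andbF.
Qed.

Lemma single_mx_corner X : sm 1 0 0 * X * sm 1 0 0 = sm (X ord0 ord0) 0 0.
Proof.
apply/matrixP => p q; rewrite mxE (bigD1 ord0) //= mxE (bigD1 ord0) //= !single_mxE !eqxx /=.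
rewrite !andbT big1 ?addr0; last first.
  by move=> r; rewrite -val_eqE /= => /negbTE r0; rewrite single_mxE r0 andbF mul0r.
rewrite big1 ?addr0; last first.
  by move=> r; rewrite -val_eqE /= => /negbTE r0; rewrite single_mxE r0 mulr0.
case: (p == 0 :> nat); case: (q == 0 :> nat) => //=; by rewrite ?mul1r ?mulr1 ?mul0r ?mulr0.
Qed.

Lemma mx1_sum : 1 = \sum_(p < n.-1.+1) sm 1 p p :> mxalg B n.
Proof.
rewrite {1}[1]single_mx_decomp; apply: eq_bigr => p _; rewrite (bigD1 p) //= big1 ?addr0.
  by rewrite mxE eqxx.
by move=> q qp; rewrite mxE eq_sym (negbTE qp) single_mx0.
Qed.

Lemma pfun_corner (phi : mxalg B n -> R[i]) i : (i < n)%N -> pfun phi ->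
  pfun (fun x => phi (sm x i i)).
Proof.
move=> hi hp; split=> [c x y|x] /=.
  by rewrite single_mx_lin (pfunD hp) (pfunZ hp).
by have := pfun_ge0 hp (sm x i i); rewrite single_mx_star single_mxM // eqxx.
Qed.

Lemma pfun_diag (Phi : B -> R[i]) (p : 'I_n.-1.+1) : pfun Phi ->
  pfun (fun X : mxalg B n => Phi (X p p)).
Proof.
move=> hP; split=> [c X Y|X] /=; first by rewrite !mxE (pfunD hP) (pfunZ hP).
rewrite mxE (pfun_sum hP); apply: sumr_ge0 => q _; rewrite !mxE.
exact: pfun_ge0.
Qed.

Section MatrixTrace.
Variable T : mxalg B n -> R[i].
Hypothesis hT : pfun T.
Hypothesis Ttr : forall X Y, T (X * Y) = T (Y * X).

Lemma trace_single x i j : (i < n)%N -> (j < n)%N ->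
  T (sm x i j) = if i == j then T (sm x 0 0) else 0.
Proof.
move=> hi hj; have -> : sm x i j = sm x i 0 * sm 1 0 j by rewrite single_mxM // mulr1.
rewrite Ttr single_mxM // eq_sym mul1r; case: eqP => // _; exact: pfun0.
Qed.

Lemma trace_diag X : T X = \sum_(p < n.-1.+1) T (sm (X p p) 0 0).
Proof.
have hp (p : 'I_n.-1.+1) : (p < n)%N by rewrite -[X in (_ < X)%N](prednK n0).
rewrite {1}[X]single_mx_decomp (pfun_sum hT); apply: eq_bigr => p _.
rewrite (pfun_sum hT) (bigD1 p) //= big1 ?addr0; first by rewrite trace_single // eqxx.
by move=> q qp; rewrite trace_single // val_eqE eq_sym (negbTE qp).
Qed.

End MatrixTrace.

Definition mx_trace (Phi : B -> R[i]) X : R[i] :=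
  (n%:R^-1 : R)%:C * \sum_(p < n.-1.+1) Phi (X p p).

Lemma mx_trace_pfun Phi : pfun Phi -> pfun (mx_trace Phi).
Proof.
move=> hP; apply: pfun_scale; first by rewrite ler0c invr_ge0.
by apply: pfun_bigsum => p; exact: pfun_diag.
Qed.

Lemma mx_trace1 Phi : Phi 1 = 1 -> mx_trace Phi 1 = 1.
Proof.
move=> P1; rewrite /mx_trace (eq_bigr (fun=> 1)) => [|p _]; last by rewrite mxE eqxx.
rewrite sumr_const card_ord prednK // -(rmorph_nat (real_complex R)) -real_complexM.
by rewrite mulVf // pnatr_eq0 -lt0n.
Qed.

Lemma mx_trace_comm Phi X Y : pfun Phi -> (forall x y, Phi (x * y) = Phi (y * x)) ->
  mx_trace Phi (X * Y) = mx_trace Phi (Y * X).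
Proof.
move=> hP Ptr; congr (_ * _).
have E (U V : mxalg B n) : \sum_(p < n.-1.+1) Phi ((U * V) p p) =
    \sum_(p < n.-1.+1) \sum_(q < n.-1.+1) Phi (U p q * V q p).
  by apply: eq_bigr => p _; rewrite mxE (pfun_sum hP).
rewrite !E exchange_big /=; apply: eq_bigr => p _; apply: eq_bigr => q _.
exact: Ptr.
Qed.

Lemma mx_trace_single Phi x i j : Phi 0 = 0 -> (i < n)%N ->
  mx_trace Phi (sm x i j) = if i == j then (n%:R^-1 : R)%:C * Phi x else 0.
Proof.
move=> P0 hi; have hi' : (i < n.-1.+1)%N by rewrite prednK.
rewrite /mx_trace (bigD1 (Ordinal hi')) //= big1 ?addr0; last first.
  by move=> p; rewrite -val_eqE /= => /negbTE pi; rewrite single_mxE pi.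
by rewrite single_mxE /= eqxx /=; case: eqP => //; rewrite P0 mulr0.
Qed.

End MatrixUnits.

(** A sum of single entries x e_pq: a positive functional restricted to the corner at q is positive
    on the C*-algebra B, so it is bounded by |x|^2 phi(e_qq), and phi(e_qq) <= phi(1). *)
Lemma bounded_elt_mx {R : realType} (B : cstarAlgType R) (n : nat) (X : mxalg B n) :
  (0 < n)%N -> bounded_elt X.
Proof.
move=> n0; rewrite [X]single_mx_decomp; apply: bounded_elt_sum => p; apply: bounded_elt_sum => q.
have hp (r : 'I_n.-1.+1) : (r < n)%N by rewrite -[X in (_ < X)%N](prednK n0).
move: (X p q) => x; exists (nrm x ^+ 2) => [|phi hp']; first by rewrite exprn_ge0 ?nrm_ge0.
rewrite single_mx_star single_mxM // eqxx.
have hc := pfun_corner n0 (hp q) hp'.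
apply: le_trans (pfun_starM_le hc x) _; rewrite ler_wpM2l //.
  by rewrite ler0c exprn_ge0 ?nrm_ge0.
rewrite mx1_sum (pfun_sum hp') (bigD1 q) //= lerDl sumr_ge0 // => r _.
by have := pfun1_ge0 (pfun_corner n0 (hp r) hp').
Qed.

(** * The connecting maps on monomials *)

Section Connecting.
Context {R : realType} (A Bn Bm : starAlgType R) (alpha : A -> A) (n m : nat).
Context (pin : A -> Bn) (un : Bn) (pim : A -> Bm) (um : Bm).
Context (gamma : mxalg Bn n -> mxalg Bm m).
Hypotheses (n0 : (0 < n)%N) (m0 : (0 < m)%N) (nm : (n %| m)%N).
Hypothesis hg : bd_connecting alpha pin un pim um gamma.
Local Notation K := (m %/ n)%N.

Lemma connecting_hom : star_hom gamma. Proof. by case: hg. Qed.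

Let K0 : (0 < K)%N. Proof. by rewrite divn_gt0 // dvdn_leq. Qed.

Let idx l : (l < K)%N -> (l * n < m)%N.
Proof. by move=> lK; rewrite -(divnK nm) ltn_pmul2r. Qed.

(** Weights of the cyclic shift of block positions that is the image of u e_00: only the step from
    the last block back to the first carries u_m. *)
Let cyc s : Bm := if s == K.-1 then um else 1.

Lemma connecting_u : gamma (single_mx n un 0 0) =
  \sum_(s < K) single_mx m (cyc s) (s * n) ((s.+1 %% K) * n).
Proof.
have [_ _ _ -> _] := hg; rewrite -[in RHS](prednK K0) big_ord_recr /= addrC.
congr (_ + _); first by rewrite /cyc eqxx modnn mul0n.
apply: eq_bigr => s _; rewrite /cyc (ltn_eqF (ltn_ord s)) modn_small //.
by rewrite ltnS.
Qed.

(* Row l*n of the j-th power of gamma(u e_00) has its only entry in column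
   ((l+j) mod K)*n, and each wrap-around contributes a factor u_m. *)
Lemma connecting_monomial a j : gamma (single_mx n (pin a * un ^+ j) 0 0) =
  \sum_(l < K) single_mx m (pim (iter (l * n) alpha a) * um ^+ ((l + j) %/ K))
     (l * n) (((l + j) %% K) * n).
Proof.
elim: j => [|j IHj].
  have [_ _ gpi _ _] := hg; rewrite mulr1 gpi; apply: eq_bigr => l _.
  by rewrite addn0 (divn_small (ltn_ord l)) (modn_small (ltn_ord l)) mulr1.
have -> : single_mx n (pin a * un ^+ j.+1) 0 0 =
    single_mx n (pin a * un ^+ j) 0 0 * single_mx n un 0 0 :> mxalg Bn n.
  by rewrite single_mxM // eqxx exprSr mulrA.
rewrite (star_homM connecting_hom) IHj connecting_u mulr_suml; apply: eq_bigr => l _.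
have sK : ((l + j) %% K < K)%N by rewrite ltn_mod.
rewrite mulr_sumr (bigD1 (Ordinal sK)) //= big1 ?addr0; last first.
  move=> s; rewrite -val_eqE /= => /negbTE sl; rewrite single_mxM ?idx //.
  by rewrite eqn_pmul2r // eq_sym sl.
rewrite single_mxM ?idx // eqxx -mulrA addnS.
have E : (l + j).+1 = ((l + j) %/ K * K + ((l + j) %% K).+1)%N by rewrite addnS -divn_eq.
have [eqK|neK] := eqVneq ((l + j) %% K)%N K.-1.
  rewrite /cyc eqK eqxx prednK // modnn -exprSr E eqK prednK // -mulSnr.
  by rewrite mulnK // modnMl.
have ltK : (((l + j) %% K).+1 < K)%N.
  by rewrite -[X in (_ < X)%N](prednK K0) ltnS ltn_neqAle neK -ltnS prednK.
by rewrite /cyc (negbTE neK) mulr1 E divnMDl // (divn_small ltK) addn0 modnMDl.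
Qed.

End Connecting.

(** * States and traces on the limit algebra *)

Section BunceDeddens.
Context {R : realType} (A : cstarAlgType R) (alpha : A -> A) (n : nat -> nat).
Context (L : cstarAlgType R) (B : nat -> cstarAlgType R).
Context (pi : forall k, A -> B k) (u : forall k, B k).
Context (gamma : forall k, mxalg (B k) (n k) -> mxalg (B k.+1) (n k.+1)).
Context (iota : forall k, mxalg (B k) (n k) -> L).
Hypothesis halpha : star_automorphism alpha.
Hypothesis n_gt0 : forall k, (0 < n k)%N.
Hypothesis n_incr : forall k, (n k < n k.+1)%N.
Hypothesis n_dvd : forall k, (n k %| n k.+1)%N.
Hypothesis hcp : forall k, crossed_product (iter (n k) alpha) (pi k) (u k).
Hypothesis hbd : forall k, bd_connecting alpha (pi k) (u k) (pi k.+1) (u k.+1) (@gamma k).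
Hypothesis hlim : cstar_direct_limit gamma iota.

Local Notation K k := (n k.+1 %/ n k)%N.
Local Notation sm k := (@single_mx R (B k) (n k)).

Let hbeta k : star_automorphism (iter (n k) alpha) := star_automorphism_iter (n k) halpha.
Let hpi k : star_hom (pi k) := cp_star_hom (hcp k).
Let hgam k : star_hom (@gamma k) := connecting_hom (hbd k).
Let hio k : star_hom (@iota k) := limit_hom hlim k.

Let K_gt1 k : (1 < K k)%N.
Proof.
have := n_incr k; rewrite -{1}(divnK (n_dvd k)) -[X in (X < _)%N]mul1n.
by rewrite ltn_pmul2r.
Qed.

Lemma n_dvd_le k m : (k <= m)%N -> (n k %| n m)%N.
Proof.
move=> /subnK <-; elim: (m - k)%N => [|d IH] //.
exact: dvdn_trans IH (n_dvd _).
Qed.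

Let Kpos k : (0 < K k)%N := ltnW (K_gt1 k).

Let gamma_monomial k a j : gamma (sm k (pi k a * u k ^+ j) 0 0) =
  \sum_(l < K k) sm k.+1 (pi k.+1 (iter (l * n k) alpha a) * u k.+1 ^+ ((l + j) %/ K k))
     (l * n k) (((l + j) %% K k) * n k).
Proof. exact: (connecting_monomial (n_gt0 k) (n_gt0 k.+1) (n_dvd k) (hbd k)). Qed.

(** The image of e_00 is a sum of diagonal units containing e_00, so the later corner lies inside
    the image of the earlier one. *)
Let corner_unit k : sm k.+1 1 0 0 * gamma (sm k 1 0 0) = sm k.+1 1 0 0.
Proof.
have := gamma_monomial k 1 0; rewrite (star_hom1 (hpi k)) mulr1 => ->.
rewrite mulr_sumr (bigD1 (Ordinal (Kpos k))) //= big1 ?addr0.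
  rewrite single_mxM // mul0n eqxx addn0 div0n mod0n mul0n /= (star_hom1 (hpi _)) !mulr1 //.
move=> l; rewrite -val_eqE /= => l0; rewrite single_mxM // eq_sym muln_eq0 -[(n k == 0)%N]negbK -lt0n n_gt0 orbF.
by rewrite (negbTE l0).
Qed.

Let corner_unit' k : gamma (sm k 1 0 0) * sm k.+1 1 0 0 = sm k.+1 1 0 0.
Proof.
apply: (can_inj (@starK _ _)); rewrite starM -(star_homS (hgam k)) !single_mx_star !star1.
exact: corner_unit.
Qed.

Section CornerState.
Variables (phi : A -> R[i]) (Phi : forall k, B k -> R[i]).
Hypotheses (hPhi : forall k, pfun (@Phi k)) (ext : forall k, cp_extends (pi k) (u k) phi (@Phi k)).

(** The (0,0) entry of the image of a u^j e_00 comes from the term l = 0, where a appears untwisted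
    by alpha. Hence corner functionals are compatible even when phi is not invariant, unlike
    normalised traces. *)
Lemma corner_compat k (X : mxalg (B k) (n k)) :
  Phi (gamma X ord0 ord0) = Phi (X ord0 ord0).
Proof.
have single b : Phi (gamma (sm k b 0 0) ord0 ord0) = Phi b.
  move: b; apply: (pfun_cp_eq (hbeta k) (hcp k)) => //.
    exact: (pfun_corner (n_gt0 k) (n_gt0 k)
      (pfun_comp (hgam k) (pfun_diag ord0 (hPhi k.+1)))).
  move=> a j; rewrite gamma_monomial mxalg_sumE (bigD1 (Ordinal (Kpos k))) //= big1 ?addr0.
    rewrite single_mxE /= ?add0n ?mul0n ?eqxx /= [(0 == _)%N]eq_sym muln_eq0 -[(n k == 0)%N]negbK.
    rewrite -lt0n n_gt0 orbF !ext; case: eqP => [jK|jK].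
      rewrite ext; case: (j =P 0)%N => [->|j0]; first by rewrite div0n.
      case: eqP => // jK'; exfalso; apply: j0.
      by rewrite (divn_eq j (K k)) jK jK'.
    rewrite (pfun0 (hPhi _)); case: eqP => // j0.
    by case: jK; rewrite j0 mod0n.
  move=> l; rewrite -val_eqE /= => l0; rewrite single_mxE /= [(0 == _)%N]eq_sym muln_eq0 -[(n k == 0)%N]negbK -lt0n.
  by rewrite n_gt0 orbF (negbTE l0).
have corner (Z : mxalg (B k.+1) (n k.+1)) : Phi (Z ord0 ord0) =
    Phi ((sm k.+1 1 0 0 * Z * sm k.+1 1 0 0 : mxalg _ _) ord0 ord0).
  by rewrite single_mx_corner // single_mxE.
have E : sm k.+1 1 0 0 * gamma X * sm k.+1 1 0 0 =
    sm k.+1 1 0 0 * gamma (sm k 1 0 0 * X * sm k 1 0 0) * sm k.+1 1 0 0.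
  rewrite !(star_homM (hgam k)) !mulrA corner_unit -(mulrA _ (gamma (sm k 1 0 0))).
  by rewrite corner_unit'.
by rewrite corner E -corner single_mx_corner // single.
Qed.

End CornerState.

Lemma state_extension phi : pfun phi -> phi 1 = 1 ->
  exists2 Psi : L -> R[i], pfun Psi &
    forall k a, Psi (iota (sm k (pi k a) 0 0)) = phi a.
Proof.
move=> hp p1.
pose Phi k := sval (cid2 (cp_extension (hbeta k) (hcp k) hp p1)).
have hPhi k : pfun (Phi k) := s2valP (cid2 (cp_extension (hbeta k) (hcp k) hp p1)).
have ext k : cp_extends (pi k) (u k) phi (Phi k) :=
  s2valP' (cid2 (cp_extension (hbeta k) (hcp k) hp p1)).
have Phi1 k : Phi k 1 = 1.
  by rewrite -(star_hom1 (hpi k)) (ext_pi (ext k)) p1.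
have [||||Psi hPsi PsiE] := @limit_functional R _ _ hgam (fun k (X : mxalg (B k) (n k)) =>
  Phi k (X ord0 ord0)) _ _ 0 _ L iota hlim.
- by move=> k; exact: pfun_diag.
- by move=> k; rewrite mxE eqxx.
- by move=> k X _; exact: corner_compat.
- by move=> k X; exact: bounded_elt_mx.
exists Psi => // k a; rewrite PsiE // single_mxE /=; exact: ext_pi (ext k) a.
Qed.

Lemma invariant_iter (rho : A -> R[i]) k l a : (forall a, rho (iter (n k) alpha a) = rho a) ->
  rho (iter (l * n k) alpha a) = rho a.
Proof.
move=> inv; elim: l => [|l IHl] //.
by rewrite mulSn iterD inv.
Qed.

(** The conclusion keeps T as an explicit matrix trace at each level: this form serves both to
    recover rho by restriction and to transfer faithfulness. *)
Lemma trace_extension k0 rho : invariant_tracial_state (iter (n k0) alpha) rho ->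
  exists2 T : L -> R[i], tracial_state T & forall k, (k0 <= k)%N ->
    exists Phi : B k -> R[i], [/\ pfun Phi, cp_extends (pi k) (u k) rho Phi &
      forall X, T (iota X) = mx_trace Phi X].
Proof.
move=> [htr inv]; have [rl rp r1 rtr] := htr; have hp : pfun rho by split.
pose Phi k := sval (cid2 (cp_extension (hbeta k) (hcp k) hp r1)).
have hPhi k : pfun (Phi k) := s2valP (cid2 (cp_extension (hbeta k) (hcp k) hp r1)).
have ext k : cp_extends (pi k) (u k) rho (Phi k) :=
  s2valP' (cid2 (cp_extension (hbeta k) (hcp k) hp r1)).
have Phi1 k : Phi k 1 = 1.
  by rewrite -(star_hom1 (hpi k)) (ext_pi (ext k)) r1.
have invk k : (k0 <= k)%N -> forall a, rho (iter (n k) alpha a) = rho a.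
  move=> kk a; rewrite -(divnK (n_dvd_le kk)); exact: invariant_iter.
have Ptr k : (k0 <= k)%N -> forall x y, Phi k (x * y) = Phi k (y * x).
  move=> kk; have [_ _ _ h] := ext_trace (hbeta k) (hcp k) hp (hPhi k) (ext k) htr (invk k kk).
  exact: h.
pose T k := @mx_trace R (B k) (n k) (Phi k).
have hT k : pfun (T k) by apply: mx_trace_pfun.
have Ttr k : (k0 <= k)%N -> forall X Y, T k (X * Y) = T k (Y * X).
  by move=> kk X Y; apply: mx_trace_comm => //; exact: Ptr.
have single k b : T k (sm k b 0 0) = ((n k)%:R^-1 : R)%:C * Phi k b.
  by rewrite /T mx_trace_single // (pfun0 (hPhi k)).
have compat k X : (k0 <= k)%N -> T k.+1 (gamma X) = T k X.
  move=> kk; have kk1 : (k0 <= k.+1)%N := leqW kk.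
  rewrite (trace_diag (n_gt0 k) (hT k) (Ttr k kk)).
  have Tg : pfun (fun X => T k.+1 (gamma X)) := pfun_comp (hgam k) (hT k.+1).
  rewrite (trace_diag (n_gt0 k) Tg); last first.
    by move=> Y Z; rewrite !(star_homM (hgam k)) Ttr.
  apply: eq_bigr => p _; move: (X p p); apply: (pfun_cp_eq (hbeta k) (hcp k)).
  - exact: (pfun_corner (n_gt0 k) (n_gt0 k) Tg).
  - exact: (pfun_corner (n_gt0 k) (n_gt0 k) (hT k)).
  move=> a j; rewrite single ext gamma_monomial (pfun_sum (hT _)).
  have lK (l : 'I_(K k)) : (l * n k < n k.+1)%N.
    by rewrite -[X in (_ < X)%N](divnK (n_dvd k)) ltn_pmul2r.
  case: eqP => [->|/eqP j0].
    (* For j = 0 each of the K diagonal terms contributes rho(a)/n_(k+1) by invariance, and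
       K/n_(k+1) = 1/n_k. *)
    rewrite (eq_bigr (fun=> ((n k.+1)%:R^-1 : R)%:C * rho a)) => [|l _].
      rewrite sumr_const card_ord -mulrnAl; congr (_ * _).
      rewrite -(rmorphMn (real_complex R)); congr (_%:C).
      rewrite -{1}(divnK (n_dvd k)) natrM invfM -mulr_natr mulrAC mulVf ?mul1r //.
      by rewrite pnatr_eq0 -lt0n.
    rewrite addn0 (divn_small (ltn_ord l)) (modn_small (ltn_ord l)).
    rewrite /T mx_trace_single ?(pfun0 (hPhi _)) // eqxx ext eqxx.
    by rewrite (invariant_iter _ _ (invk k kk)).
  rewrite mulr0 big1 // => l _.
  rewrite /T mx_trace_single ?(pfun0 (hPhi _)) // eqn_pmul2r // ext.
  (* A nonzero term would need (l + j) mod K = l together with quotient 0, which forces j = 0. *)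
  case: eqP => // lj; case: eqP => [lj0|_]; last by rewrite mulr0.
  have := divn_eq (l + j) (K k); rewrite lj0 mul0n add0n -lj => /eqP.
  by rewrite -[X in _ == X]addn0 eqn_add2l (negbTE j0).
have [||||Psi hPsi PsiE] := @limit_functional R _ _ hgam T _ _ k0 _ L iota hlim.
- by [].
- by move=> k; apply: mx_trace1.
- exact: compat.
- by move=> k X; exact: bounded_elt_mx.
exists Psi; last by move=> k kk; exists (Phi k); split => // X; rewrite PsiE.
have [Psil Psip] := hPsi; split=> //.
  by rewrite -(star_hom1 (hio k0)) PsiE //; apply: mx_trace1.
apply: (limit_trace hlim (N0 := k0)) => // k X Y kk.
by rewrite -!(star_homM (hio k)) !PsiE // Ttr.
Qed.

(** The factor n_k compensates for tau(e_00) = 1/n_k. Invariance holds because alpha^(n_k) is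
    implemented by conjugation with u_k. *)
Lemma trace_restriction tau k : tracial_state tau ->
  invariant_tracial_state (iter (n k) alpha)
    (fun a => ((n k)%:R : R)%:C * tau (iota (sm k (pi k a) 0 0))).
Proof.
move=> [tl tp t1 ttr]; have ht : pfun tau by split.
have hti : pfun (fun X => tau (@iota k X)) := pfun_comp (hio k) ht.
have hc := pfun_comp (hpi k) (pfun_corner (n_gt0 k) (n_gt0 k) hti).
have titr X Y : tau (@iota k (X * Y)) = tau (iota (Y * X)).
  by rewrite !(star_homM (hio k)) ttr.
have scaled : pfun (fun a => ((n k)%:R : R)%:C * tau (iota (sm k (pi k a) 0 0))).
  by apply: (pfun_scale _ hc); rewrite ler0c.
have [sl sp] := scaled; split; first split=> //.
- rewrite (star_hom1 (hpi k)) -t1 -(star_hom1 (hio k)) [RHS](trace_diag (n_gt0 k) hti titr).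
  rewrite (eq_bigr (fun=> tau (iota (sm k 1 0 0)))) => [|p _]; last first.
    by congr (tau (iota (single_mx _ _ 0 0))); rewrite mxE eqxx.
  by rewrite sumr_const card_ord prednK // -[RHS]mulr_natl -(rmorph_nat (real_complex R)).
- move=> x y; congr (_ * _); rewrite !(star_homM (hpi k)).
  have E (b c : B k) : sm k (b * c) 0 0 = sm k b 0 0 * sm k c 0 0.
    by rewrite single_mxM // eqxx.
  by rewrite !E titr.
move=> a; congr (_ * _).
have -> : pi k (iter (n k) alpha a) = u k * (pi k a * star (u k)).
  by rewrite mulrA; case: (hcp k) => -[_ _ ->].
have E (b c : B k) : sm k (b * c) 0 0 = sm k b 0 0 * sm k c 0 0.
  by rewrite single_mxM // eqxx.
rewrite E titr -E -mulrA.
by rewrite (cp_uu (hcp k)) mulr1.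
Qed.

Lemma trace_monomial_eq0 tau : tracial_state tau -> forall j k a, (0 < j)%N ->
  tau (iota (sm k (pi k a * u k ^+ j) 0 0)) = 0.
Proof.
move=> [tl tp t1 ttr]; have ht : pfun tau by split.
elim/ltn_ind => j IHj k a j0.
have hti : pfun (fun X => tau (@iota k.+1 X)) := pfun_comp (hio k.+1) ht.
have titr X Y : tau (@iota k.+1 (X * Y)) = tau (iota (Y * X)).
  by rewrite !(star_homM (hio k.+1)) ttr.
rewrite -(limit_compat hlim) gamma_monomial (pfun_sum hti) big1 // => l _.
have lK (s : nat) : (s < K k)%N -> (s * n k < n k.+1)%N.
  by move=> sK; rewrite -[X in (_ < X)%N](divnK (n_dvd k)) ltn_pmul2r.
rewrite (trace_single (n_gt0 k.+1) hti titr) ?lK ?ltn_mod //.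
rewrite eqn_pmul2r //; case: eqP => // lj.
have E := divn_eq (l + j) (K k); rewrite -lj in E.
(* On the diagonal the new exponent q = (l + j) / K satisfies j = q K; since j > 0 and K > 1, it
   lies strictly between 0 and j. *)
have jE : (j = (l + j) %/ K k * K k)%N by move: E; lia.
apply: IHj.
  rewrite [X in (_ < X)%N]jE -[X in (X < _)%N]muln1 ltn_pmul2l //.
  by rewrite lt0n; apply: contraTneq j0 => q0; rewrite jE q0.
by rewrite lt0n; apply: contraTneq j0 => q0; rewrite jE q0.
Qed.

Lemma trace_unique tau tau' : tracial_state tau -> tracial_state tau' ->
  (forall k a, tau (iota (sm k (pi k a) 0 0)) = tau' (iota (sm k (pi k a) 0 0))) ->
  tau = tau'.
Proof.
move=> ht ht' E; have [tl tp _ ttr] := ht; have [tl' tp' _ ttr'] := ht'.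
have hp : pfun tau by split. have hp' : pfun tau' by split.
apply: (limit_pfun_eq hlim) => // k X.
have hti : pfun (fun X => tau (@iota k X)) := pfun_comp (hio k) hp.
have hti' : pfun (fun X => tau' (@iota k X)) := pfun_comp (hio k) hp'.
rewrite (trace_diag (n_gt0 k) hti); last by move=> ? ?; rewrite !(star_homM (hio k)) ttr.
rewrite (trace_diag (n_gt0 k) hti'); last by move=> ? ?; rewrite !(star_homM (hio k)) ttr'.
apply: eq_bigr => p _; move: (X p p); apply: (pfun_cp_eq (hbeta k) (hcp k)).
- exact: (pfun_corner (n_gt0 k) (n_gt0 k) hti).
- exact: (pfun_corner (n_gt0 k) (n_gt0 k) hti').
move=> a [|j]; first by rewrite mulr1 E.
by rewrite !trace_monomial_eq0.
Qed.

End BunceDeddens.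

(** * Faithfulness *)

Section FaithfulRepresentation.
Context {R : realType} (L : cstarAlgType R) (tau : L -> R[i]).
Hypothesis htau : tracial_state tau.

Let ht : pfun tau. Proof. by case: htau. Qed.

Lemma gns_unitE : tau (star 1 * 1) = 1.
Proof. by case: htau => _ _ t1 _; rewrite star1 mulr1 t1. Qed.

Definition gns_space : preHilbert R := PreHilbert (pfun_semi_inner ht) gns_unitE.

(** For a trace the left kernel is a two-sided ideal: tau(z* x y) = tau(y z* x) vanishes by
    Cauchy-Schwarz when tau(x* x) does. Conversely, pairing x 1 with x returns tau(x* x). *)
Lemma gns_representation : exists (C : cstarAlgType R) (F : L -> C), star_hom F /\
  forall x, F x = 0 <-> tau (star x * x) = 0.
Proof.
have [||||||F hF FE] := @star_representation R L gns_space (fun a x => a * x).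
- by move=> a x y; exact: mulrBr.
- move=> c a b x y; rewrite /= mulrDl mulrDr -scalerAl -scalerAr.
  by rewrite (pfunD ht) (pfunZ ht).
- by move=> a b x y; rewrite /= !mulrA.
- by move=> x y; rewrite /= mul1r.
- by move=> a x y; rewrite /= starM starK !mulrA.
- exact: bounded_elt_cstar.
exists (bop (hilbert_completion gns_space)), F; split=> // x; split=> [Fx|x0].
  have := FE x (1 : L) (x : L); rewrite Fx bop0E /= mulr1.
  by move=> <-.
have [_ _ _ ttr] := htau.
rewrite -(star_hom0 hF); apply: (represents_inj (FE x) (FE 0)) => y z /=.
by rewrite mul0r mulr0 mulrA ttr mulrA (pfun0 ht) (pfun_null ht).
Qed.

End FaithfulRepresentation.

(** If s < r then C (s/r)^N tends to 0 and cannot stay above 1. Powers of two suffice, and these are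
    what repeated use of the C*-identity provides. *)
Lemma le_of_pow2_le {R : realType} (r s C : R) : 0 <= r -> 0 <= s ->
  (forall j, r ^+ (2 ^ j) <= C * s ^+ (2 ^ j)) -> r <= s.
Proof.
move=> r0 s0 H; rewrite leNgt; apply/negP => sr.
have rp : 0 < r := le_lt_trans s0 sr.
have q1 : `|s / r| < 1.
  by rewrite ger0_norm ?divr_ge0 // ltr_pdivrMr // mul1r.
have hq : (fun k => C * (s / r) ^+ k) @ \oo --> (0 : R).
  by rewrite -(mulr0 C); apply: cvgMr; exact: cvg_expr.
have /cvgrPdist_lt/(_ 1 ltr01)[N _ HN] := hq.
have := HN (2 ^ N)%N (ltnW (ltn_expl N (ltnSn 1))).
rewrite /= sub0r normrN => /(le_lt_trans (ler_norm _)); apply/negP; rewrite -leNgt.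
by rewrite expr_div_n mulrA ler_pdivlMr ?exprn_gt0 // mul1r H.
Qed.

(** * Isometry on matrix algebras *)

Section MatrixNorms.
Context {R : realType} (B L C : cstarAlgType R) (n : nat).
Context (iota : mxalg B n -> L) (F : L -> C).
Hypothesis n0 : (0 < n)%N.
Hypothesis hi : star_hom iota.
Hypothesis hF : star_hom F.
Local Notation sm := (@single_mx R B n).

Definition scalar_embed (b : B) : mxalg B n := \sum_(p < n.-1.+1) sm b p p.

Let lt_n (p : 'I_n.-1.+1) : (p < n)%N.
Proof. by rewrite -[X in (_ < X)%N](prednK n0). Qed.

Lemma scalar_embed_single b c i j : (i < n)%N -> scalar_embed b * sm c i j = sm (b * c) i j.
Proof.
move=> hi'; have hi2 : (i < n.-1.+1)%N by rewrite prednK.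
rewrite mulr_suml (bigD1 (Ordinal hi2)) //= big1 ?addr0.
  by rewrite single_mxM // eqxx.
by move=> p; rewrite -val_eqE /= => /negbTE pi; rewrite single_mxM // pi.
Qed.

Lemma scalar_embed_hom : star_hom scalar_embed.
Proof.
split.
- move=> c x y; rewrite /scalar_embed scaler_sumr -big_split; apply: eq_bigr => p _.
  exact: single_mx_lin.
- split; first by rewrite /= /scalar_embed -mx1_sum.
  move=> x y; rewrite [scalar_embed y]/scalar_embed mulr_sumr; apply: eq_bigr => p _.
  by rewrite scalar_embed_single.
- move=> x; rewrite /scalar_embed star_sum; apply: eq_bigr => p _.
  by rewrite single_mx_star.
Qed.

(** Recovers an entry, spread along the diagonal, by multiplications and sums only, so that it can
    be read off in any homomorphic image. *)
Lemma scalar_embed_entry (X : mxalg B n) (p q : 'I_n.-1.+1) :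
  scalar_embed (X p q) = \sum_(r < n.-1.+1) sm 1 r p * X * sm 1 q r.
Proof.
apply: eq_bigr => r _.
rewrite [in RHS](single_mx_decomp X) -mulrA mulr_suml (mulr_sumr _ _ _ (sm 1 r p)).
rewrite (bigD1 p) //= [X in _ + X]big1 ?addr0.
  rewrite mulr_suml (mulr_sumr _ _ _ (sm 1 r p)) (bigD1 q) //= [X in _ + X]big1 ?addr0.
    by rewrite !single_mxM // eqxx mulr1 single_mxM // eqxx mul1r.
  by move=> s; rewrite -val_eqE /= => /negbTE sq; rewrite single_mxM // sq mulr0.
move=> s; rewrite -val_eqE /= eq_sym => /negbTE sp.
rewrite mulr_suml (mulr_sumr _ _ _ (sm 1 r p)) big1 // => t _.
by rewrite mulrA single_mxM // sp mul0r.
Qed.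

Lemma nrm_sum_le (D : normedStarAlgType R) I (r : seq I) (G : I -> D) :
  nrm (\sum_(i <- r) G i) <= \sum_(i <- r) nrm (G i).
Proof.
elim: r => [|i r IHr]; first by rewrite !big_nil nrm0.
by rewrite !big_cons (le_trans (nrmD _ _)) // lerD2l.
Qed.

Hypothesis injF : forall b : B, F (iota (scalar_embed b)) = 0 -> b = 0.

(* Entrywise bounds make the two norms on iota(M_n(B)) equivalent; equivalent
   C*-norms agree, by the C*-identity applied to the powers h^(2^j). *)
Lemma matrix_isometry (X : mxalg B n) : nrm (iota X) <= nrm (F (iota X)).
Proof.
have hd := star_hom_comp scalar_embed_hom hi.
have hFd := star_hom_comp hd hF.
have isoB b : nrm (F (iota (scalar_embed b))) = nrm b.
  apply: (star_hom_isometry hFd) => x y xy; apply/subr0_eq/injF.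
  by have := star_homB hFd x y; rewrite /= => ->; rewrite [F _]xy subrr.
pose c p q := nrm (F (iota (sm 1 p q))).
pose e p q := nrm (iota (sm 1 p q)).
(* Entries of a matrix are extracted in [C], at a cost of c r p * c q r, and the matrix is
   reassembled from them in [L], at a cost of e p q. *)
pose K := \sum_(p < n.-1.+1) \sum_(q < n.-1.+1) (\sum_(r < n.-1.+1) c r p * c q r) * e p q.
have bound Y : nrm (iota Y) <= K * nrm (F (iota Y)).
  rewrite {1}[Y](single_mx_decomp Y) (star_hom_sum hi) mulr_suml.
  apply: le_trans (nrm_sum_le _ _) _; apply: ler_sum => p _.
  rewrite (star_hom_sum hi) mulr_suml.
  apply: le_trans (nrm_sum_le _ _) _; apply: ler_sum => q _.
  rewrite -[Y p q]mulr1 -scalar_embed_single // (star_homM hi) (le_trans (nrmM _ _)) // mulrAC.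
  rewrite ler_wpM2r ?nrm_ge0 //.
  apply: le_trans (star_hom_nrm hd _) _; rewrite -isoB scalar_embed_entry.
  rewrite (star_hom_sum hi) (star_hom_sum hF) mulr_suml.
  apply: le_trans (nrm_sum_le _ _) _; apply: ler_sum => r _.
  rewrite !(star_homM hi) !(star_homM hF) mulrAC.
  by rewrite (le_trans (nrmM _ _)) // ler_wpM2r ?nrm_ge0 // nrmM.
rewrite -(ler_pXn2r (n := 2)) ?nnegrE ?nrm_ge0 // -!nrm_starM -(star_homS hF) -(star_homM hF).
rewrite -(star_homS hi) -(star_homM hi).
set h := star X * X; have sh : sa h := saJ X.
have pw (D : cstarAlgType R) (g : mxalg B n -> D) : star_hom g ->
    forall j, nrm (g (h ^+ (2 ^ j))) = nrm (g h) ^+ (2 ^ j).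
  move=> hg; elim=> [|j IHj] //.
  rewrite expnS mulnC exprM [_ ^+ 2]expr2 (star_homM hg).
  have sj : sa (g (h ^+ (2 ^ j))).
    by apply: (star_hom_sa hg); rewrite /sa starX sh.
  by rewrite -{1}sj nrm_starM IHj -exprM.
apply: (@le_of_pow2_le _ _ _ K); try exact: nrm_ge0.
by move=> j; rewrite -(pw _ _ hi) -(pw _ _ (star_hom_comp hi hF)); exact: bound.
Qed.

End MatrixNorms.

Theorem proposition3p1 (R : realType) (A : cstarAlgType R) (alpha : A -> A)
    (n : nat -> nat) (L : cstarAlgType R)
    (sepA : separable_space (normed_space A))
    (halpha : star_automorphism alpha)
    (n_gt0 : forall k : nat, (0 < n k)%N)
    (n_incr : forall k : nat, (n k < n k.+1)%N)
    (n_dvd : forall k : nat, (n k %| n k.+1)%N)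
    (hL : bunce_deddens alpha n L) :
  ((exists! tau : L -> R[i], tracial_state tau) <->
   (exists tau0 : A -> R[i],
      invariant_tracial_state alpha tau0 /\
      forall k : nat,
        unique (invariant_tracial_state (iter (n k) alpha)) tau0)) /\
  (forall (tau : L -> R[i]) (tau0 : A -> R[i]),
     unique (@tracial_state R L) tau ->
     invariant_tracial_state alpha tau0 ->
     (forall k : nat,
        unique (invariant_tracial_state (iter (n k) alpha)) tau0) ->
     (faithful tau <-> faithful tau0)).
Proof.
have [B [pi [u [gamma [iota [hcp hbd hlim]]]]]] := hL.
have ext := trace_extension halpha n_gt0 n_incr n_dvd hcp hbd hlim.
have restr := trace_restriction n_gt0 hcp hlim.
have nK k : ((n k)%:R : R)%:C * (((n k)%:R^-1 : R)%:C) = 1 :> R[i].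
  by rewrite -real_complexM mulfV // pnatr_eq0 -lt0n.
(* Restriction to A at level k, normalised to be a state. *)
pose corner k (tau : L -> R[i]) a := ((n k)%:R : R)%:C * tau (iota k (single_mx (n k) (pi k a) 0 0)).
have extE k rho T : (exists Phi : B k -> R[i], [/\ pfun Phi, cp_extends (pi k) (u k) rho Phi &
      forall X, T (iota k X) = mx_trace Phi X]) -> corner k T = rho.
  move=> [Phi [hP Pe TE]]; apply/funext => a; rewrite /corner TE.
  by rewrite mx_trace_single ?(pfun0 hP) // eqxx mulrA nK mul1r (ext_pi Pe).
split; last first.
  move=> tau tau0 [htau Utau] [ht0 inv0] U0.
  have [hk0 _] := U0 0%N; have [T hT TE] := ext 0%N tau0 hk0.
  (* Uniqueness identifies tau with the extension of tau0, so its values at each level become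
     explicit matrix traces. *)
  have tauT : tau = T := Utau _ hT; subst T.
  have [_ p0 t01 _] := ht0.
  split.
    move=> ftau a a0.
    have [Phi [hP Pe TPhi]] := TE 0%N (leq0n _).
    have hi := limit_hom hlim 0.
    have z0 : iota 0%N (single_mx (n 0%N) (pi 0%N a) 0 0) = 0.
      apply: ftau; rewrite -(star_homS hi) -(star_homM hi) single_mx_star single_mxM // eqxx.
      rewrite TPhi mx_trace_single ?(pfun0 hP) // eqxx.
      have hpi := cp_star_hom (hcp 0%N).
      by rewrite -(star_homS hpi) -(star_homM hpi) (ext_pi Pe) a0 mulr0.
    (* The injectivity of the embedding of A in L is not assumed: a state with phi(a* a) = |a|^2,
       extended to L, detects a. *)
    have [phi [hp p1 pE]] := state_exists a.
    have [Psi hPsi PsiE] := state_extension halpha n_gt0 n_incr n_dvd hcp hbd hlim hp p1.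
    have := PsiE 0%N (star a * a).
    have hpi := cp_star_hom (hcp 0%N).
    have -> : single_mx (n 0%N) (pi 0%N (star a * a)) 0 0 =
        single_mx (n 0%N) (pi 0%N (star a)) 0 0 * single_mx (n 0%N) (pi 0%N a) 0 0.
      by rewrite single_mxM // eqxx (star_homM hpi).
    rewrite (star_homM hi) z0 mulr0 (pfun0 hPsi) pE => /esym/complexI/eqP.
    by rewrite sqrf_eq0 => /eqP; exact: nrm0_eq0.
  move=> f0 x x0.
  have [C [F [hF F0]]] := gns_representation htau.
  suff injF : injective F by apply: injF; rewrite (star_hom0 hF); apply/F0.
  apply: (limit_isometry hlim hF) => k X.
  apply: matrix_isometry => //; first exact: limit_hom hlim k.
  move=> b /F0.
  have hi := limit_hom hlim k; have hd := @scalar_embed_hom R (B k) (n k) (n_gt0 k).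
  rewrite -(star_homS hi) -(star_homM hi) -(star_homS hd) -(star_homM hd).
  have [Phi [hP Pe TPhi]] := TE k (leq0n _).
  have hp0 : pfun tau0 by case: ht0.
  have fPhi := cp_faithful (star_automorphism_iter (n k) halpha) (hcp k) hp0 hP Pe f0.
  (* The normalised trace of the diagonal matrix with entries b* b is Phi(b* b). *)
  rewrite TPhi => h; apply: fPhi; move: h.
  rewrite (pfun_sum (mx_trace_pfun _ hP)) (eq_bigr (fun=> ((n k)%:R^-1 : R)%:C * Phi (star b * b))).
    rewrite sumr_const card_ord prednK // -[LHS]mulr_natl mulrA -(rmorph_nat (real_complex R)).
    by rewrite nK mul1r.
  move=> p _; rewrite mx_trace_single ?(pfun0 hP) ?eqxx //.
  by rewrite -[X in (_ < X)%N](prednK (n_gt0 k)).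
split.
  move=> [tau [htau Utau]].
  have key k rho : invariant_tracial_state (iter (n k) alpha) rho -> corner k tau = rho.
    move=> hr; have [T hT TE] := ext k rho hr.
    by rewrite (Utau _ hT); apply: extE; exact: TE.
  have sinv k : invariant_tracial_state alpha (corner k tau).
    have [ht hi] := restr tau k htau; split => // a.
    have [ha _] := halpha; have [cl cp c1 ctr] := ht.
    (* Invariance under alpha^(n_k) persists because alpha commutes with its powers; [key] then
       returns the restriction itself. *)
    have h : invariant_tracial_state (iter (n k) alpha) (corner k tau \o alpha).
      have hp : pfun (corner k tau) by split.
      have [l' p'] := pfun_comp ha hp.
      split; first split=> //; rewrite /=.
      + by rewrite (star_hom1 ha).
      + by move=> x y; rewrite !(star_homM ha); exact: ctr.
      + by move=> x /=; rewrite -iterS iterSr; exact: hi.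
    by rewrite [in RHS](key k _ h).
  have all0 k : corner k tau = corner 0%N tau.
    apply: key; have [ht hi] := sinv 0%N; split=> // a.
    by elim: (n k) => [|m IHm] //=; rewrite hi.
  exists (corner 0%N tau); split; first exact: sinv.
  move=> k; split; first by rewrite -(all0 k); exact: restr.
  by move=> rho hr; rewrite -(all0 k); exact: key.
move=> [tau0 [[ht0 inv0] U0]].
have [hk0 _] := U0 0%N; have [T hT TE] := ext 0%N tau0 hk0.
exists T; split=> // tau' ht'.
apply: (trace_unique halpha n_gt0 n_incr n_dvd hcp hbd hlim hT ht') => k a.
have E1 := extE k tau0 T (TE k (leq0n _)).
(* Uniqueness on A is invoked at every level k, since a trace on the limit is determined by all its
   restrictions together. *)
have E2 : tau0 = corner k tau' by have [_ Uk] := U0 k; apply: Uk; exact: restr.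
have := congr1 (fun f => f a) (etrans E1 E2); rewrite /corner.
apply: mulfI; apply/eqP => nk0; have := nK k.
by rewrite nk0 mul0r => /eqP; rewrite eq_sym oner_eq0.
Qed.
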